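(* There exist real numbers $p_0$ and $p_1$ with $1<p_0<\frac32$ and $p_1>\frac{11}{5}$ such that, for every $p\in[p_0,p_1]$ and every $s>1$ ($s<\infty$), the family of functions $\{\cos_p(n\pi_p\,\cdot)\}_{n=0}^\infty$ is a Schauder basis of $L_s(0,1)$.
   Context: For $1<p<\infty$ let $F_p(y)=\int_0^y(1-t^p)^{-1/p}\,dt$ for $y\in[0,1]$, and $\pi_p:=2F_p(1)=\frac{2\pi}{p\sin(\pi/p)}$. The function $\sin_p:[0,\frac{\pi_p}{2}]\to[0,1]$ is the inverse of $F_p$, extended to $\mathbb{R}$ by $\sin_p(-x)=-\sin_p(x)$ and $\sin_p(\frac{\pi_p}{2}-x)=\sin_p(\frac{\pi_p}{2}+x)$ (so it is $2\pi_p$-periodic). Define $\cos_p x:=\frac{d}{dx}\sin_p x$ for all $x\in\mathbb{R}$. $\cos_p(n\pi_p\,\cdot)$ denotes the function $x\mapsto\cos_p(n\pi_p x)$ on $(0,1)$; for $n=0$ it is the constant $1$. The Schauder basis is ordered by $n=0,1,2,\dots$. *)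

(* Defs.v *)
From HB Require Import structures.
From mathcomp Require Import all_boot all_order all_algebra.
From mathcomp Require Import all_classical all_reals all_analysis.
From mathcomp Require Import ring lra.
Set Implicit Arguments.
Unset Strict Implicit.
Unset Printing Implicit Defensive.
Import Order.TTheory GRing.Theory Num.Theory.
Import numFieldNormedType.Exports.
Local Open Scope classical_set_scope.
Local Open Scope ring_scope.

Section generalized_trigonometry.
Context {R : realType}.
Implicit Types p x y : R.

(* The integrand is unbounded near t = 1 when y = 1; there the Lebesgue
   integral agrees with the improper one, and the value 0 `^ (- p^-1) = 0
   taken by the integrand at t = 1 is irrelevant. *)
Definition Fp p y : R :=
  \int[lebesgue_measure]_(t in `[0, y]) (1 - t `^ p) `^ (- p^-1).

Definition pip p : R := 2 * Fp p 1.

(* Meaningful on [0, pip p / 2] only. *)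
Definition sinp_quarter p : R -> R := 'pinv_(fun=> 0) `[0, 1] (Fp p).

(* The two symmetries in the definition of sin_p amount to oddness and
   pi_p-antiperiodicity: x is reduced to r in [- pi_p / 2, pi_p / 2[ by
   subtracting k pi_p. See sinp_quarterE, sinpN and sinp_reflect below. *)
Definition sinp p x : R :=
  let k := Num.floor (x / pip p + 2^-1) in
  let r := x - k%:~R * pip p in
  (-1) ^ k * (Num.sg r * sinp_quarter p `|r|).

Definition cosp p : R -> R := derive1 (sinp p).

Let sinp_reduce p (k : int) r : 0 < pip p ->
  - (pip p / 2) <= r <= pip p / 2 ->
  sinp p (k%:~R * pip p + r) = (-1) ^ k * (Num.sg r * sinp_quarter p `|r|).
Proof.
move=> pi0 /andP[r1 r2]; rewrite /sinp.
have -> : (k%:~R * pip p + r) / pip p + 2^-1 = k%:~R + (r / pip p + 2^-1).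
  by field; rewrite gt_eqF.
rewrite floorDzr ?intr_int// intrKfloor.
have [rlt|rge] := ltP r (pip p / 2).
  have -> : Num.floor (r / pip p + 2^-1) = 0.
    apply/floor_def; rewrite add0r; apply/andP; split.
      have : - 2^-1 <= r / pip p by rewrite ler_pdivlMr//; lra.
      by rewrite /=; lra.
    have : r / pip p < 2^-1 by rewrite ltr_pdivrMr//; lra.
    by rewrite /=; lra.
  by rewrite addr0 addrC addKr.
have -> : r = pip p / 2 by lra.
have -> : pip p / 2 / pip p + 2^-1 = 1%:~R by field; rewrite gt_eqF.
rewrite intrKfloor intrD.
have -> : k%:~R * pip p + pip p / 2 - (k%:~R + 1%:~R) * pip p = - (pip p / 2).
  by lra.
rewrite sgrN normrN exprzDr ?unitrN1// expr1z.
by rewrite mulrN1 !mulNr mulrN opprK.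
Qed.

Let reduceP p x : 0 < pip p -> exists (k : int) (r : R),
  - (pip p / 2) <= r <= pip p / 2 /\ x = k%:~R * pip p + r.
Proof.
move=> pi0; pose k := Num.floor (x / pip p + 2^-1).
exists k, (x - k%:~R * pip p); split; last by rewrite addrC subrK.
have /andP[k1 k2] : k%:~R <= x / pip p + 2^-1 < (k + 1)%:~R.
  exact: floor_itv.
have xE : x = x / pip p * pip p by rewrite divfK// gt_eqF.
rewrite intrD in k2.
apply/andP; split; rewrite [X in X - _]xE; first by nra.
by nra.
Qed.

Lemma sinp_quarterE p x : 0 < x <= pip p / 2 -> sinp p x = sinp_quarter p x.
Proof.
move=> /andP[x0 x1].
rewrite -[in LHS](add0r x) -[in X in X + _](mul0r (pip p)) (@sinp_reduce _ 0).
- by rewrite expr0z mul1r gtr0_sg// mul1r gtr0_norm.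
- lra.
- by apply/andP; split; lra.
Qed.

Lemma sinpN p x : 0 < pip p -> sinp p (- x) = - sinp p x.
Proof.
move=> pi0; have [k [r [rb ->]]] := reduceP x pi0.
have -> : - (k%:~R * pip p + r) = (- k)%:~R * pip p + - r.
  by rewrite opprD intrN mulNr.
rewrite !sinp_reduce//; last by move: rb => /andP[? ?]; apply/andP; split; lra.
by rewrite sgrN normrN -exprz_inv invrN1 mulNr mulrN.
Qed.

Lemma sinp_reflect p x : 0 < pip p ->
  sinp p (pip p / 2 - x) = sinp p (pip p / 2 + x).
Proof.
move=> pi0; have [k [r [rb xE]]] := reduceP (pip p / 2 + x) pi0.
rewrite [in RHS]xE.
have -> : pip p / 2 - x = (1 - k)%:~R * pip p + - r.
  by rewrite intrD intrN; lra.
rewrite !sinp_reduce//; last by move: rb => /andP[? ?]; apply/andP; split; lra.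
rewrite sgrN normrN exprzDr ?unitrN1// expr1z -exprz_inv invrN1.
by rewrite mulN1r !mulNr mulrN opprK.
Qed.

End generalized_trigonometry.

(* Elements of L_s(0,1) are represented by functions on the whole line, only
   their restriction to ]0, 1[ being seen by the norm. *)
Definition lebesgue01 (R : realType) :
    {measure set (measurableTypeR R) -> \bar R} :=
  mrestr (@lebesgue_measure R) (measurable_itv `]0, 1[).

(* Elements of L_s(mu) are given by representatives; as convergence only
   depends on the classes of f and of the e n modulo a.e. equality, this is
   the notion of Schauder basis of the quotient space. *)
Definition schauder_basis_Lfun (d : measure_display) (T : measurableType d)
    (R : realType) (mu : {measure set T -> \bar R}) (s : R)
    (e : nat -> T -> R) : Prop :=
  (forall n, e n \in Lfun mu s%:E) /\
  forall f : T -> R, f \in Lfun mu s%:E ->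
    exists! a : nat -> R,
      'N[mu]_(s%:E)[EFin \o (fun x => f x - \sum_(n < N) a n * e n x)%R]%E
        @[N --> \oo] --> 0%E.

(* Main.v *)
Require Import Defs.
From HB Require Import structures.
From mathcomp Require Import all_boot all_order all_algebra.
From mathcomp Require Import all_classical all_reals all_analysis.
From mathcomp Require Import measurable_realfun.
From mathcomp Require Import ring lra zify.
Set Implicit Arguments.
Unset Strict Implicit.
Unset Printing Implicit Defensive.
Import Order.TTheory GRing.Theory Num.Theory.
Import numFieldNormedType.Exports.
Local Open Scope classical_set_scope.
Local Open Scope ring_scope.

(* Write e_n(x) = cos(n pi x), f_n(x) = g(n x) with g(x) = cos_p(pi_p x), and
   let a_j be the cosine coefficients of g. The function g is even,
   2-periodic and odd about 1/2, so that a_j = 0 for even j, and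
   f_n = sum_j a_j e_(jn) for n > 0. Hence e_n |-> f_n is a_1 times the identity
   plus sum_(j >= 2) a_j M_j, where M_j : e_n |-> e_(jn) preserves the norm of
   L_s; when sum_(j >= 2) |a_j| < a_1, the property of being a basis passes
   from (e_n) to (f_n). That (e_n) is a basis of L_s is M. Riesz's theorem,
   obtained here from subharmonic functions of pairs of conjugate harmonic
   functions.

   For the coefficients, expand
     0 <= int_0^(1/2) (g' + Q)^2,  Q = sum_j q_j sin(j pi x), j odd.
   With B an upper bound of int_0^(1/2) g'^2, integration by parts gives
     (pi / 2) sum_j j q_j a_j <= B + (1 / 4) sum_j q_j^2.
   Taking q_1 = pi a_1 and q_j = 4 pi a_1 sgn(a_j) / j for j >= 3, and using
   sum_(odd j >= 3) 1 / j^2 <= 1 / 4, one obtains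
     sum_(j >= 2) |a_j| <= B / (2 pi^2 a_1) + (3 / 8) a_1.
   Concavity of sin_p on the first quarter period yields
   a_1 >= 8 / (pi pi_p), so it is enough that B pi_p^2 < 80. *)

(** * Perturbation of a basis by dilations *)

(** Instead of inverting a_1 I + sum_(j >= 2) a_j M_j on L_s, the proof estimates finite
    combinations: the coefficients in (f_n) solve a triangular system indexed by divisors, and an
    induction on the length bounds their partial sums. The constant mode decouples, since g has mean
    zero and f_0 is the constant g(0).

    The multiplier 4 pi a_1 loses nothing. With q_1 = pi a_1, which is optimal, and q_j = t sgn(a_j)
    / j for j >= 3, the energy inequality becomes (pi / 2) t S <= B - pi^2 a_1^2 / 4 + t^2 / 16,
    where S = sum_(j >= 2) |a_j|. The best t is 4 sqrt(B - pi^2 a_1^2 / 4); it equals 4 pi a_1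
    exactly when B = (5 / 4) pi^2 a_1^2, the threshold at which the bound on S reaches a_1. The
    lower bound on a_1 turns this threshold into B pi_p^2 = 80.

    The energy of g is finite only for p < 3, and pi_p grows without bound as p tends to 1: these
    two effects limit the range of p at either end. *)

Lemma strong_recursion (T : Type) (x0 : T) (G : nat -> (nat -> T) -> T) :
  (forall n u v, (forall m, (m < n)%N -> u m = v m) -> G n u = G n v) ->
  exists u, forall n, u n = G n u.
Proof.
move=> Gext.
(* [h k] is a table of the first [k] values; the entries not yet filled are harmless because [G n]
   reads only indices below [n]. *)
pose h := fix h k := if k is k'.+1 then
  fun m => if m == k' then G k' (h k') else h k' m else fun=> x0.
have hE k m : (m < k)%N -> h k m = h m.+1 m.
  elim: k => // k IH; rewrite ltnS leq_eqVlt => /orP[/eqP ->//|mk].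
  by rewrite [LHS]/= ltn_eqF// IH.
exists (fun n => h n.+1 n) => n; rewrite /= eqxx; apply: Gext => m mn.
exact: hE.
Qed.

Section PerturbedBasis.
Context {R : realType} {V : lmodType R}.
Variable nu : V -> R.
Hypothesis nuD : forall f g, nu (f + g) <= nu f + nu g.
Hypothesis nuZ : forall a f, nu (a *: f) = `|a| * nu f.

Lemma seminorm0 : nu 0 = 0.
Proof. by rewrite -(scale0r 0) nuZ normr0 mul0r. Qed.

Lemma seminormN f : nu (- f) = nu f.
Proof. by rewrite -scaleN1r nuZ normrN1 mul1r. Qed.

Lemma seminormB f g : nu (f - g) <= nu f + nu g.
Proof. by rewrite -(seminormN g). Qed.

Lemma seminorm_ge0 f : 0 <= nu f.
Proof. by have := seminormB f f; rewrite subrr seminorm0; lra. Qed.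

Lemma seminorm_sum (I : Type) (r : seq I) (P : pred I) (F : I -> V) :
  nu (\sum_(i <- r | P i) F i) <= \sum_(i <- r | P i) nu (F i).
Proof.
elim/big_rec2: _ => [|i y z _ h]; first by rewrite seminorm0.
by apply: (le_trans (nuD _ _)); rewrite lerD2l.
Qed.

Lemma seminorm_sumZ (I : Type) (r : seq I) (P : pred I) (c : I -> R)
    (F : I -> V) (d : R) : (forall i, P i -> nu (F i) <= d) ->
  nu (\sum_(i <- r | P i) c i *: F i) <= (\sum_(i <- r | P i) `|c i|) * d.
Proof.
move=> Fd; apply: (le_trans (seminorm_sum _ _ _)).
rewrite mulr_suml; apply: ler_sum => i Pi.
by rewrite nuZ ler_wpM2l//; exact: Fd.
Qed.

Lemma ler_addgt0M (x y c : R) : 0 <= c ->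
  (forall d, 0 < d -> x <= y + c * d) -> x <= y.
Proof.
move=> c0 h; apply/ler_addgt0Pr => d d0.
apply: (le_trans (h (d / (c + 1)) _)).
  by rewrite divr_gt0// ltr_wpDl.
rewrite lerD2l mulrCA ger_pMr// ler_pdivrMr ?ltr_wpDl//.
by rewrite mul1r lerDl.
Qed.

(** Banach's criterion for a basis: bounded biorthogonal functionals, a uniform bound for truncating
    finite combinations, and density of their span. *)
Variable e : nat -> V.
Variable kap : nat -> V -> R.
Hypothesis kapD : forall n f g, kap n (f + g) = kap n f + kap n g.
Hypothesis kapZ : forall n a f, kap n (a *: f) = a * kap n f.
Hypothesis kap_e : forall n m, kap n (e m) = (n == m)%:R.
Variable L : R.
Hypothesis kap_le : forall n f, `|kap n f| <= L * nu f.
Variable K : R.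
Hypothesis K_ge1 : 1 <= K.
Hypothesis partial_sum_le : forall (b : nat -> R) (N M : nat), (N <= M)%N ->
  nu (\sum_(0 <= n < N) b n *: e n) <= K * nu (\sum_(0 <= n < M) b n *: e n).
Hypothesis e_dense : forall f (d : R), 0 < d ->
  exists N (b : nat -> R), nu (f - \sum_(0 <= n < N) b n *: e n) < d.

Let kap0 n : kap n 0 = 0.
Proof. by rewrite -(scale0r 0) kapZ mul0r. Qed.

Let kapN n f : kap n (- f) = - kap n f.
Proof. by rewrite -scaleN1r kapZ mulN1r. Qed.

Let kap_sum n (I : Type) (r : seq I) (P : pred I) (F : I -> V) :
  kap n (\sum_(i <- r | P i) F i) = \sum_(i <- r | P i) kap n (F i).
Proof. exact: (big_morph (kap n) (kapD n) (kap0 n)). Qed.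

Let pair_sum (W : lmodType R) (N m : nat) (F : nat -> W) (k : nat) :
  (k <= m < N)%N ->
  \sum_(k <= n < N) (m == n)%:R *: F n = F m.
Proof.
move=> h; rewrite (bigD1_seq m) ?mem_index_iota ?iota_uniq//= eqxx scale1r.
by rewrite big1 ?addr0// => i /negPf; rewrite eq_sym => ->; rewrite scale0r.
Qed.

Let kap_comb (b : nat -> R) N n : (n < N)%N ->
  kap n (\sum_(0 <= m < N) b m *: e m) = b n.
Proof.
move=> nN; rewrite kap_sum -[RHS](@pair_sum R^o N n b 0%N)//.
by apply: eq_bigr => i _; rewrite kapZ kap_e mulrC.
Qed.

Definition partial_sum N f := \sum_(0 <= n < N) kap n f *: e n.

Lemma partial_sum_bounded N f : nu (partial_sum N f) <= K * nu f.
Proof.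
have K1 := K_ge1; have K0 : 0 <= K by lra.
(* A crude bound, depending on [N], for the partial sum of the small remainder [f - P]; it only
   enters multiplied by the arbitrary [d]. *)
set c := \sum_(0 <= n < N) `|L| * nu (e n).
have c0 : 0 <= c.
  by apply: sumr_ge0 => i _; rewrite mulr_ge0// seminorm_ge0.
apply: (@ler_addgt0M _ _ (c + K)); first by rewrite addr_ge0.
move=> d d0; have [M [b hb]] := e_dense f d0.
(* Padding by zeros makes the approximant at least [N] terms long, as [partial_sum_le] cuts a longer
   sum to a shorter one. *)
pose b' n := if (n < M)%N then b n else 0.
have bE : \sum_(0 <= n < M) b n *: e n = \sum_(0 <= n < maxn N M) b' n *: e n.
  rewrite (@big_nat_widen _ _ _ _ M (maxn N M)) ?leq_maxr//.
  rewrite big_mkcond/=; apply: eq_bigr => i _; rewrite /b'.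
  by case: ifP; rewrite ?scale0r.
rewrite bE in hb; set P := (X in f - X) in hb.
have -> : partial_sum N f =
    partial_sum N (f - P) + \sum_(0 <= n < N) b' n *: e n.
  rewrite /partial_sum -big_split/=; apply: eq_big_nat => i /andP[_ iN].
  rewrite -scalerDl kapD kapN kap_comb ?subrK//.
  by rewrite (leq_trans iN)// leq_maxl.
apply: (le_trans (nuD _ _)).
have h1 : nu (partial_sum N (f - P)) <= c * d.
  apply: (le_trans (seminorm_sum _ _ _)); rewrite mulr_suml.
  apply: ler_sum => i _; rewrite nuZ mulrAC ler_wpM2r ?seminorm_ge0//.
  apply: (le_trans (kap_le _ _)); apply: ler_pM => //.
  - by have := le_trans (normr_ge0 _) (kap_le i (f - P));
      have [L0|L0] := lerP 0 L => //; have := kap_le 0%N (e 0%N);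
      rewrite kap_e normr1; have := seminorm_ge0 (e 0%N); nra.
  - exact: seminorm_ge0.
  - exact: ler_norm.
  - exact: ltW.
have h2 := partial_sum_le b' (leq_maxl N M).
rewrite -/P in h2.
have h3 : nu P <= nu f + d.
  have -> : P = f - (f - P) by rewrite opprB addrC subrK.
  by apply: (le_trans (seminormB _ _)); rewrite lerD2l ltW.
nra.
Qed.

Lemma partial_sum_cvg f (d : R) : 0 < d ->
  exists N0, forall N, (N0 <= N)%N -> nu (f - partial_sum N f) < d.
Proof.
move=> d0; have K1 := K_ge1; have K0 : 0 <= K by lra.
have [|M [b hb]] := @e_dense f (d / (K + 2)).
  by rewrite divr_gt0//; lra.
exists M => N MN; set P := (X in f - X) in hb.
(* For [N >= M] the partial sum reproduces [P], so only the remainder counts, with a factor at most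
   [1 + K]. *)
have -> : f - partial_sum N f = (f - P) - partial_sum N (f - P).
  rewrite -addrA -opprD; congr (_ - _).
  have -> : partial_sum N (f - P) = partial_sum N f - partial_sum N P.
    rewrite /partial_sum -sumrB; apply: eq_bigr => i _.
    by rewrite kapD kapN scalerBl.
  suff -> : partial_sum N P = P by rewrite addrC subrK.
  rewrite /P /partial_sum (big_cat_nat (leq0n M) MN)/= [X in _ + X]big_nat_cond.
  rewrite [X in _ + X]big1 ?addr0.
    by apply: eq_big_nat => i /andP[_ iM]; rewrite kap_comb.
  move=> i /andP[/andP[Mi _] _]; rewrite kap_sum big1_seq ?scale0r// => j /=.
  rewrite mem_index_iota => /andP[_ jM]; rewrite kapZ kap_e gtn_eqF ?mulr0//.
  exact: leq_trans jM Mi.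
apply: (le_lt_trans (seminormB _ _)).
have h1 := partial_sum_bounded N (f - P).
move: hb; rewrite ltr_pdivlMr//; last lra.
have := seminorm_ge0 (f - P); nra.
Qed.

Variables (a : nat -> R) (A : R).
Hypothesis a1_gt0 : 0 < a 1%N.
Hypothesis a_sum_le : forall J, \sum_(2 <= j < J) `|a j| <= A.
Hypothesis A_lt : A < a 1%N.
Hypothesis dilation_le : forall j (b : nat -> R) N, (0 < j)%N ->
  nu (\sum_(1 <= n < N) b n *: e (j * n)%N) <=
  nu (\sum_(1 <= n < N) b n *: e n).
Variables (f : nat -> V) (s0 : R).
Hypothesis s0_neq0 : s0 != 0.
Hypothesis f0E : f 0%N = s0 *: e 0%N.
Hypothesis f_lim : forall n (d : R), (0 < n)%N -> 0 < d ->
  exists J0, forall J, (J0 <= J)%N ->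
    nu (f n - \sum_(1 <= j < J) a j *: e (j * n)%N) < d.

Let A_ge0 : 0 <= A.
Proof. by have := a_sum_le 2; rewrite big_geq. Qed.

Let f_lim_unif N (d : R) : 0 < d ->
  exists J0, forall n J, (0 < n < N)%N -> (J0 <= J)%N ->
    nu (f n - \sum_(1 <= j < J) a j *: e (j * n)%N) < d.
Proof.
move=> d0; elim: N => [|N [J0 h]]; first by exists 0%N => n J /andP[].
have [N0|N0] := posnP N.
  by exists 0%N => n J; rewrite N0 => /andP[]; case: n.
have [J1 h1] := f_lim N0 d0.
exists (maxn J0 J1) => n J /andP[n0]; rewrite ltnS leq_eqVlt geq_max.
move=> /orP[/eqP -> /andP[_ ?]|nN /andP[? _]]; first exact: h1.
by apply: h => //; rewrite n0.
Qed.

(** On finite combinations, e_n |-> f_n - a_1 e_n is a combination of the dilations of index j >= 2,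
    none of which increases the seminorm; cutting the series at [J] costs an arbitrarily small
    error. *)
Lemma perturbation_le (b : nat -> R) N :
  nu (\sum_(1 <= n < N) b n *: f n - a 1%N *: \sum_(1 <= n < N) b n *: e n)
    <= A * nu (\sum_(1 <= n < N) b n *: e n).
Proof.
set Pe := \sum_(1 <= n < N) b n *: e n.
apply: (@ler_addgt0M _ _ (\sum_(1 <= n < N) `|b n|)); first exact: sumr_ge0.
move=> d d0; have [J0 h] := f_lim_unif N d0.
pose J := maxn J0 2.
have -> : \sum_(1 <= n < N) b n *: f n - a 1%N *: Pe =
   (\sum_(2 <= j < J) a j *: \sum_(1 <= n < N) b n *: e (j * n)%N) +
   \sum_(1 <= n < N) b n *: (f n - \sum_(1 <= j < J) a j *: e (j * n)%N).
  rewrite [X in _ = _ + X](_ : _ = \sum_(1 <= n < N) b n *: f n -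
    \sum_(1 <= j < J) a j *: \sum_(1 <= n < N) b n *: e (j * n)%N).
    rewrite addrCA; congr (_ + _).
    rewrite [X in _ - X]big_ltn ?leq_max ?orbT// opprD addrCA subrr addr0.
    by under [in RHS]eq_bigr do rewrite mul1n.
  under eq_bigr do rewrite scalerBr; rewrite sumrB; congr (_ - _).
  under eq_bigr do rewrite scaler_sumr; rewrite exchange_big/=.
  apply: eq_bigr => j _; rewrite scaler_sumr; apply: eq_bigr => n _.
  by rewrite !scalerA mulrC.
apply: (le_trans (nuD _ _)); apply: lerD.
  apply: (@le_trans _ _ ((\sum_(2 <= j < J) `|a j|) * nu Pe)); last first.
    by rewrite ler_wpM2r// seminorm_ge0.
  rewrite big_seq [in leRHS]big_seq.
  apply: seminorm_sumZ => j; rewrite mem_index_iota => /andP[j2 _].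
  by apply: dilation_le; rewrite (leq_trans _ j2).
rewrite big_seq [in leRHS]big_seq.
apply: seminorm_sumZ => n; rewrite mem_index_iota => nN.
by apply/ltW/h; rewrite // leq_maxl.
Qed.

(** For d > 0 the condition d m < N amounts to m <= (N - 1) / d; for [N = 0] both sums are empty. *)
Let pairs_sum (W : lmodType R) (N d : nat) (F : nat -> W) : (0 < d)%N ->
  \sum_(1 <= m < N) (d * m < N)%N%:R *: F m =
  \sum_(1 <= m < (N.-1 %/ d).+1) F m.
Proof.
move=> d0; have [->|N0] := posnP N; first by rewrite /= div0n !big_geq.
rewrite [RHS](@big_nat_widen _ _ _ _ _ N); last first.
  by rewrite -[X in (_ < X)%N](prednK N0) ltnS leq_div.
rewrite [RHS]big_mkcond/=; apply: eq_bigr => m _.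
rewrite [in RHS]ltnS leq_divRL// mulnC -[in RHS]ltnS prednK//.
by case: ifP; rewrite ?scale1r ?scale0r.
Qed.

(* Applying the n-th coefficient functional to [g = sum_m al_m f_m] gives a
   Dirichlet convolution, which determines [al] since [a 1 != 0]. *)
Definition dirichlet_coeffs (g : V) (al : nat -> R) := forall n, (0 < n)%N ->
  kap n g = \sum_(1 <= d < n.+1) \sum_(1 <= m < n.+1)
              (d * m == n)%N%:R * (a d * al m).

(** Grouping the pairs (d, m) by d turns the convolution into dilated sums; those with d >= 2 are
    shorter than the sum of divisor 1. *)
Let dirichletE (g : V) al N : dirichlet_coeffs g al ->
  \sum_(1 <= n < N) kap n g *: e n =
  \sum_(1 <= d < N) a d *:
    \sum_(1 <= m < (N.-1 %/ d).+1) al m *: e (d * m)%N.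
Proof.
move=> ga.
transitivity (\sum_(1 <= n < N) \sum_(1 <= d < N) \sum_(1 <= m < N)
    (d * m == n)%N%:R *: ((a d * al m) *: e n)).
  apply: eq_big_nat => n /andP[n0 nN].
  rewrite ga// scaler_suml.
  rewrite (@big_nat_widen _ _ _ 1 n.+1 N)//= big_mkcond/=.
  apply: eq_big_nat => d /andP[d0 dN]; case: ifP => [dn|/negbT dn].
    rewrite scaler_suml.
    rewrite (@big_nat_widen _ _ _ 1 n.+1 N)//= big_mkcond/=.
    apply: eq_big_nat => m /andP[m0 mN]; case: ifP => [mn|/negbT mn].
      by rewrite -scalerA.
    rewrite (_ : _ == _ = false) ?scale0r//; apply/negbTE.
    by apply/eqP => h; move: mn; rewrite ltnS -h; nia.
  rewrite big_nat_cond big1// => m /andP[/andP[m0 _] _].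
  rewrite (_ : _ == _ = false) ?scale0r//; apply/negbTE.
  by apply/eqP => h; move: dn; rewrite ltnS -h; nia.
rewrite exchange_big/=; apply: eq_big_nat => d /andP[d0 _].
rewrite exchange_big/= -pairs_sum// scaler_sumr.
apply: eq_big_nat => m /andP[m0 _].
case: ltnP => h; last first.
  rewrite scale0r scaler0 big_nat_cond big1// => n /andP[/andP[_ nN] _].
  by rewrite gtn_eqF ?scale0r// (leq_trans nN).
rewrite scale1r scalerA.
rewrite (@pair_sum _ N (d * m)%N (fun n => (a d * al m) *: e n) 1%N)//.
by rewrite h muln_gt0 d0 m0.
Qed.

(** The solution of a_1 K2 = 2 K + A K2, the relation that closes the induction of
    [dirichlet_le]. *)
Let K2 := (2 * K) / (a 1%N - A).

(** Induction on the length: the divisor 1 carries a_1 times the sum to be estimated, and every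
    divisor d >= 2 carries the dilation of a strictly shorter sum, to which the induction hypothesis
    applies with the same constant. *)
Lemma dirichlet_le (g : V) al N : dirichlet_coeffs g al ->
  nu (\sum_(1 <= n < N) al n *: e n) <= K2 * nu g.
Proof.
have K1 := K_ge1; have hA := A_lt; move=> ga.
have K20 : 0 <= K2 by rewrite divr_ge0//; lra.
elim/ltn_ind: N => N IH; have [N1|N1] := leqP N 1.
  by rewrite big_geq// seminorm0 mulr_ge0// seminorm_ge0.
have := dirichletE N ga; rewrite [in RHS]big_ltn// divn1 prednK ?(ltnW N1)//.
under [X in _ = a _ *: X + _]eq_bigr do rewrite mul1n.
set P := \sum_(1 <= m < N) al m *: e m => hP.
have {}hP : a 1%N *: P = \sum_(1 <= n < N) kap n g *: e n -
    \sum_(2 <= d < N) a d *: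
      \sum_(1 <= m < (N.-1 %/ d).+1) al m *: e (d * m)%N.
  by rewrite hP addrK.
(* The term of index 0 lies outside the convolution; removing it costs a second partial sum, hence
   the factor 2. *)
have h1 : nu (\sum_(1 <= n < N) kap n g *: e n) <= 2 * K * nu g.
  have -> : \sum_(1 <= n < N) kap n g *: e n =
      partial_sum N g - partial_sum 1 g.
    rewrite /partial_sum [in X in _ = X - _]big_ltn ?(ltnW N1)// big_nat1.
    by rewrite addrC addKr.
  apply: (le_trans (seminormB _ _)).
  have := partial_sum_bounded N g; have := partial_sum_bounded 1 g; lra.
have h2 : nu (\sum_(2 <= d < N) a d *:
    \sum_(1 <= m < (N.-1 %/ d).+1) al m *: e (d * m)%N) <= A * (K2 * nu g).
  apply: (@le_trans _ _ ((\sum_(2 <= j < N) `|a j|) * (K2 * nu g))); last first.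
    by rewrite ler_wpM2r// mulr_ge0// seminorm_ge0.
  rewrite big_seq [in leRHS]big_seq.
  apply: seminorm_sumZ => d; rewrite mem_index_iota => /andP[d2 dN].
  apply: (le_trans (dilation_le _ _ _)); first by rewrite (leq_trans _ d2).
  apply: IH; rewrite -[X in (_ < X)%N](prednK (ltnW N1)) ltnS.
  by rewrite ltn_Pdiv// -ltnS prednK// ltnW.
have h3 : a 1%N * nu P <= 2 * K * nu g + A * (K2 * nu g).
  rewrite -[X in X * _](ger0_norm (ltW a1_gt0)) -nuZ hP.
  by apply: (le_trans (seminormB _ _)); exact: lerD.
have a1 := a1_gt0.
have K2E : K2 * (a 1%N - A) = 2 * K by rewrite /K2 divfK// gt_eqF//; lra.
rewrite -(ler_pM2l a1_gt0); apply: (le_trans h3).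
by rewrite -K2E; lra.
Qed.

Definition perturbed_sum (al : nat -> R) N := \sum_(0 <= n < N) al n *: f n.

Lemma perturbed_sum_le (al : nat -> R) N :
  nu (\sum_(1 <= n < N) al n *: f n) <=
  (a 1%N + A) * nu (\sum_(1 <= n < N) al n *: e n).
Proof.
have a1 := a1_gt0; have := perturbation_le al N.
set Pf := \sum_(1 <= n < N) al n *: f n; set Pe := \sum_(1 <= n < N) al n *: e n.
have := nuD (Pf - a 1%N *: Pe) (a 1%N *: Pe).
by rewrite subrK nuZ (ger0_norm (ltW a1_gt0)); lra.
Qed.

Lemma perturbed_sum_ge (al : nat -> R) N :
  (a 1%N - A) * nu (\sum_(1 <= n < N) al n *: e n) <=
  nu (\sum_(1 <= n < N) al n *: f n).
Proof.
have a1 := a1_gt0; have := perturbation_le al N.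
set Pf := \sum_(1 <= n < N) al n *: f n; set Pe := \sum_(1 <= n < N) al n *: e n.
have := seminormB Pf (Pf - a 1%N *: Pe).
by rewrite subKr nuZ (ger0_norm (ltW a1_gt0)); lra.
Qed.

Lemma dirichlet_coeffs_exist (g : V) : exists al, dirichlet_coeffs g al /\
  al 0%N = kap 0 g / s0.
Proof.
(* The term d = 1, m = n, the only one to involve [al n], is solved for; index 0 is governed by f_0
   = s0 e_0. *)
pose G n (al : nat -> R) := if n == 0%N then kap 0 g / s0 else
  (kap n g - \sum_(1 <= d < n.+1) \sum_(1 <= m < n)
              (d * m == n)%N%:R * (a d * al m)) / a 1%N.
have [n u v uv|al alE] := @strong_recursion R 0 G.
  rewrite /G; case: ifP => // _; congr ((_ - _) / _).
  apply: eq_bigr => d _; apply: eq_big_nat => m /andP[_ mn].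
  by rewrite uv.
exists al; split; last by rewrite alE /G eqxx.
move=> n n0; under eq_bigr do rewrite big_nat_recr//=.
rewrite big_split/= [X in _ + X](_ : _ = a 1%N * al n).
  rewrite [in X in _ + _ * X]alE /G gtn_eqF// mulrC divfK ?gt_eqF//.
  by rewrite addrCA subrr addr0.
rewrite big_ltn//.
rewrite mul1n eqxx mul1r big_nat_cond big1 ?addr0//.
move=> d /andP[/andP[d1 _] _].
by rewrite (_ : _ == _ = false) ?mul0r//; apply/negbTE/eqP; nia.
Qed.

Lemma dirichlet_coeffsB (g h : V) al be :
  dirichlet_coeffs g al -> dirichlet_coeffs h be ->
  dirichlet_coeffs (g - h) (fun n => al n - be n).
Proof.
move=> ga hb n n0; rewrite kapD kapN ga// hb// -sumrB; apply: eq_bigr => d _.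
by rewrite -sumrB; apply: eq_bigr => m _; rewrite -!mulrBr.
Qed.

(** By continuity [kap n] acts termwise on the expansion of f_m; as j m = n with m > 0 forces j <=
    n, the sum is finite. *)
Let kap_f n m : (0 < m)%N ->
  kap n (f m) = \sum_(1 <= j < n.+1) a j * (n == j * m)%N%:R.
Proof.
move=> m0; apply/eqP; rewrite -subr_eq0 -normr_le0.
have L0 : 0 <= L.
  by have := kap_le 0 (e 0); rewrite kap_e normr1;
    have := seminorm_ge0 (e 0); nra.
apply: (@ler_addgt0M _ _ L) => // d d0.
have [J0 hJ] := f_lim m0 d0.
have := hJ (maxn J0 n.+1) (leq_maxl _ _); set J := maxn _ _ => h.
rewrite (_ : kap n (f m) - _ =
    kap n (f m - \sum_(1 <= j < J) a j *: e (j * m)%N)).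
  by rewrite add0r (le_trans (kap_le _ _))// ler_wpM2l// ltW.
rewrite kapD kapN kap_sum; congr (_ - _).
under [RHS]eq_bigr do rewrite kapZ kap_e.
rewrite (@big_cat_nat _ _ _ n.+1 1 J)//=; last exact: leq_maxr.
rewrite [X in _ = _ + X]big_nat_cond [X in _ = _ + X]big1 ?addr0//.
move=> j /andP[/andP[nj _] _].
by rewrite (_ : _ == _ = false) ?mulr0//; apply/negbTE/eqP; nia.
Qed.

Let dirichlet_f m : (0 < m)%N ->
  dirichlet_coeffs (f m) (fun n => (n == m)%:R).
Proof.
move=> m0 n n0; rewrite kap_f//; apply: eq_big_nat => j /andP[j0 jn].
case: (ltnP m n.+1) => mn.
  rewrite (bigD1_seq m) ?mem_index_iota ?m0 ?iota_uniq//= eqxx mulr1 mulrC.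
  rewrite big1 ?addr0 1?eq_sym// => i /negPf ->.
  by rewrite !mulr0.
rewrite (_ : _ == _ = false) ?mulr0; last by apply/negbTE/eqP; nia.
rewrite big_nat_cond big1// => i /andP[/andP[_ im] _].
by rewrite (@ltn_eqF i m) ?mulr0// (leq_trans im).
Qed.

Let in_span (v : V) := exists N b, v = \sum_(0 <= n < N) b n *: f n.

Let in_spanP v w (c : R) : in_span v -> in_span w -> in_span (v + c *: w).
Proof.
move=> [N [b ->]] [M [b' ->]].
pose ext k (b : nat -> R) n := if (n < k)%N then b n else 0.
have extE k b0 : (k <= maxn N M)%N -> \sum_(0 <= n < k) b0 n *: f n =
    \sum_(0 <= n < maxn N M) ext k b0 n *: f n.
  move=> kl; rewrite (@big_nat_widen _ _ _ _ k (maxn N M))//.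
  by rewrite big_mkcond/=; apply: eq_bigr => i _; rewrite /ext;
    case: ifP; rewrite ?scale0r.
exists (maxn N M), (fun n => ext N b n + c * ext M b' n).
rewrite (extE N b) ?leq_maxl// (extE M b') ?leq_maxr// scaler_sumr -big_split/=.
by apply: eq_bigr => i _; rewrite scalerDl scalerA.
Qed.

Let in_span_f n : in_span (f n).
Proof.
by exists n.+1, (fun m => (n == m)%:R); rewrite (@pair_sum _ _ _ f)//=.
Qed.

Let in_span0 : in_span 0.
Proof. by exists 0%N, (fun=> 0); rewrite big_geq. Qed.

Let in_span_sum (I : eqType) (r : seq I) (c : I -> R) (w : I -> V) :
  (forall i, i \in r -> in_span (w i)) ->
  in_span (\sum_(i <- r) c i *: w i).
Proof.
elim: r => [|i r IH] h; first by rewrite big_nil.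
rewrite big_cons addrC; apply: in_spanP; last exact: h (mem_head _ _).
by apply: IH => j jr; apply: h; rewrite inE jr orbT.
Qed.

(** Solve the expansion of f_m for e_m and replace each e_(jm), j >= 2, by its approximant. The
    approximants cost A d and the cut (a_1 - A) d / 2; together, divided by a_1, they contract a
    distance valid for all the e_m at once. *)
Let e_span_step (d : R) : 0 < d ->
  (forall m, (0 < m)%N -> exists2 w, in_span w & nu (e m - w) <= d) ->
  (forall m, (0 < m)%N -> exists2 w, in_span w &
    nu (e m - w) <= (a 1%N + A) / (2 * a 1%N) * d).
Proof.
have a1 := a1_gt0; have hA := A_lt; move=> d0 h m m0.
have [|J0 hJ] := @f_lim m ((a 1%N - A) / 2 * d) m0.
  by rewrite mulr_gt0//; lra.
have {hJ} := hJ (maxn J0 2) (leq_maxl _ _); set J := maxn _ _ => hJ.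
have /choice[w hw] : forall j, exists w, (0 < j)%N ->
    in_span w /\ nu (e (j * m)%N - w) <= d.
  move=> j; have [->|j0] := posnP j; first by exists 0.
  have [|w w1 w2] := h (j * m)%N; first by rewrite muln_gt0 j0.
  by exists w.
pose v := f m - \sum_(2 <= j < J) a j *: w j.
exists ((a 1%N)^-1 *: v).
  rewrite -[_ *: v]add0r; apply: in_spanP => //.
  rewrite /v -scaleN1r; apply: in_spanP => //.
  by apply: in_span_sum => j; rewrite mem_index_iota => /andP[j2 _];
    have [] := hw j (ltnW j2).
rewrite (_ : e m - _ = (a 1%N)^-1 *: (- (f m -
    \sum_(1 <= j < J) a j *: e (j * m)%N) -
    \sum_(2 <= j < J) a j *: (e (j * m)%N - w j))); last first.
  rewrite [X in _ = _ *: (- (_ - X) - _)]big_ltn ?leq_max ?orbT// mul1n.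
  under [X in _ = _ *: (_ - X)]eq_bigr do rewrite scalerBr.
  have aux (p q x y : V) : p - (q - x) = - (q - (p + y)) - (y - x).
    by rewrite !opprB (addrAC p y) -[RHS]addrA [y + _]addrC subrK addrA addrAC.
  have {1}-> : e m = (a 1%N)^-1 *: (a 1%N *: e m).
    by rewrite scalerA mulVf ?scale1r// gt_eqF.
  by rewrite sumrB -scalerBr /v; congr (_ *: _); exact: aux.
rewrite nuZ normfV (gtr0_norm a1) mulrC ler_pdivrMr//.
apply: (le_trans (seminormB _ _)); rewrite seminormN.
have -> : (a 1%N + A) / (2 * a 1%N) * d * a 1%N = (a 1%N + A) / 2 * d.
  by field; rewrite gt_eqF.
have h2 : nu (\sum_(2 <= j < J) a j *: (e (j * m)%N - w j)) <= A * d.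
  apply: (@le_trans _ _ ((\sum_(2 <= j < J) `|a j|) * d)); last first.
    by rewrite ler_wpM2r// ltW.
  rewrite big_seq [in leRHS]big_seq.
  apply: seminorm_sumZ => j; rewrite mem_index_iota => /andP[j2 _].
  by have [] := hw j (ltnW j2).
move: hJ h2; nra.
Qed.

Let e_span m (d : R) : 0 < d -> exists2 w, in_span w & nu (e m - w) < d.
Proof.
have a1 := a1_gt0; have hA := A_lt; move=> d0.
have [->|m0] := posnP m.
  exists (s0^-1 *: f 0%N).
    by rewrite -[_ *: _]add0r; apply: in_spanP.
  by rewrite f0E scalerA mulVf// scale1r subrr seminorm0.
pose r := (a 1%N + A) / (2 * a 1%N).
have r0 : 0 <= r by rewrite divr_ge0//; have := A_ge0; lra.
have r1 : `|r| < 1 by rewrite ger0_norm// ltr_pdivrMr; lra.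
(* Applied to a single term, [dilation_le] bounds the seminorm of every e_m by that of e_1, so [E]
   starts the iteration; the added 1 makes it positive. *)
pose E := nu (e 1%N) + 1.
have E0 : 0 < E by rewrite ltr_wpDl// seminorm_ge0.
have hr k m' : (0 < m')%N ->
    exists2 w, in_span w & nu (e m' - w) <= r ^+ k * E.
  have A0 := A_ge0.
  have rp : 0 < r by rewrite divr_gt0//; lra.
  elim: k m' => [|k IH] m' m'0.
    exists 0 => //; rewrite subr0 expr0 mul1r.
    have := dilation_le (fun=> 1) 2 m'0.
    by rewrite !big_nat1 muln1 !scale1r /E; lra.
  rewrite exprS -mulrA; apply: e_span_step => //.
  by rewrite mulr_gt0// exprn_gt0.
have /cvgrPdist_lt/(_ (d / E)) := cvg_expr r1.
rewrite divr_gt0// => /(_ isT)[k _ /(_ k (leqnn k))].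
rewrite sub0r normrN ger0_norm ?exprn_ge0// ltr_pdivlMr// => hk.
by have [w w1 w2] := hr k m m0; exists w => //; exact: le_lt_trans hk.
Qed.

Let span_dense (g : V) (d : R) : 0 < d ->
  exists2 w, in_span w & nu (g - w) < d.
Proof.
move=> d0; have [|N [b hb]] := @e_dense g (d / 2); first by rewrite divr_gt0.
pose c := \sum_(0 <= n < N) `|b n|.
have c0 : 0 <= c by apply: sumr_ge0.
have /choice[w hw] : forall m, exists w, in_span w /\
    nu (e m - w) < d / 2 / (c + 1).
  move=> m; have [|w w1 w2] := @e_span m (d / 2 / (c + 1)).
    by rewrite !divr_gt0// ltr_wpDl.
  by exists w.
exists (\sum_(0 <= n < N) b n *: w n).
  by apply: in_span_sum => i _; have [] := hw i.
rewrite -(subrK (\sum_(0 <= n < N) b n *: e n) g) -addrA -sumrB.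
have -> : \sum_(0 <= i < N) (b i *: e i - b i *: w i) =
    \sum_(0 <= i < N) b i *: (e i - w i).
  by apply: eq_bigr => i _; rewrite scalerBr.
apply: (le_lt_trans (nuD _ _)).
have : nu (\sum_(0 <= n < N) b n *: (e n - w n)) <= c * (d / 2 / (c + 1)).
  by apply: seminorm_sumZ => i _; apply/ltW; have [] := hw i.
have : c * (d / 2 / (c + 1)) <= d / 2.
  by rewrite mulrA ler_pdivrMr ?ltr_wpDl//; nra.
lra.
Qed.

Let kap0_f n : (0 < n)%N -> kap 0 (f n) = 0.
Proof. by move=> n0; rewrite kap_f// big_geq. Qed.

(** Uniform boundedness of the partial sums in the new system: the constant mode is treated by
    itself, the rest by comparison with (e_n). *)
Let perturbed_sum_coeffs_le (g : V) al N : dirichlet_coeffs g al ->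
  al 0%N = kap 0 g / s0 ->
  nu (perturbed_sum al N) <= (L * nu (e 0%N) + (a 1%N + A) * K2) * nu g.
Proof.
have a1 := a1_gt0; have hA := A_ge0; move=> ga a0.
have L0 : 0 <= L.
  by have := kap_le 0 (e 0); rewrite kap_e normr1;
    have := seminorm_ge0 (e 0); nra.
have ng := seminorm_ge0 g; have ne := seminorm_ge0 (e 0%N).
have K20 : 0 <= K2.
  by rewrite divr_ge0//; have := A_lt; have := K_ge1; lra.
have a1A : 0 <= a 1%N + A by rewrite addr_ge0// ltW.
rewrite /perturbed_sum; case: N => [|N].
  by rewrite big_geq// seminorm0 mulr_ge0// addr_ge0// mulr_ge0.
rewrite big_ltn//; apply: (le_trans (nuD _ _)); rewrite mulrDl lerD//.
  rewrite a0 f0E scalerA divfK// nuZ mulrAC ler_wpM2r//; exact: kap_le.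
apply: (le_trans (perturbed_sum_le _ _)); rewrite -mulrA ler_wpM2l//.
exact: dirichlet_le.
Qed.

Let perturbed_sum_f g : in_span g -> exists al N0,
  [/\ dirichlet_coeffs g al, al 0%N = kap 0 g / s0 &
     forall N, (N0 <= N)%N -> perturbed_sum al N = g].
Proof.
move=> [M [b ->]]; pose b' n := if (n < M)%N then b n else 0.
exists b', M; split.
- move=> n n0; rewrite kap_sum.
  have [M0|M0] := posnP M.
    rewrite M0 big_geq// big1// => d _; rewrite big1// => m _.
    by rewrite /b' M0 !mulr0.
  rewrite big_ltn// kapZ f0E kapZ kap_e gtn_eqF// !mulr0 add0r.
  under eq_big_nat => m /andP[m0 _] do rewrite kapZ (dirichlet_f m0)//.
  under eq_bigr do rewrite mulr_sumr.
  rewrite exchange_big/=; apply: eq_bigr => d _.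
  under eq_bigr do rewrite mulr_sumr.
  rewrite exchange_big/=; apply: eq_big_nat => m /andP[m0 _].
  case: (ltnP m M) => mM.
    rewrite (bigD1_seq m) ?mem_index_iota ?m0 ?iota_uniq//= eqxx.
    rewrite big1 ?addr0 /b' ?mM; first by rewrite mulr1 mulrC mulrA.
    by move=> i /negPf h; rewrite [m == i]eq_sym h !mulr0.
  rewrite /b' ltnNge mM/= !mulr0 big_nat_cond big1// => i /andP[/andP[_ iM] _].
  by rewrite (@gtn_eqF i m) ?mulr0// (leq_trans iM).
- rewrite kap_sum; have [M0|M0] := posnP M.
    by rewrite M0 big_geq// /b' M0 mul0r.
  rewrite big_ltn// kapZ f0E kapZ kap_e eqxx big_nat_cond big1 ?addr0.
    by rewrite mulr1 mulfK// /b' M0.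
  by move=> i /andP[/andP[i0 _] _]; rewrite kapZ kap0_f// mulr0.
- move=> k Mk; rewrite /perturbed_sum.
  rewrite [RHS](@big_nat_widen _ _ _ _ M k)//.
  rewrite [RHS]big_mkcond/=; apply: eq_bigr => i _; rewrite /b'.
  by case: ifP; rewrite ?scale0r.
Qed.

Lemma perturbed_basis (g : V) : exists! al : nat -> R,
  forall d, 0 < d -> exists N0, forall N, (N0 <= N)%N ->
    nu (g - \sum_(0 <= n < N) al n *: f n) < d.
Proof.
have a1 := a1_gt0; have hA := A_ge0; have hA' := A_lt.
have [al [ga a0]] := dirichlet_coeffs_exist g.
have L0 : 0 <= L.
  by have := kap_le 0 (e 0); rewrite kap_e normr1;
    have := seminorm_ge0 (e 0); nra.
(* The partial sums are uniformly bounded and eventually exact on the dense span of the f_n, which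
   gives convergence everywhere. *)
have alP : forall d, 0 < d -> exists N0, forall N, (N0 <= N)%N ->
    nu (g - \sum_(0 <= n < N) al n *: f n) < d.
  move=> d d0; set K3 := L * nu (e 0%N) + (a 1%N + A) * K2.
  have [|w ws wd] := @span_dense g (d / (`|K3| + 1)).
    by rewrite divr_gt0// ltr_wpDl.
  have [be [N0 [wb b0 wE]]] := @perturbed_sum_f w ws.
  exists N0 => N N0N.
  have -> : g - \sum_(0 <= n < N) al n *: f n =
      (g - w) - perturbed_sum (fun n => al n - be n) N.
    have -> : perturbed_sum (fun n => al n - be n) N = perturbed_sum al N - w.
      rewrite -(wE N N0N) /perturbed_sum -sumrB; apply: eq_bigr => i _.
      by rewrite scalerBl.
    by rewrite opprB addrA subrK.
  apply: (le_lt_trans (seminormB _ _)).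
  have := @perturbed_sum_coeffs_le (g - w) _ N (dirichlet_coeffsB ga wb).
  rewrite a0 b0 kapD kapN mulrBl => /(_ erefl).
  rewrite -/K3 => h; move: wd; rewrite ltr_pdivlMr ?ltr_wpDl//.
  have := ler_norm K3; have := seminorm_ge0 (g - w); nra.
exists al; split => // be beP.
pose c n := al n - be n.
have cP d : 0 < d -> exists N0, forall N, (N0 <= N)%N ->
    nu (\sum_(0 <= n < N) c n *: f n) < d.
  move=> d0; have [|N1 h1] := alP (d / 2); first by rewrite divr_gt0.
  have [|N2 h2] := beP (d / 2); first by rewrite divr_gt0.
  exists (maxn N1 N2) => N; rewrite geq_max => /andP[/h1 {}h1 /h2 {}h2].
  rewrite (_ : \sum_(_ <= _ < _) _ = (g - \sum_(0 <= n < N) be n *: f n) -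
     (g - \sum_(0 <= n < N) al n *: f n)).
    apply: (le_lt_trans (seminormB _ _)); lra.
  rewrite opprB [RHS]addrC addrA subrK -sumrB.
  by apply: eq_bigr => i _; rewrite scalerBl.
(* Uniqueness: a number dominated by arbitrarily late partial sums of the null expansion [c] is
   zero. *)
have small0 (x C : R) : 0 <= C ->
    (forall N, exists2 N', (N <= N')%N &
      `|x| <= C * nu (\sum_(0 <= n < N') c n *: f n)) -> x = 0.
  move=> C0 h; apply/normr0_eq0/le_anti; rewrite normr_ge0 andbT.
  apply: (@ler_addgt0M _ _ C) => // d d0.
  have [N0 hN0] := cP d d0; have [N' N0N' hx] := h N0.
  by rewrite add0r (le_trans hx)// ler_wpM2l// ltW// hN0.
have c0 : c 0%N = 0.
  apply: (@small0 _ (`|s0^-1| * L)); first by rewrite mulr_ge0.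
  move=> N; exists N.+1 => //; rewrite -mulrA.
  apply: le_trans (ler_wpM2l _ (kap_le 0 _)); last exact: normr_ge0.
  rewrite kap_sum big_ltn// kapZ f0E kapZ kap_e eqxx big_nat_cond big1 ?addr0.
    by rewrite mulr1 -normrM mulrCA mulVf// mulr1.
  by move=> i /andP[/andP[i0 _] _]; rewrite kapZ kap0_f// mulr0.
(* [perturbed_sum_ge] carries smallness over from the sums of c_n f_n to those of c_n e_n, from
   which [kap n] extracts c_n. *)
have cn n : (0 < n)%N -> c n = 0.
  move=> n0; apply: (@small0 _ (L * (a 1%N - A)^-1)).
    by rewrite mulr_ge0// invr_ge0; lra.
  move=> N; exists (maxn N n.+1); first exact: leq_maxl.
  have nN : (n < maxn N n.+1)%N by rewrite leq_max ltnSn orbT.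
  have N0 := leq_ltn_trans (leq0n _) nN.
  rewrite big_ltn// c0 scale0r add0r -mulrA.
  apply: (@le_trans _ _ (L * nu (\sum_(1 <= m < maxn N n.+1) c m *: e m))).
    have := kap_le n (\sum_(0 <= m < maxn N n.+1) c m *: e m).
    by rewrite kap_comb// big_ltn// c0 scale0r add0r.
  rewrite ler_wpM2l// ler_pdivlMl; last lra.
  exact: perturbed_sum_ge.
apply/funext => n; apply/eqP; rewrite -subr_eq0; apply/eqP.
by have [->|/cn] := posnP n.
Qed.

End PerturbedBasis.

(** * Calculus on the unit interval *)

Section DerivativeRules.
Context {R : realType}.
Implicit Types (f g : R -> R) (x a b c : R).

Lemma is_derive_val f x a b : is_derive x 1 f a -> a = b -> is_derive x 1 f b.
Proof. by move=> + <-. Qed.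

Lemma is_derive_funD f g x a b : is_derive x 1 f a -> is_derive x 1 g b ->
  is_derive x 1 (fun t => f t + g t) (a + b).
Proof. exact: is_deriveD. Qed.

Lemma is_derive_funB f g x a b : is_derive x 1 f a -> is_derive x 1 g b ->
  is_derive x 1 (fun t => f t - g t) (a - b).
Proof. exact: is_deriveB. Qed.

Lemma is_derive_funN f x a : is_derive x 1 f a ->
  is_derive x 1 (fun t => - f t) (- a).
Proof. exact: is_deriveN. Qed.

Lemma is_derive_funM f g x a b : is_derive x 1 f a -> is_derive x 1 g b ->
  is_derive x 1 (fun t => f t * g t) (a * g x + f x * b).
Proof.
move=> fa gb; apply: is_derive_val (is_deriveM fa gb) _.
by rewrite addrC /GRing.scale/= [g x * a]mulrC.
Qed.

Lemma is_derive_funZ c f x a : is_derive x 1 f a ->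
  is_derive x 1 (fun t => c * f t) (c * a).
Proof. exact: is_deriveZ. Qed.

Lemma is_derive_fun_comp f g x a b : is_derive (g x) 1 f a ->
  is_derive x 1 g b -> is_derive x 1 (fun t => f (g t)) (a * b).
Proof. exact: is_derive1_comp. Qed.

Lemma is_derive_fun_affine c d x : is_derive x 1 (fun t => c * t + d) c.
Proof.
apply: is_derive_val (is_derive_funD (is_derive_funZ c (is_derive_id x 1))
  (is_derive_cst d x 1)) _.
by rewrite addr0 mulr1.
Qed.

Lemma is_derive_funX n f x a : is_derive x 1 f a ->
  is_derive x 1 (fun t => f t ^+ n) (n%:R * f x ^+ n.-1 * a).
Proof.
move=> fa; rewrite (_ : (fun _ => _) = f ^+ n); first exact: is_deriveX.
apply/funext => t; elim: n => [|n IH]; first by rewrite !expr0.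
by rewrite !exprS IH.
Qed.

Lemma is_derive_fun_powR c f x a : is_derive x 1 f a -> 0 < f x ->
  is_derive x 1 (fun t => f t `^ c) (c * f x `^ (c - 1) * a).
Proof.
move=> fa fx; apply: (is_derive_fun_comp (f := fun y => y `^ c)) fa.
exact: is_derive1_powR.
Qed.

Lemma is_derive_fun_sum (I : Type) (s : seq I) (F : I -> R -> R) (d : I -> R) x :
  (forall i, is_derive x 1 (F i) (d i)) ->
  is_derive x 1 (fun t => \sum_(i <- s) F i t) (\sum_(i <- s) d i).
Proof.
move=> Fd; elim: s => [|i s IH].
  by under eq_fun do rewrite big_nil; rewrite big_nil; exact: is_derive_cst.
under eq_fun do rewrite big_cons; rewrite big_cons; exact: is_derive_funD.
Qed.

Lemma is_derive_continuous f x a : is_derive x 1 f a -> {for x, continuous f}.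
Proof.
by move=> h; apply/differentiable_continuous/derivable1_diffP; case: h.
Qed.

Lemma is_derive_derive1 f x a : is_derive x 1 f a -> derive1 f x = a.
Proof. by move=> h; rewrite derive1E; case: h. Qed.

Lemma ge0_is_derive_le f g (a b : R) : a <= b ->
  {within `[a, b], continuous f} ->
  (forall x, a < x < b -> is_derive x 1 f (g x)) ->
  (forall x, a < x < b -> 0 <= g x) -> f a <= f b.
Proof.
move=> ab cf fg g0.
have h x : x \in `]a, b[ -> is_derive x 1 f (g x).
  by rewrite in_itv => /fg.
apply: (@ger0_derive1_ndecr _ f a b) => // x xab.
  by case: (h x xab).
by rewrite (is_derive_derive1 (h x xab)) g0//; move: xab; rewrite in_itv.
Qed.

Lemma is_derive0_eq f (a b : R) : a <= b ->
  {within `[a, b], continuous f} ->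
  (forall x, a < x < b -> is_derive x 1 f 0) -> f a = f b.
Proof.
move=> ab cf fg; apply/le_anti/andP; split.
  by apply: (@ge0_is_derive_le f (fun=> 0)).
rewrite -lerN2; apply: (@ge0_is_derive_le (fun t => - f t) (fun=> 0)) => //.
  by move=> x; apply: cvgN; exact: cf.
by move=> x xab; rewrite -oppr0; apply/is_derive_funN/fg.
Qed.

End DerivativeRules.

Section ContinuityRules.
Context {R : realType} {T : topologicalType}.
Implicit Types f g : T -> R.

Lemma continuous_funD f g : continuous f -> continuous g ->
  continuous (fun x => f x + g x).
Proof. by move=> cf cg x; apply: cvgD; [exact: cf|exact: cg]. Qed.

Lemma continuous_funB f g : continuous f -> continuous g ->
  continuous (fun x => f x - g x).
Proof. by move=> cf cg x; apply: cvgB; [exact: cf|exact: cg]. Qed.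

Lemma continuous_funN f : continuous f -> continuous (fun x => - f x).
Proof. by move=> cf x; apply: cvgN; exact: cf. Qed.

Lemma continuous_funM f g : continuous f -> continuous g ->
  continuous (fun x => f x * g x).
Proof. by move=> cf cg x; apply: cvgM; [exact: cf|exact: cg]. Qed.

Lemma continuous_fun_cst (c : R) : continuous (fun _ : T => c).
Proof. by move=> x; exact: cvg_cst. Qed.

Lemma continuous_fun_norm f : continuous f -> continuous (fun x => `|f x|).
Proof. by move=> cf x; apply: cvg_norm; exact: cf. Qed.

Lemma continuous_fun_comp (h : R -> R) f : continuous h -> continuous f ->
  continuous (fun x => h (f x)).
Proof. by move=> ch cf x; apply: (continuous_comp (cf x)); exact: ch. Qed.

Lemma continuous_funX n f : continuous f -> continuous (fun x => f x ^+ n).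
Proof. exact: (continuous_fun_comp (@exprn_continuous R n)). Qed.

Lemma continuous_fun_sum (I : Type) (s : seq I) (F : I -> T -> R) :
  (forall i, continuous (F i)) -> continuous (fun x => \sum_(i <- s) F i x).
Proof.
move=> cF; elim: s => [|i s IH].
  by under eq_fun do rewrite big_nil; exact: continuous_fun_cst.
by under eq_fun do rewrite big_cons; exact: continuous_funD.
Qed.

Lemma continuous_fun_powR c f : continuous f -> (forall x, 0 < f x) ->
  continuous (fun x => f x `^ c).
Proof.
move=> cf f0 x.
apply: (@continuous_comp _ _ _ f (fun y => y `^ c)); first exact: cf.
exact: (is_derive_continuous (is_derive1_powR c (f0 x))).
Qed.

Lemma continuous_ge0_powR c f : 0 < c -> continuous f -> (forall x, 0 <= f x) ->
  continuous (fun x => f x `^ c).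
Proof.
move=> c0 cf f0 x; have [fx|fx] := ltP 0 (f x).
  apply: (@continuous_comp _ _ _ f (fun y => y `^ c)); first exact: cf.
  exact: (is_derive_continuous (is_derive1_powR c fx)).
have fx0 : f x = 0 by apply/le_anti; rewrite fx f0.
rewrite /continuous_at fx0 powR0 ?gt_eqF//.
apply/cvgrPdist_lt => e e0; near=> y.
rewrite sub0r normrN ger0_norm ?powR_ge0//.
rewrite -[ltRHS](@powRr1 _ e) ?ltW// -(@mulVf _ c) ?gt_eqF// powRrM.
rewrite gt0_ltr_powR ?nnegrE ?powR_ge0//.
have : `|f x - f y| < e `^ c^-1.
  by near: y; apply: cvgr_dist_lt; [exact: cf|rewrite powR_gt0].
by rewrite fx0 sub0r normrN ger0_norm.
Unshelve. all: by end_near. Qed.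

End ContinuityRules.

Ltac continuous_step := lazymatch goal with
  | |- forall x, continuous_at x (fun t => Algebra.add _ _) =>
      apply: continuous_funD
  | |- forall x, continuous_at x (fun t => Algebra.opp _) =>
      apply: continuous_funN
  | |- forall x, continuous_at x (fun t => GRing.mul _ _) =>
      apply: continuous_funM
  end.

Lemma continuous_fun_within {R : realType} (A : set R) (f : R -> R) :
  continuous f -> {within A, continuous f}.
Proof. exact: continuous_subspaceT. Qed.

(** * Integration over [0, 1] and differentiation under the integral sign *)

Section IntegralUnitInterval.
Context {R : realType}.
Implicit Types (f g F : R -> R) (x c r : R).

Definition int01 f : R := \int[lebesgue_measure]_(x in `[0, 1]) f x.

Lemma continuous_integrable_itv f a b : continuous f ->
  lebesgue_measure.-integrable `[a, b] (EFin \o f).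
Proof.
move=> cf; apply: continuous_compact_integrable; first exact: segment_compact.
exact: continuous_fun_within.
Qed.

Lemma int01D f g : continuous f -> continuous g ->
  int01 (fun x => f x + g x) = int01 f + int01 g.
Proof. by move=> cf cg; apply: RintegralD => //; exact: continuous_integrable_itv. Qed.

Lemma int01B f g : continuous f -> continuous g ->
  int01 (fun x => f x - g x) = int01 f - int01 g.
Proof. by move=> cf cg; apply: RintegralB => //; exact: continuous_integrable_itv. Qed.

Lemma int01Z c f : continuous f -> int01 (fun x => c * f x) = c * int01 f.
Proof. by move=> cf; apply: RintegralZl => //; exact: continuous_integrable_itv. Qed.

Lemma int01_le f g : continuous f -> continuous g ->
  (forall x, 0 <= x <= 1 -> f x <= g x) -> int01 f <= int01 g.
Proof.
by move=> cf cg fg; apply: le_Rintegral => //; exact: continuous_integrable_itv.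
Qed.

Lemma int01_cst c : int01 (fun=> c) = c.
Proof.
rewrite /int01 Rintegral_cst//= lebesgue_measure_itv/= lte_fin ltr01 oppr0.
by rewrite adde0 mulr1.
Qed.

Lemma int01_ge0 f : continuous f -> (forall x, 0 <= x <= 1 -> 0 <= f x) -> 0 <= int01 f.
Proof.
by move=> cf f0; rewrite -(int01_cst 0); apply: int01_le => //; exact: continuous_fun_cst.
Qed.

Lemma int01_sum (I : Type) (s : seq I) (F : I -> R -> R) :
  (forall i, continuous (F i)) ->
  int01 (fun x => \sum_(i <- s) F i x) = \sum_(i <- s) int01 (F i).
Proof.
move=> cF; elim: s => [|i s IH].
  by under eq_fun do rewrite big_nil; rewrite big_nil int01_cst.
under eq_fun do rewrite big_cons; rewrite big_cons -IH int01D//.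
exact: continuous_fun_sum.
Qed.

Lemma Rintegral_FTC f F (a b : R) : a < b -> continuous f ->
  (forall x, is_derive x 1 F (f x)) ->
  \int[lebesgue_measure]_(x in `[a, b]) f x = F b - F a.
Proof.
move=> ab cf Ff; rewrite /Rintegral (@continuous_FTC2 _ f F)//.
- exact: continuous_fun_within.
- split=> [x _|//|//]; first by case: (Ff x).
    by apply: cvg_at_right_filter; exact: is_derive_continuous (Ff a).
  by apply: cvg_at_left_filter; exact: is_derive_continuous (Ff b).
- by move=> x _; exact: is_derive_derive1 (Ff x).
Qed.

Lemma int01_FTC f F : continuous f -> (forall x, is_derive x 1 F (f x)) ->
  int01 f = F 1 - F 0.
Proof. by move=> cf Ff; exact: Rintegral_FTC. Qed.

Lemma antiderivative_itv f (a b : R) : continuous f ->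
  let F x := \int[lebesgue_measure]_(t in `[a, x]) f t in
  forall x, a < x < b -> is_derive x 1 F (f x).
Proof.
move=> cf F x /andP[ax xb].
have [h1 h2] := @continuous_FTC1_closed R f a x b xb
  (continuous_integrable_itv a b cf) ax (cf x).
by rewrite -h2 derive1E; exact: derivableP.
Qed.

Lemma is_derive_int01 (f f' : R -> R -> R) r :
  (forall r x, is_derive r 1 (f^~ x) (f' r x)) ->
  continuous (fun z : R * R => f' z.1 z.2) ->
  (forall r, continuous (f r)) ->
  is_derive r 1 (fun r => int01 (f r)) (int01 (f' r)).
Proof.
move=> ff' cf' cf.
(* Compactness of this rectangle bounds the continuous derivative, and the constant bound serves for
   domination. *)
pose D := `[r - 1, r + 1]%classic `*` `[0, 1]%classic : set (R * R).
have cD : compact D by apply: compact_setX; exact: segment_compact.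
have : compact [set f' z.1 z.2 | z in D].
  by apply: continuous_compact => //; exact: continuous_subspaceT.
move=> /compact_bounded[M [_ /(_ (M + 1))]]; rewrite ltrDl ltr01 => /(_ isT) hM.
have hb s x : r - 1 < s < r + 1 -> 0 <= x <= 1 -> `|f' s x| <= M + 1.
  move=> /andP[s1 s2] x01; apply: hM; exists (s, x) => //.
  by split; rewrite /= in_itv/= ?(ltW s1) ?(ltW s2).
have p1E s x : partial1of2 f s x = f' s x.
  exact: is_derive_derive1.
have M0 : 0 <= M + 1.
  by apply: le_trans (normr_ge0 _) (hb r 0 _ _); rewrite ?lexx ?ler01//; lra.
have mI : measurable (`[0, 1]%classic : set R) by [].
have rI : `]r - 1, r + 1[%classic r by rewrite /= in_itv/=; lra.
have i1 s : `]r - 1, r + 1[%classic s ->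
    lebesgue_measure.-integrable `[0, 1] (EFin \o f s).
  by move=> _; exact: continuous_integrable_itv.
have i2 s x : `]r - 1, r + 1[%classic s -> `[0, 1]%classic x ->
  derivable (f^~ x) s 1 by move=> _ _; case: (ff' s x).
have i3 : lebesgue_measure.-integrable `[0, 1] (EFin \o (fun _ : R => M + 1)).
  by apply: continuous_integrable_itv; exact: continuous_fun_cst.
have i4 s x : `]r - 1, r + 1[%classic s -> `[0, 1]%classic x ->
    `|partial1of2 f s x| <= M + 1.
  by rewrite /= !in_itv/= p1E; exact: hb.
have h1 := @differentiation_under_integral _ _ _ lebesgue_measure f _ mI
  r _ _ rI i1 i2 (fun=> M + 1) (fun=> M0) i3 i4.
have h2 := @derivable_under_integral _ _ _ lebesgue_measure f _ mI
  r _ _ rI i1 i2 (fun=> M + 1) (fun=> M0) i3 i4.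
apply: is_derive_val (derivableP h2) _; rewrite -derive1E h1.
by apply: eq_Rintegral => x _; rewrite p1E.
Qed.

End IntegralUnitInterval.

(** * Conjugate functions and M. Riesz's inequality *)

Section Waves.
Context {R : realType}.
Implicit Types (s : seq (R * nat)) (ph r x y : R).

(* For [s] a list of pairs (weight, frequency), [wave cos s ph] and
   [wave sin s ph] are conjugate harmonic functions in the polar coordinates
   [r], [pi x]. *)
Definition wave (trig : R -> R) s ph r x :=
  \sum_(wn <- s) wn.1 * r ^+ wn.2 * trig (wn.2%:R * pi * x - ph).

Definition wave_dr (trig : R -> R) s ph r x :=
  \sum_(wn <- s) wn.1 * (wn.2%:R * r ^+ wn.2.-1) * trig (wn.2%:R * pi * x - ph).

(** On waves this is the operator r d/dr; up to a factor pi, a sign and the exchange of cos and sin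
    it is also d/dx. *)
Definition freq s : seq (R * nat) := [seq (wn.1 * wn.2%:R, wn.2) | wn <- s].

Lemma continuous_slice (f : R -> R -> R) r :
  continuous (fun z : R * R => f z.1 z.2) -> continuous (f r).
Proof.
have cp (x : R) : {for x, continuous (fun x : R => (r, x))}.
  exact: (cvg_pair (cvg_cst r) cvg_id).
move=> cf x.
exact: (@continuous_comp _ _ _ _ (fun z : R * R => f z.1 z.2) x (cp x) (cf _)).
Qed.

Lemma continuous_wave trig s ph : continuous trig ->
  continuous (fun z : R * R => wave trig s ph z.1 z.2).
Proof.
move=> ct; apply: continuous_fun_sum => wn.
apply: continuous_funM.
  apply: continuous_funM; first exact: continuous_fun_cst.
  by apply: continuous_funX => z; exact: cvg_fst.
apply: continuous_fun_comp => //.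
apply: continuous_funB; last exact: continuous_fun_cst.
apply: continuous_funM; first exact: continuous_fun_cst.
by move=> z; exact: cvg_snd.
Qed.

Lemma continuous_wave_dr trig s ph : continuous trig ->
  continuous (fun z : R * R => wave_dr trig s ph z.1 z.2).
Proof.
move=> ct; apply: continuous_fun_sum => wn.
apply: continuous_funM.
  apply: continuous_funM; first exact: continuous_fun_cst.
  apply: continuous_funM; first exact: continuous_fun_cst.
  by apply: continuous_funX => z; exact: cvg_fst.
apply: continuous_fun_comp => //.
apply: continuous_funB; last exact: continuous_fun_cst.
apply: continuous_funM; first exact: continuous_fun_cst.
by move=> z; exact: cvg_snd.
Qed.

Lemma is_derive_wave_r trig s ph r x :
  is_derive r 1 (fun r => wave trig s ph r x) (wave_dr trig s ph r x).
Proof.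
apply: is_derive_fun_sum => wn.
have h := is_derive_funZ (wn.1 * trig (wn.2%:R * pi * x - ph))
  (is_derive_funX wn.2 (is_derive_id r 1)).
rewrite (_ : (fun _ => _) = (fun t => wn.1 * trig (wn.2%:R * pi * x - ph) *
  id t ^+ wn.2)); last by apply/funext => t; rewrite mulrAC.
by apply: is_derive_val h _; rewrite /= mulr1 mulrAC.
Qed.

Lemma wave_drM trig s ph r x :
  r * wave_dr trig s ph r x = wave trig (freq s) ph r x.
Proof.
rewrite /wave /wave_dr /freq big_map mulr_sumr; apply: eq_bigr => -[w n] _ /=.
case: n => [|n]; first by rewrite !(mul0r, mulr0).
by rewrite exprS /=; ring.
Qed.

Lemma is_derive_wave_x (trig trig' : R -> R) s ph r x :
  (forall y, is_derive y 1 trig (trig' y)) ->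
  is_derive x 1 (wave trig s ph r) (pi * wave trig' (freq s) ph r x).
Proof.
move=> tt'; rewrite /wave /freq big_map mulr_sumr.
apply: is_derive_fun_sum => -[w n] /=.
have h := is_derive_funZ (w * r ^+ n) (@is_derive_fun_comp _ _
  (fun t => n%:R * pi * t - ph) x _ _ (tt' _) (is_derive_fun_affine (n%:R * pi) (- ph) x)).
by apply: is_derive_val h _; ring.
Qed.

Lemma wave_freq0 trig s ph x : wave trig (freq s) ph 0 x = 0.
Proof. by rewrite -wave_drM mul0r. Qed.

Lemma waveN trig s ph r x :
  wave (fun y => - trig y) s ph r x = - wave trig s ph r x.
Proof. by rewrite -sumrN; apply: eq_bigr => i _; rewrite mulrN. Qed.

End Waves.

(** * Means of subharmonic functions of a conjugate pair over half circles *)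

Section SubharmonicMean.
Context {R : realType}.
Variables F F1 F2 F11 F12 F22 : R -> R -> R.
(** Partial derivatives are specified by the chain rule along curves, the form in which the argument
    uses them. *)
Let chain (G G1 G2 : R -> R -> R) := forall (al be : R -> R) (t a b : R),
  is_derive t 1 al a -> is_derive t 1 be b ->
  is_derive t 1 (fun t => G (al t) (be t))
    (G1 (al t) (be t) * a + G2 (al t) (be t) * b).
Let cont (G : R -> R -> R) := forall (T : topologicalType) (al be : T -> R),
  continuous al -> continuous be -> continuous (fun t => G (al t) (be t)).
Hypothesis F_chain : chain F F1 F2.
Hypothesis F1_chain : chain F1 F11 F12.
Hypothesis F2_chain : chain F2 F12 F22.
Hypothesis F_cont : cont F.
Hypothesis F1_cont : cont F1.
Hypothesis F2_cont : cont F2.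
Hypothesis F11_cont : cont F11.
Hypothesis F12_cont : cont F12.
Hypothesis F22_cont : cont F22.
Hypothesis laplacian_ge0 : forall u v, 0 <= F11 u v + F22 u v.
Variables (s : seq (R * nat)) (ph : R).
Let u := wave cos s ph.
Let v := wave sin s ph.
Let u1 := wave cos (freq s) ph.
Let v1 := wave sin (freq s) ph.
Let u2 := wave cos (freq (freq s)) ph.
Let v2 := wave sin (freq (freq s)) ph.
(** Up to the factor pi this is the x-derivative of F(u, v): a Neumann condition on the diameter of
    the half disc 0 <= x <= 1. *)
Hypothesis flux0 : forall r x, x = 0 \/ x = 1 ->
  F2 (u r x) (v r x) * u1 r x - F1 (u r x) (v r x) * v1 r x = 0.

Let csin := @continuous_sin R.
Let ccos := @continuous_cos R.

(** [Q] is r dG/dr and [T] is dG/dx divided by pi, so that r [Qr] + [T2] is r^2 times the Laplacian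
    of [G] in polar coordinates of angle pi x. *)
Let G r x := F (u r x) (v r x).
Let Gr r x := F1 (u r x) (v r x) * wave_dr cos s ph r x +
              F2 (u r x) (v r x) * wave_dr sin s ph r x.
Let Q r x := F1 (u r x) (v r x) * u1 r x + F2 (u r x) (v r x) * v1 r x.
Let Qr r x :=
  (F11 (u r x) (v r x) * wave_dr cos s ph r x +
   F12 (u r x) (v r x) * wave_dr sin s ph r x) * u1 r x +
  F1 (u r x) (v r x) * wave_dr cos (freq s) ph r x +
  ((F12 (u r x) (v r x) * wave_dr cos s ph r x +
   F22 (u r x) (v r x) * wave_dr sin s ph r x) * v1 r x +
  F2 (u r x) (v r x) * wave_dr sin (freq s) ph r x).
Let T r x := F2 (u r x) (v r x) * u1 r x - F1 (u r x) (v r x) * v1 r x.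
Let T2 r x :=
  (- F12 (u r x) (v r x) * v1 r x + F22 (u r x) (v r x) * u1 r x) * u1 r x
  - F2 (u r x) (v r x) * v2 r x
  - ((- F11 (u r x) (v r x) * v1 r x + F12 (u r x) (v r x) * u1 r x) * v1 r x
     + F1 (u r x) (v r x) * u2 r x).

Let cwave trig sq : continuous trig ->
  continuous (fun z : R * R => wave trig sq ph z.1 z.2).
Proof. exact: continuous_wave. Qed.

Let cwave_dr trig sq : continuous trig ->
  continuous (fun z : R * R => wave_dr trig sq ph z.1 z.2).
Proof. exact: continuous_wave_dr. Qed.

Let cF (H : R -> R -> R) : cont H ->
  continuous (fun z : R * R => H (u z.1 z.2) (v z.1 z.2)).
Proof. by move=> cH; apply: cH; exact: cwave. Qed.

Local Ltac cont_tac := repeat first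
  [ continuous_step | exact: cF | exact: cwave | exact: cwave_dr].

Let cG : continuous (fun z : R * R => G z.1 z.2).
Proof. exact: cF. Qed.
Let cGr : continuous (fun z : R * R => Gr z.1 z.2).
Proof. by rewrite /Gr; cont_tac. Qed.
Let cQ : continuous (fun z : R * R => Q z.1 z.2).
Proof. by rewrite /Q; cont_tac. Qed.
Let cQr : continuous (fun z : R * R => Qr z.1 z.2).
Proof. by rewrite /Qr; cont_tac. Qed.
Let cT2 : continuous (fun z : R * R => T2 z.1 z.2).
Proof. by rewrite /T2; cont_tac. Qed.

Let dG (r x : R) : is_derive r 1 (G^~ x) (Gr r x).
Proof. by apply: F_chain; exact: is_derive_wave_r. Qed.

Let dQ (r x : R) : is_derive r 1 (Q^~ x) (Qr r x).
Proof.
apply: is_derive_funD; apply: is_derive_funM;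
  try exact: is_derive_wave_r.
- by apply: F1_chain; exact: is_derive_wave_r.
- by apply: F2_chain; exact: is_derive_wave_r.
Qed.

Let du sq (r x : R) : is_derive x 1 (wave cos sq ph r) (- (pi * wave sin (freq sq) ph r x)).
Proof.
apply: is_derive_val (is_derive_wave_x sq ph r x (@is_derive_cos R)) _.
by rewrite waveN mulrN.
Qed.

Let dv sq (r x : R) : is_derive x 1 (wave sin sq ph r) (pi * wave cos (freq sq) ph r x).
Proof. exact: is_derive_wave_x (@is_derive_sin R). Qed.

Let dT (r x : R) : is_derive x 1 (T r) (pi * T2 r x).
Proof.
have h1 := is_derive_funM (F2_chain (du s r x) (dv s r x)) (du (freq s) r x).
have h2 := is_derive_funM (F1_chain (du s r x) (dv s r x)) (dv (freq s) r x).
apply: is_derive_val (is_derive_funB h1 h2) _.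
by rewrite /T2 -/u -/v -/u1 -/v1 -/u2 -/v2; ring.
Qed.

Let int_T2 r : int01 (T2 r) = 0.
Proof.
have cpT : continuous (fun x => pi * T2 r x).
  apply: continuous_funM; first exact: continuous_fun_cst.
  exact: continuous_slice.
have := int01_FTC cpT (dT r).
rewrite /T !flux0 ?subrr; [|by left|by right].
rewrite int01Z; last exact: continuous_slice.
by move=> /eqP; rewrite mulf_eq0 gt_eqF ?pi_gt0// => /eqP.
Qed.

Let int_Qr (r : R) : 0 <= r * int01 (Qr r).
Proof.
rewrite -int01Z; last exact: continuous_slice.
suff : 0 <= int01 (fun x => r * Qr r x + T2 r x).
  rewrite int01D ?int_T2 ?addr0//; last exact: continuous_slice.
  by apply: continuous_funM; [exact: continuous_fun_cst|exact: continuous_slice].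
apply: int01_ge0.
  apply: continuous_funD; last exact: continuous_slice.
  by apply: continuous_funM; [exact: continuous_fun_cst|exact: continuous_slice].
move=> x _.
(* By the Cauchy-Riemann equations the Laplacian of F(u, v) is that of F times |grad u|^2; the
   second factor is r^2 |grad u|^2. *)
have <- : (F11 (u r x) (v r x) + F22 (u r x) (v r x)) *
    (u1 r x ^+ 2 + v1 r x ^+ 2) = r * Qr r x + T2 r x.
  have e1 := wave_drM cos s ph r x; have e2 := wave_drM sin s ph r x.
  have e3 := wave_drM cos (freq s) ph r x.
  have e4 := wave_drM sin (freq s) ph r x.
  transitivity ((F11 (u r x) (v r x) * (r * wave_dr cos s ph r x) +
    F12 (u r x) (v r x) * (r * wave_dr sin s ph r x)) * u1 r x +
    F1 (u r x) (v r x) * (r * wave_dr cos (freq s) ph r x) +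
    ((F12 (u r x) (v r x) * (r * wave_dr cos s ph r x) +
    F22 (u r x) (v r x) * (r * wave_dr sin s ph r x)) * v1 r x +
    F2 (u r x) (v r x) * (r * wave_dr sin (freq s) ph r x)) + T2 r x).
    by rewrite e1 e2 e3 e4 -/u1 -/v1 -/u2 -/v2 /T2; ring.
  by rewrite /Qr; ring.
by rewrite mulr_ge0// addr_ge0 ?sqr_ge0.
Qed.

Let int_Q_ge0 (r : R) : 0 <= r <= 1 -> 0 <= int01 (Q r).
Proof.
move=> /andP[r0 r1].
have Q0 : int01 (Q 0) = 0.
  rewrite -[RHS](int01_cst 0); congr int01; apply/funext => x.
  by rewrite /Q /u1 /v1 !wave_freq0 !mulr0 addr0.
have dI (t : R) := is_derive_int01 t dQ cQr
  (fun r => @continuous_slice R Q r cQ).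
rewrite -Q0; apply: (@ge0_is_derive_le _ (fun r => int01 (Q r)) (fun t => int01 (Qr t))
  0 r r0).
- by apply: continuous_fun_within => t; exact: is_derive_continuous (dI t).
- by move=> t /andP[t0 _]; rewrite -(pmulr_rge0 _ t0); exact: int_Qr.
Qed.

(** The mean of [G] has r-derivative (int Q) / r. Here int Q vanishes at r = 0 and is nondecreasing,
    by subharmonicity and the Neumann condition. *)
Lemma subharmonic_mean_le :
  int01 (fun x => F (u 0 x) (v 0 x)) <= int01 (fun x => F (u 1 x) (v 1 x)).
Proof.
have dI (t : R) := is_derive_int01 t dG cGr
  (fun r => @continuous_slice R G r cG).
apply: (@ge0_is_derive_le _ (fun r => int01 (G r)) (fun t => int01 (Gr t))
  0 1 ler01).
- by apply: continuous_fun_within => t; exact: is_derive_continuous (dI t).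
- move=> t /andP[t0 t1]; rewrite -(pmulr_rge0 _ t0) -int01Z; last first.
    exact: continuous_slice.
  rewrite (_ : (fun _ => _) = Q t); first by rewrite int_Q_ge0// !ltW.
  by apply/funext => x; rewrite /Gr mulrDr !(mulrCA t) !wave_drM.
Qed.

End SubharmonicMean.

(** * Laplacians of regularized power weights *)

Section PowerWeights.
Context {R : realType}.
Variable eps : R.
Hypothesis eps_gt0 : 0 < eps.
Implicit Types a b c u v : R.

(** The shift by [eps] keeps both bases positive, hence the weight is smooth for all real exponents;
    it is sent to 0 in [conjugate_le]. The suffixes below record partial derivatives. *)
Definition mono a b u v := (u ^+ 2 + eps) `^ a * (u ^+ 2 + v ^+ 2 + eps) `^ b.
Definition mono1 a b u v := 2 * u * (a * mono (a - 1) b u v + b * mono a (b - 1) u v).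
Definition mono2 a b u v := 2 * b * v * mono a (b - 1) u v.
Definition mono11 a b u v := 2 * (a * mono (a - 1) b u v + b * mono a (b - 1) u v)
  + 2 * u * (a * mono1 (a - 1) b u v + b * mono1 a (b - 1) u v).
Definition mono12 a b u v := 2 * b * v * mono1 a (b - 1) u v.
Definition mono22 a b u v := 2 * b * mono a (b - 1) u v +
  2 * b * v * mono2 a (b - 1) u v.

Let X_gt0 u : 0 < u ^+ 2 + eps.
Proof. by rewrite ltr_wpDl// sqr_ge0. Qed.

Let W_gt0 u v : 0 < u ^+ 2 + v ^+ 2 + eps.
Proof. by rewrite ltr_wpDl// addr_ge0// sqr_ge0. Qed.

Lemma is_derive_mono a b (al be : R -> R) (t x y : R) :
  is_derive t 1 al x -> is_derive t 1 be y ->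
  is_derive t 1 (fun t => mono a b (al t) (be t))
    (mono1 a b (al t) (be t) * x + mono2 a b (al t) (be t) * y).
Proof.
move=> alx bey.
have dX : is_derive t 1 (fun t => al t ^+ 2 + eps) (2 * al t * x).
  apply: is_derive_val
    (is_derive_funD (is_derive_funX 2 alx) (is_derive_cst eps t 1)) _.
  by rewrite addr0.
have dW : is_derive t 1 (fun t => al t ^+ 2 + be t ^+ 2 + eps)
    (2 * al t * x + 2 * be t * y).
  apply: is_derive_val (is_derive_funD (is_derive_funD (is_derive_funX 2 alx)
    (is_derive_funX 2 bey)) (is_derive_cst eps t 1)) _.
  by rewrite addr0.
have h := is_derive_funM (is_derive_fun_powR a dX (X_gt0 (al t)))
  (is_derive_fun_powR b dW (W_gt0 (al t) (be t))).
by apply: is_derive_val h _; rewrite /mono1 /mono2 /mono; ring.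
Qed.

Lemma is_derive_mono1 a b (al be : R -> R) (t x y : R) :
  is_derive t 1 al x -> is_derive t 1 be y ->
  is_derive t 1 (fun t => mono1 a b (al t) (be t))
    (mono11 a b (al t) (be t) * x + mono12 a b (al t) (be t) * y).
Proof.
move=> alx bey.
have d1 := is_derive_funZ a (is_derive_mono (a - 1) b alx bey).
have d2 := is_derive_funZ b (is_derive_mono a (b - 1) alx bey).
have h := is_derive_funM (is_derive_funZ 2 alx) (is_derive_funD d1 d2).
apply: is_derive_val h _; rewrite /mono12 /mono11 /mono1 /mono2 /=.
by ring.
Qed.

Lemma is_derive_mono2 a b (al be : R -> R) (t x y : R) :
  is_derive t 1 al x -> is_derive t 1 be y ->
  is_derive t 1 (fun t => mono2 a b (al t) (be t))
    (mono12 a b (al t) (be t) * x + mono22 a b (al t) (be t) * y).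
Proof.
move=> alx bey.
have d2 := is_derive_mono a (b - 1) alx bey.
have h := is_derive_funM (is_derive_funZ (2 * b) bey) d2.
by apply: is_derive_val h _; rewrite /mono12 /mono22 /=; ring.
Qed.

Section Continuity.
Variables (T : topologicalType) (al be : T -> R).
Hypotheses (cal : continuous al) (cbe : continuous be).

Lemma continuous_mono a b : continuous (fun t => mono a b (al t) (be t)).
Proof.
have cX : continuous (fun t => al t ^+ 2 + eps).
  by apply: continuous_funD; [exact: continuous_funX|exact: continuous_fun_cst].
have cW : continuous (fun t => al t ^+ 2 + be t ^+ 2 + eps).
  apply: continuous_funD; last exact: continuous_fun_cst.
  by apply: continuous_funD; exact: continuous_funX.
by apply: continuous_funM; apply: continuous_fun_powR.
Qed.

Local Ltac cont_tac := repeat first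
  [ continuous_step | exact: continuous_fun_cst | exact: cal | exact: cbe
  | exact: continuous_mono].

Lemma continuous_mono1 a b : continuous (fun t => mono1 a b (al t) (be t)).
Proof. by rewrite /mono1; cont_tac. Qed.

Lemma continuous_mono2 a b : continuous (fun t => mono2 a b (al t) (be t)).
Proof. by rewrite /mono2; cont_tac. Qed.

Lemma continuous_mono11 a b : continuous (fun t => mono11 a b (al t) (be t)).
Proof. by rewrite /mono11; cont_tac; exact: continuous_mono1. Qed.

Lemma continuous_mono12 a b : continuous (fun t => mono12 a b (al t) (be t)).
Proof. by rewrite /mono12; cont_tac; exact: continuous_mono1. Qed.

Lemma continuous_mono22 a b : continuous (fun t => mono22 a b (al t) (be t)).
Proof. by rewrite /mono22; cont_tac; exact: continuous_mono2. Qed.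

End Continuity.

Lemma powRB1 (x a : R) : 0 < x -> x `^ (a - 1) = x `^ a / x.
Proof.
by move=> x0; rewrite powRB ?(gt_eqF x0) ?implybT// powRr1// ltW.
Qed.

Lemma laplacian_mono a b u v (X := u ^+ 2 + eps) (W := u ^+ 2 + v ^+ 2 + eps) :
  mono11 a b u v + mono22 a b u v = mono a b u v *
  (2 * a / X + 4 * b / W + 4 * a * (a - 1) * u ^+ 2 / X ^+ 2 +
   4 * b * (b - 1) * (u ^+ 2 + v ^+ 2) / W ^+ 2 + 8 * a * b * u ^+ 2 / (X * W)).
Proof.
have X0 : X != 0 by rewrite gt_eqF// X_gt0.
have W0 : W != 0 by rewrite gt_eqF// W_gt0.
rewrite /mono11 /mono22 /mono1 /mono2 /mono.
rewrite !(powRB1 _ (X_gt0 u)) !(powRB1 _ (W_gt0 u v)) -/X -/W.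
by field; rewrite X0 W0.
Qed.

(** Since 0 <= u^2 + v^2 <= W, the factor W + (c - 1)(u^2 + v^2) is at most (1 + c) W, on either
    side of c = 1. *)
Lemma laplacian_W_le c u v : 0 < c ->
  mono11 0 c u v + mono22 0 c u v <=
  4 * c * (1 + c) * ((u ^+ 2 + v ^+ 2 + eps) `^ c / (u ^+ 2 + v ^+ 2 + eps)).
Proof.
move=> c0; rewrite laplacian_mono /mono powRr0 mul1r.
set W := u ^+ 2 + v ^+ 2 + eps; have W0 : 0 < W := W_gt0 u v.
rewrite [leRHS]mulrCA ler_wpM2l ?powR_ge0//.
rewrite !(mul0r, mulr0, addr0, add0r).
have -> : 4 * c / W + 4 * c * (c - 1) * (u ^+ 2 + v ^+ 2) / W ^+ 2 =
  4 * c * (W + (c - 1) * (u ^+ 2 + v ^+ 2)) / W ^+ 2.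
  by field; rewrite gt_eqF.
rewrite ler_pdivrMr ?exprn_gt0//.
have -> : 4 * c * (1 + c) / W * W ^+ 2 = 4 * c * ((1 + c) * W).
  by field; rewrite gt_eqF.
rewrite ler_pM2l; last lra.
have w0 : 0 <= u ^+ 2 + v ^+ 2 by rewrite addr_ge0 ?sqr_ge0.
rewrite /W; have e0 := eps_gt0; nra.
Qed.

(** As u^2 <= X, one has X + 2 (c - 1) u^2 >= (2 c - 1) X; moreover X^(c-1) >= W^(c-1) for c <= 1.
    With c = s / 2, positivity of 2 c - 1 is the condition s > 1. *)
Lemma laplacian_X_ge c u v : 2^-1 < c <= 1 ->
  2 * c * (2 * c - 1) *
    ((u ^+ 2 + v ^+ 2 + eps) `^ c / (u ^+ 2 + v ^+ 2 + eps)) <=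
  mono11 c 0 u v + mono22 c 0 u v.
Proof.
move=> /andP[c0 c1]; rewrite laplacian_mono /mono powRr0 mulr1.
rewrite -(powRB1 _ (W_gt0 u v)).
apply: (@le_trans _ _ (2 * c * (2 * c - 1) * (u ^+ 2 + eps) `^ (c - 1))).
  rewrite ler_wpM2l; [by []|by rewrite mulr_ge0//; lra|].
  rewrite -opprB !powRN lef_pV2 ?posrE ?powR_gt0//.
  rewrite ge0_ler_powR ?nnegrE ?subr_ge0 ?(ltW (X_gt0 _)) ?(ltW (W_gt0 _ _))//.
  by rewrite -addrA lerD2l lerDr sqr_ge0.
rewrite (powRB1 _ (X_gt0 u)) [leLHS]mulrCA ler_wpM2l ?powR_ge0//.
set X := u ^+ 2 + eps; have X0 : 0 < X := X_gt0 u.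
rewrite !(mul0r, mulr0, addr0, add0r).
have -> : 2 * c / X + 4 * c * (c - 1) * u ^+ 2 / X ^+ 2 =
  2 * c * (X + 2 * (c - 1) * u ^+ 2) / X ^+ 2.
  by field; rewrite gt_eqF.
rewrite ler_pdivlMr ?exprn_gt0//.
have -> : 2 * c * (2 * c - 1) / X * X ^+ 2 = 2 * c * ((2 * c - 1) * X).
  by field; rewrite gt_eqF.
rewrite ler_pM2l; last lra.
rewrite /X; have e0 := eps_gt0; nra.
Qed.

(** For c > 1 the comparison X^(c-1) >= W^(c-1) fails. The mixed weight X W^(c-1) replaces X^c: the
    second derivative of u^2 supplies 2 W^(c-1), and the other terms are nonnegative. *)
Lemma laplacian_XW_ge c u v : 1 <= c ->
  2 * ((u ^+ 2 + v ^+ 2 + eps) `^ c / (u ^+ 2 + v ^+ 2 + eps)) <=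
  mono11 1 (c - 1) u v + mono22 1 (c - 1) u v.
Proof.
move=> c1; rewrite laplacian_mono /mono.
rewrite -(powRB1 _ (W_gt0 u v)) powRr1 ?(ltW (X_gt0 u))//.
set X := u ^+ 2 + eps; have X0 : 0 < X := X_gt0 u.
set W := u ^+ 2 + v ^+ 2 + eps; have W0 : 0 < W := W_gt0 u v.
rewrite [leRHS]mulrAC ler_wpM2r ?powR_ge0//.
rewrite subrr !(mul0r, mulr0, addr0).
have -> : X * (2 * 1 / X + 4 * (c - 1) / W +
    4 * (c - 1) * (c - 1 - 1) * (u ^+ 2 + v ^+ 2) / W ^+ 2 +
    8 * 1 * (c - 1) * u ^+ 2 / (X * W)) =
  2 + 4 * (c - 1) * X * (W + (c - 1 - 1) * (u ^+ 2 + v ^+ 2)) / W ^+ 2 +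
    8 * (c - 1) * u ^+ 2 / W.
  by field; rewrite !gt_eqF.
have w0 : 0 <= u ^+ 2 + v ^+ 2 by rewrite addr_ge0 ?sqr_ge0.
have h1 : 0 <= W + (c - 1 - 1) * (u ^+ 2 + v ^+ 2).
  by rewrite /W; have e0 := eps_gt0; nra.
rewrite -addrA lerDl addr_ge0// divr_ge0 ?sqr_ge0 ?(ltW W0)//.
  by rewrite mulr_ge0// mulr_ge0 ?(ltW X0)//; lra.
by rewrite mulr_ge0 ?sqr_ge0//; lra.
Qed.

End PowerWeights.

(** * M. Riesz's inequality for conjugate trigonometric polynomials *)

Section ConjugateFunction.
Context {R : realType}.
Implicit Types (c C eps : R) (s : seq (R * nat)) (ph : R).

Lemma sin_natpi (n : nat) : sin (n%:R * pi) = 0 :> R.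
Proof.
elim: n => [|n IH]; first by rewrite mul0r sin0.
by rewrite -natr1 mulrDl mul1r sinDpi IH oppr0.
Qed.

Lemma cos_natpi (n : nat) : cos (n%:R * pi) = (-1) ^+ n :> R.
Proof.
elim: n => [|n IH]; first by rewrite mul0r cos0.
by rewrite -natr1 mulrDl mul1r cosDpi IH exprS mulN1r.
Qed.

Lemma wave_sin_end s r x : x = 0 \/ x = 1 -> wave sin s 0 r x = 0.
Proof.
move=> x01; apply: big1_seq => -[w n] _ /=; rewrite subr0.
by case: x01 => ->; rewrite ?mulr0 ?sin0 ?mulr1 ?sin_natpi mulr0.
Qed.

Lemma wave_cos_end s r x : x = 0 \/ x = 1 -> wave cos s (pi / 2) r x = 0.
Proof.
move=> x01; apply: big1_seq => -[w n] _ /=; rewrite cosBpihalf.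
by case: x01 => ->; rewrite ?mulr0 ?sin0 ?mulr1 ?sin_natpi mulr0.
Qed.

(** Phase 0 makes v vanish at x = 0 and x = 1, phase pi / 2 makes u vanish there; for weights even
    in u and in v either one gives the Neumann condition. The second clause normalizes the conjugate
    at the centre. *)
Definition conj_admissible s ph := (ph = 0 \/ ph = pi / 2) /\
  forall x, wave sin s ph 0 x = 0.

Lemma continuous_wave1 (trig : R -> R) s ph r : continuous trig ->
  continuous (wave trig s ph r).
Proof. by move=> ct;
exact: (@continuous_slice _ (wave trig s ph) r (@continuous_wave _ trig s ph ct)). Qed.

(* The function [C X^a W^b - W^c] of the pair of waves [(u, v)], with
   [X = u^2 + eps] and [W = X + v^2], is subharmonic, and nonnegative at the
   origin, where [v = 0]. *)
Lemma conj_weight_le (a b c C eps : R) : 0 < eps -> 1 <= C -> a + b = c ->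
  (forall u v, mono11 eps 0 c u v + mono22 eps 0 c u v <=
     C * (mono11 eps a b u v + mono22 eps a b u v)) ->
  forall s ph, conj_admissible s ph ->
  int01 (fun x => mono eps 0 c (wave cos s ph 1 x) (wave sin s ph 1 x)) <=
  C * int01 (fun x => mono eps a b (wave cos s ph 1 x) (wave sin s ph 1 x)).
Proof.
move=> e0 C1 abc lap s ph [phE v0].
have cw trig r := @continuous_wave1 trig s ph r.
have ccos := @continuous_cos R; have csin := @continuous_sin R.
have cm a' b' r : continuous
    (fun x => mono eps a' b' (wave cos s ph r x) (wave sin s ph r x)).
  by apply: continuous_mono => //; exact: cw.
have cCm a' b' r : continuous
    (fun x => C * mono eps a' b' (wave cos s ph r x) (wave sin s ph r x)).
  by apply: continuous_funM => //; exact: continuous_fun_cst.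
rewrite -subr_ge0 -int01Z// -int01B//.
pose comb (f g : R -> R -> R) (u v : R) := C * f u v - g u v.
have h := @subharmonic_mean_le R
  (comb (mono eps a b) (mono eps 0 c)) (comb (mono1 eps a b) (mono1 eps 0 c))
  (comb (mono2 eps a b) (mono2 eps 0 c)) (comb (mono11 eps a b) (mono11 eps 0 c))
  (comb (mono12 eps a b) (mono12 eps 0 c)) (comb (mono22 eps a b) (mono22 eps 0 c)).
apply: le_trans (h _ _ _ _ _ _ _ _ _ _ s ph _).
- apply: int01_ge0; first by apply: continuous_funB.
  move=> x _; rewrite /comb v0 /mono expr0n/= addr0 -powRD; last first.
    by apply/implyP => _; rewrite gt_eqF// ltr_wpDl// sqr_ge0.
  rewrite abc powRr0 mul1r -[X in _ - X]mul1r -mulrBl.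
  by rewrite mulr_ge0 ?powR_ge0// subr_ge0.
- move=> al be t x y alx bey.
  have d1 := is_derive_mono e0 a b alx bey.
  have d2 := is_derive_mono e0 0 c alx bey.
  apply: is_derive_val (is_derive_funB (is_derive_funZ C d1) d2) _.
  by rewrite /comb; ring.
- move=> al be t x y alx bey.
  have d1 := is_derive_mono1 e0 a b alx bey.
  have d2 := is_derive_mono1 e0 0 c alx bey.
  apply: is_derive_val (is_derive_funB (is_derive_funZ C d1) d2) _.
  by rewrite /comb; ring.
- move=> al be t x y alx bey.
  have d1 := is_derive_mono2 e0 a b alx bey.
  have d2 := is_derive_mono2 e0 0 c alx bey.
  apply: is_derive_val (is_derive_funB (is_derive_funZ C d1) d2) _.
  by rewrite /comb; ring.
- move=> T al be cal cbe; apply: continuous_funB; last exact: continuous_mono.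
  by apply: continuous_funM; [exact: continuous_fun_cst|exact: continuous_mono].
- move=> T al be cal cbe; apply: continuous_funB; last exact: continuous_mono1.
  by apply: continuous_funM; [exact: continuous_fun_cst|exact: continuous_mono1].
- move=> T al be cal cbe; apply: continuous_funB; last exact: continuous_mono2.
  by apply: continuous_funM; [exact: continuous_fun_cst|exact: continuous_mono2].
- move=> T al be cal cbe; apply: continuous_funB; last exact: continuous_mono11.
  by apply: continuous_funM; [exact: continuous_fun_cst|exact: continuous_mono11].
- move=> T al be cal cbe; apply: continuous_funB; last exact: continuous_mono12.
  by apply: continuous_funM; [exact: continuous_fun_cst|exact: continuous_mono12].
- move=> T al be cal cbe; apply: continuous_funB; last exact: continuous_mono22.
  by apply: continuous_funM; [exact: continuous_fun_cst|exact: continuous_mono22].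
- by move=> u v; have := lap u v; rewrite /comb; lra.
- move=> r x x01; rewrite /comb /mono1 /mono2.
  case: phE => ->; first by rewrite !wave_sin_end//; ring.
  by rewrite !wave_cos_end//; ring.
Qed.

Lemma conj_weight_bound c : 2^-1 < c -> exists2 K, 0 <= K &
  forall eps s ph, 0 < eps -> conj_admissible s ph ->
  int01 (fun x => mono eps 0 c (wave cos s ph 1 x) (wave sin s ph 1 x)) <=
  K * int01 (fun x => mono eps c 0 (wave cos s ph 1 x) (wave sin s ph 1 x)).
Proof.
move=> c0; have [c1|/ltW c1] := leP c 1.
  have c21 : 0 < 2 * c - 1 by lra.
  (* The ratio of the constants in [laplacian_W_le] and [laplacian_X_ge]. *)
  pose C := 2 * (1 + c) / (2 * c - 1).
  have C1 : 1 <= C by rewrite ler_pdivlMr//; lra.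
  exists C; first by lra.
  move=> eps s ph e0 sp.
  apply: (conj_weight_le e0 C1 _ _ sp); first by rewrite addr0.
  move=> u v; apply: (le_trans (laplacian_W_le e0 u v _)); first by lra.
  apply: le_trans (ler_wpM2l _ (laplacian_X_ge e0 u v _)); [|lra|by rewrite c0].
  rewrite [leRHS]mulrA ler_wpM2r//.
    by rewrite divr_ge0 ?powR_ge0// addr_ge0 ?(ltW e0)// addr_ge0 ?sqr_ge0.
  by rewrite /C le_eqVlt; apply/orP; left; apply/eqP; field; rewrite gt_eqF.
(* The ratio of the constants in [laplacian_W_le] and [laplacian_XW_ge]. *)
have [C CE] : exists C, C = 2 * c * (1 + c) by eexists.
have C1 : 1 <= C by rewrite CE; nra.
have C0 : 0 <= C by lra.
exists (2 * (C * (2 * C) `^ (c - 1))).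
  by rewrite mulr_ge0// mulr_ge0// powR_ge0.
move=> eps s ph e0 sp.
have h : int01 (fun x => mono eps 0 c (wave cos s ph 1 x) (wave sin s ph 1 x)) <=
  C * int01 (fun x => mono eps 1 (c - 1) (wave cos s ph 1 x) (wave sin s ph 1 x)).
  apply: (conj_weight_le e0 C1 _ _ sp); first by rewrite addrC subrK.
  move=> u v; apply: (le_trans (laplacian_W_le e0 u v _)); first by lra.
  apply: le_trans (ler_wpM2l _ (laplacian_XW_ge e0 u v _)); [|lra|lra].
  rewrite [leRHS]mulrA ler_wpM2r//.
    by rewrite divr_ge0 ?powR_ge0// addr_ge0 ?(ltW e0)// addr_ge0 ?sqr_ge0.
  by rewrite CE; lra.
have cm a' b' : continuous
    (fun x => mono eps a' b' (wave cos s ph 1 x) (wave sin s ph 1 x)).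
  apply: continuous_mono => //; apply: continuous_wave1.
    exact: continuous_cos.
  exact: continuous_sin.
have cCm C' a' b' : continuous
    (fun x => C' * mono eps a' b' (wave cos s ph 1 x) (wave sin s ph 1 x)).
  by apply: continuous_funM => //; exact: continuous_fun_cst.
(* Absorption: where W >= 2 C X, [C] times the mixed weight is at most W^c / 2, which moves to the
   left-hand side; elsewhere W < 2 C X bounds it by a multiple of X^c. *)
suff : C * int01 (fun x => mono eps 1 (c - 1) (wave cos s ph 1 x) (wave sin s ph 1 x)) <=
   2^-1 * int01 (fun x => mono eps 0 c (wave cos s ph 1 x) (wave sin s ph 1 x)) +
   C * (2 * C) `^ (c - 1) *
   int01 (fun x => mono eps c 0 (wave cos s ph 1 x) (wave sin s ph 1 x)).
  by move: h; move: (int01 _) (int01 _) (int01 _) => i j k; lra.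
rewrite -!int01Z// -int01D//; apply: int01_le => //.
  exact: continuous_funD.
move=> x _; rewrite /mono !powRr0 mul1r mulr1.
set u := wave cos _ _ _ _; set v := wave sin _ _ _ _.
have X0 : 0 < u ^+ 2 + eps by rewrite ltr_wpDl// sqr_ge0.
have W0 : 0 < u ^+ 2 + v ^+ 2 + eps by rewrite ltr_wpDl// addr_ge0// sqr_ge0.
move: X0 W0; move: (u ^+ 2 + eps) (u ^+ 2 + v ^+ 2 + eps) => X W X0 W0.
rewrite powRr1 ?(ltW X0)//.
have WE : W `^ c = W * W `^ (c - 1) by rewrite mulr_powRB1 ?(ltW W0)//; lra.
have XE : X `^ c = X * X `^ (c - 1) by rewrite mulr_powRB1 ?(ltW X0)//; lra.
have [XW|WX] := leP (2 * C * X) W.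
  have : C * (X * W `^ (c - 1)) <= 2^-1 * W `^ c.
    by rewrite WE !mulrA ler_wpM2r ?powR_ge0//; lra.
  have : 0 <= C * (2 * C) `^ (c - 1) * X `^ c.
    by rewrite mulr_ge0 ?powR_ge0// mulr_ge0 ?powR_ge0.
  lra.
have h2 : W `^ (c - 1) <= (2 * C) `^ (c - 1) * X `^ (c - 1).
  rewrite -powRM ?(ltW X0)//; last lra.
  have CX : 0 <= 2 * C * X by rewrite (le_trans _ (ltW WX))// ltW.
  by apply: ge0_ler_powR; rewrite ?nnegrE ?subr_ge0 ?(ltW W0) ?(ltW WX).
have : C * (X * W `^ (c - 1)) <= C * (2 * C) `^ (c - 1) * X `^ c.
  rewrite XE; apply: (@le_trans _ _ (C * (X * ((2 * C) `^ (c - 1) * X `^ (c - 1))))).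
    by apply: ler_wpM2l => //; apply: ler_wpM2l => //; exact: ltW.
  by rewrite le_eqVlt; apply/orP; left; apply/eqP; ring.
have : 0 <= 2^-1 * W `^ c by rewrite mulr_ge0 ?powR_ge0.
lra.
Qed.

Lemma conjugate_le (p : R) : 1 < p -> exists2 K, 0 <= K &
  forall s ph, conj_admissible s ph ->
  int01 (fun x => `|wave sin s ph 1 x| `^ p) <=
  K * int01 (fun x => `|wave cos s ph 1 x| `^ p).
Proof.
move=> p1; pose c := p / 2.
have c0 : 0 < c by rewrite /c; lra.
have [|K K0 hK] := @conj_weight_bound c; first by rewrite /c; lra.
exists (K * 2 `^ c); first by rewrite mulr_ge0 ?powR_ge0.
move=> s ph sp.
have normE (y : R) : `|y| `^ p = (y ^+ 2) `^ c.
  by rewrite -real_normK ?num_real// -powR_mulrn// -powRrM; congr (_ `^ _); rewrite /c; field.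
have cc := @continuous_wave1 cos s ph 1 (@continuous_cos R).
have cs := @continuous_wave1 sin s ph 1 (@continuous_sin R).
have cm eps a' b' : 0 < eps -> continuous
    (fun x => mono eps a' b' (wave cos s ph 1 x) (wave sin s ph 1 x)).
  by move=> e0; apply: continuous_mono.
have cnp (f : R -> R) : continuous f -> continuous (fun x => `|f x| `^ p).
  by move=> cf; apply: continuous_ge0_powR => //; [lra|exact: continuous_fun_norm].
apply: (@ler_addgt0M _ _ _ (K * 2 `^ c)); first by rewrite mulr_ge0 ?powR_ge0.
(* With this choice eps^c is exactly [d], so letting [d] tend to 0 removes the regularization. *)
move=> d d0; pose eps := d `^ c^-1.
have e0 : 0 < eps by rewrite powR_gt0.
have ec : eps `^ c = d by rewrite -powRrM mulVf ?gt_eqF// powRr1// ltW.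
apply: (@le_trans _ _ (int01 (fun x => mono eps 0 c (wave cos s ph 1 x) (wave sin s ph 1 x)))).
  apply: int01_le; [exact: cnp|exact: cm|].
  move=> x _; rewrite normE /mono powRr0 mul1r.
  rewrite ge0_ler_powR ?nnegrE ?sqr_ge0 ?(ltW c0)//.
    by rewrite addr_ge0 ?(ltW e0)// addr_ge0 ?sqr_ge0.
  by have := sqr_ge0 (wave cos s ph 1 x); lra.
apply: (le_trans (hK eps s ph e0 sp)); rewrite -mulrDr -!mulrA ler_wpM2l//.
rewrite -(int01_cst d) -int01D; [|exact: cnp|exact: continuous_fun_cst].
rewrite -int01Z; last first.
  by apply: continuous_funD; [exact: cnp|exact: continuous_fun_cst].
apply: int01_le; first exact: cm.
  apply: continuous_funM; first exact: continuous_fun_cst.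
  by apply: continuous_funD; [exact: cnp|exact: continuous_fun_cst].
move=> x _; rewrite /mono powRr0 mulr1 normE -ec.
set y := wave cos s ph 1 x ^+ 2; have y0 : 0 <= y by exact: sqr_ge0.
have [ye|ey] := leP y eps.
  apply: (@le_trans _ _ ((2 * eps) `^ c)).
    by rewrite ge0_ler_powR ?nnegrE ?(ltW c0)//; lra.
  by rewrite powRM ?(ltW e0)// ler_wpM2l ?powR_ge0// lerDr powR_ge0.
apply: (@le_trans _ _ ((2 * y) `^ c)).
  by rewrite ge0_ler_powR ?nnegrE ?(ltW c0)//; lra.
by rewrite powRM// ler_wpM2l ?powR_ge0// lerDl powR_ge0.
Qed.

End ConjugateFunction.

(** * Truncation of cosine polynomials by modulation and conjugation *)

Section HalfPartialSums.
Context {R : realType}.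
Implicit Types (b : nat -> R) (x p : R).

Definition cosn (n : nat) x : R := cos (n%:R * pi * x).

Lemma continuous_cosn n : continuous (cosn n).
Proof.
apply: continuous_fun_comp; first exact: continuous_cos.
by apply: continuous_funM; [exact: continuous_fun_cst|move=> x; exact: cvg_id].
Qed.

Definition cos_poly b N x : R := \sum_(0 <= n < N) b n * cosn n x.

Lemma continuous_cos_poly b N : continuous (cos_poly b N).
Proof.
apply: continuous_fun_sum => n.
by apply: continuous_funM; [exact: continuous_fun_cst|exact: continuous_cosn].
Qed.

Lemma continuous_norm_powR p (f : R -> R) : 0 < p -> continuous f ->
  continuous (fun x => `|f x| `^ p).
Proof.
by move=> p0 cf; apply: continuous_ge0_powR => //; exact: continuous_fun_norm.
Qed.

Lemma norm_powRD_le p (y z : R) : 0 <= p ->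
  `|y + z| `^ p <= 2 `^ p * (`|y| `^ p + `|z| `^ p).
Proof.
move=> p0; have [yz|zy] := leP `|y| `|z|.
  apply: (@le_trans _ _ ((2 * `|z|) `^ p)).
    apply: ge0_ler_powR; rewrite ?nnegrE ?mulr_ge0//.
    by rewrite (le_trans (ler_normD _ _))//; lra.
  by rewrite powRM// ler_wpM2l ?powR_ge0// lerDr powR_ge0.
apply: (@le_trans _ _ ((2 * `|y|) `^ p)).
  apply: ge0_ler_powR; rewrite ?nnegrE ?mulr_ge0//.
  by rewrite (le_trans (ler_normD _ _))//; lra.
by rewrite powRM// ler_wpM2l ?powR_ge0// lerDl powR_ge0.
Qed.

Lemma norm_powRM_le1 p (y z : R) : 0 <= p -> `|z| <= 1 ->
  `|y * z| `^ p <= `|y| `^ p.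
Proof.
move=> p0 z1; apply: ge0_ler_powR; rewrite ?nnegrE// normrM.
by rewrite ler_piMr.
Qed.

(* [freqs_cos] and [freqs_sin] list the frequencies of the products of a cosine
   polynomial with [cos(N pi x)] and [sin(N pi x)]; combining the conjugates of
   these products cuts the polynomial at frequency [N]. *)
Let sgd (N k : nat) : R := if (k < N)%N then 1 else if (N < k)%N then -1 else 0.
Let dst (N k : nat) : nat := ((N - k) + (k - N))%N.
Let freqs_cos b N M : seq (R * nat) :=
  [seq (b k / 2, (N + k)%N) | k <- index_iota 0 M] ++
  [seq (b k / 2, dst N k) | k <- index_iota 0 M].
Let freqs_sin b N M : seq (R * nat) :=
  [seq (b k / 2, (N + k)%N) | k <- index_iota 0 M] ++
  [seq (sgd N k * b k / 2, dst N k) | k <- index_iota 0 M].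

Let dstE (N k : nat) : (dst N k)%:R = sgd N k * (N%:R - k%:R) :> R.
Proof.
rewrite /dst /sgd; case: ltngtP => h.
- by rewrite (eqP (ltnW h)) addn0 natrB ?mul1r// ltnW.
- by rewrite (eqP (ltnW h)) add0n natrB 1?ltnW// mulN1r opprB.
- by rewrite h subnn mul0r.
Qed.

Let wave_freqs_cos b N M x :
  wave cos (freqs_cos b N M) 0 1 x = cos_poly b M x * cosn N x.
Proof.
rewrite /wave /freqs_cos big_cat/= !big_map -big_split/= /cos_poly mulr_suml.
apply: eq_bigr => k _; rewrite /cosn !expr1n !mulr1 !subr0 dstE natrD.
have -> : cos (sgd N k * (N%:R - k%:R) * pi * x) = cos ((N%:R - k%:R) * pi * x).
  have : k = N -> (N%:R - k%:R) * (pi * x) = 0 by move=> ->; rewrite subrr mul0r.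
  rewrite -!mulrA; move: ((N%:R - k%:R) * (pi * x)) => y y0; rewrite /sgd; case: ltngtP => h; rewrite ?mul1r ?mulN1r ?cosN//.
  by rewrite y0// mulr0.
by rewrite !mulrDl mulNr mulNr cosD cosB; field.
Qed.

Let wave_freqs_sin b N M x :
  wave cos (freqs_sin b N M) (pi / 2) 1 x =
  cos_poly b M x * sin (N%:R * pi * x).
Proof.
rewrite /wave /freqs_sin big_cat/= !big_map -big_split/= /cos_poly mulr_suml.
apply: eq_bigr => k _; rewrite /cosn !expr1n !mulr1 !cosBpihalf dstE natrD.
have -> : sgd N k * b k / 2 * sin (sgd N k * (N%:R - k%:R) * pi * x) =
    b k / 2 * sin ((N%:R - k%:R) * pi * x).
  have : k = N -> (N%:R - k%:R) * (pi * x) = 0 by move=> ->; rewrite subrr mul0r.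
  rewrite -!mulrA; move: ((N%:R - k%:R) * (pi * x)) => y y0; rewrite /sgd; case: ltngtP => h.
  - by rewrite !mul1r.
  - by rewrite !mulN1r sinN !mulrN !opprK.
  - by rewrite y0// mulr0 sin0 !mulr0.
by rewrite !mulrDl mulNr mulNr sinD sinB; field.
Qed.

(** With theta = pi x, multiplying the two conjugates back by sin(N theta) and cos(N theta) gives
    b_k cos(k theta) the weight (1 + sgd N k) / 2: 1 below [N], 1 / 2 at [N] and 0 above. *)
Let half_sumE b N M x : (N < M)%N ->
  cos_poly b N x + b N / 2 * cosn N x =
  sin (N%:R * pi * x) * wave sin (freqs_cos b N M) 0 1 x -
  cosn N x * wave sin (freqs_sin b N M) (pi / 2) 1 x.
Proof.
move=> NM; rewrite /wave /freqs_cos /freqs_sin !big_cat/= !big_map -!big_split/=.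
rewrite 2!mulr_sumr -sumrB.
transitivity (\sum_(0 <= k < M) (1 + sgd N k) / 2 * (b k * cosn k x)).
  rewrite (@big_cat_nat _ _ _ N 0 M)//=; last exact: ltnW.
  rewrite [X in _ = _ + X]big_ltn//; congr (_ + _).
    apply: eq_big_nat => k /andP[_ kN]; rewrite /sgd kN.
    by rewrite (_ : (1 + 1) / 2 = 1) ?mul1r//; field.
  rewrite [X in _ = _ + X]big_nat_cond [X in _ = _ + X]big1 ?addr0.
    by rewrite /sgd ltnn addr0; field.
  move=> k /andP[/andP[Nk _] _]; rewrite /sgd Nk ltnNge (ltnW Nk)/=.
  by rewrite subrr !mul0r.
apply: eq_bigr => k _; rewrite /cosn !expr1n !mulr1 !subr0 !sinBpihalf dstE natrD.
have e1 : cos (k%:R * pi * x) =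
    cos (N%:R * pi * x) * cos ((N%:R + k%:R) * pi * x) +
    sin (N%:R * pi * x) * sin ((N%:R + k%:R) * pi * x).
  by rewrite -cosB -cosN; congr cos; ring.
have e2 : sgd N k * cos (k%:R * pi * x) =
    sgd N k * (cos (N%:R * pi * x) *
    cos (sgd N k * (N%:R - k%:R) * pi * x)) +
    sin (N%:R * pi * x) * sin (sgd N k * (N%:R - k%:R) * pi * x).
  rewrite /sgd; case: ltngtP => h.
  - by rewrite !mul1r -cosB; congr cos; ring.
  - have -> : -1 * (N%:R - k%:R) * pi * x = (k%:R - N%:R) * pi * x by ring.
    have -> : cos (k%:R * pi * x) = cos (N%:R * pi * x + (k%:R - N%:R) * pi * x).
      by congr cos; ring.
    by rewrite cosD; ring.
  - by rewrite !mul0r sin0 mulr0 addr0.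
transitivity (b k / 2 * (cos (k%:R * pi * x) + sgd N k * cos (k%:R * pi * x))).
  by ring.
by rewrite e2 e1; ring.
Qed.

Lemma half_partial_sum_le p : 1 < p -> exists2 K, 0 <= K &
  forall b N M, (0 < N < M)%N ->
  int01 (fun x => `|cos_poly b N x + b N / 2 * cosn N x| `^ p) <=
  K * int01 (fun x => `|cos_poly b M x| `^ p).
Proof.
move=> p1; have p0 : 0 < p by lra.
have [K K0 hK] := conjugate_le p1.
exists (2 `^ p * (K + K)); first by rewrite mulr_ge0 ?powR_ge0// addr_ge0.
move=> b N M /andP[N0 NM].
have ad1 : conj_admissible (freqs_cos b N M) 0.
  split; first by left.
  move=> x; apply: big1_seq => -[w [|n]] _ /=; last by rewrite exprS mul0r mulr0 mul0r.
  by rewrite !mul0r subr0 sin0 mulr0.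
(* At r = 0 only frequency 0 survives. It occurs for k = N alone, where the weight contains
   [sgd N N = 0]; N > 0 keeps the frequencies N + k positive. *)
have ad2 : conj_admissible (freqs_sin b N M) (pi / 2).
  split; first by right.
  move=> x; rewrite /wave /freqs_sin big_cat !big_map/=.
  rewrite !big1 ?addr0// => k _.
    case: (ltngtP N k) => h; rewrite /dst /sgd.
    - by rewrite (eqP (ltnW h)) -(subnSK h) exprS mul0r mulr0 mul0r.
    - by rewrite (eqP (ltnW h)) -(subnSK h) exprS mul0r mulr0 mul0r.
    - by rewrite h ltnn !mul0r.
  by rewrite -(prednK N0) addSn exprS mul0r mulr0 mul0r.
have cw1 := continuous_norm_powR p0
  (@continuous_wave1 R sin (freqs_cos b N M) 0 1 (@continuous_sin R)).
have cw2 := continuous_norm_powR p0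
  (@continuous_wave1 R sin (freqs_sin b N M) (pi / 2) 1 (@continuous_sin R)).
have cc1 := continuous_norm_powR p0
  (@continuous_wave1 R cos (freqs_cos b N M) 0 1 (@continuous_cos R)).
have cc2 := continuous_norm_powR p0
  (@continuous_wave1 R cos (freqs_sin b N M) (pi / 2) 1 (@continuous_cos R)).
have cf := continuous_norm_powR p0 (@continuous_cos_poly b M).
apply: (@le_trans _ _ (2 `^ p * (
    int01 (fun x => `|wave sin (freqs_cos b N M) 0 1 x| `^ p) +
    int01 (fun x => `|wave sin (freqs_sin b N M) (pi / 2) 1 x| `^ p)))).
  rewrite -int01D// -int01Z; last exact: continuous_funD.
  apply: int01_le.
  - apply: continuous_norm_powR => //; apply: continuous_funD.
      exact: continuous_cos_poly.
    by apply: continuous_funM; [exact: continuous_fun_cst|exact: continuous_cosn].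
  - by apply: continuous_funM; [exact: continuous_fun_cst|exact: continuous_funD].
  - move=> x _; rewrite (half_sumE _ _ NM).
    apply: (le_trans (norm_powRD_le _ _ (ltW p0))).
    rewrite ler_wpM2l ?powR_ge0// lerD//.
      by rewrite mulrC norm_powRM_le1 ?(ltW p0)// sin_max.
    by rewrite normrN mulrC norm_powRM_le1 ?(ltW p0)// cos_max.
rewrite -[leRHS]mulrA; apply: ler_wpM2l; first exact: powR_ge0.
rewrite [leRHS]mulrDl; apply: lerD.
  apply: (le_trans (hK _ _ ad1)); rewrite ler_wpM2l//; apply: int01_le => //.
  by move=> x _; rewrite wave_freqs_cos norm_powRM_le1 ?(ltW p0)// cos_max.
apply: (le_trans (hK _ _ ad2)); rewrite ler_wpM2l//; apply: int01_le => //.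
by move=> x _; rewrite wave_freqs_sin norm_powRM_le1 ?(ltW p0)// sin_max.
Qed.

End HalfPartialSums.

(** * Cosine series in L_s(0, 1) *)

Section LNorm.
Context d (T : measurableType d) (R : realType).
Variables (mu : {measure set T -> \bar R}) (s : R).
Hypothesis s1 : 1 <= s.
Implicit Types f g h : T -> R.

Let s1E : (1 <= s%:E)%E. Proof. by rewrite lee_fin. Qed.
Let s0 : 0 < s. Proof. exact: lt_le_trans s1. Qed.

Definition nrm f := fine ('N[mu]_(s%:E)[EFin \o f])%E.

Lemma nrmE f : nrm f = (\int[mu]_x (`|f x| `^ s)) `^ s^-1.
Proof. by rewrite /nrm unlock fine_poweR. Qed.

Lemma eq_nrm f g : f =1 g -> nrm f = nrm g.
Proof. by move=> /funext ->. Qed.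

Lemma nrm_fin f : f \in Lfun mu s%:E ->
  (nrm f)%:E = ('N[mu]_(s%:E)[EFin \o f])%E.
Proof. by move=> Lf; rewrite -(Lfun_valP s1E Lf); exact: finite_norm_fine. Qed.

Lemma nrm_ge0 f : 0 <= nrm f.
Proof. by rewrite nrmE powR_ge0. Qed.

Lemma LfunD f g : f \in Lfun mu s%:E -> g \in Lfun mu s%:E ->
  (fun x => f x + g x) \in Lfun mu s%:E.
Proof.
move=> Lf Lg; have [_ h] := Lfun_submod_closed mu s1E.
by have := h 1 f g Lf Lg; rewrite scale1r.
Qed.

Lemma LfunZ a f : f \in Lfun mu s%:E -> (fun x => a * f x) \in Lfun mu s%:E.
Proof.
move=> Lf; have [h0 h] := Lfun_submod_closed mu s1E.
by have := h a f 0 Lf h0; rewrite addr0.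
Qed.

Lemma LfunB f g : f \in Lfun mu s%:E -> g \in Lfun mu s%:E ->
  (fun x => f x - g x) \in Lfun mu s%:E.
Proof.
move=> Lf Lg; have := LfunD Lf (LfunZ (-1) Lg).
by rewrite (_ : (fun _ => _) = (fun x => f x - g x))//; apply/funext => x; rewrite mulN1r.
Qed.

Lemma nrmD f g : f \in Lfun mu s%:E -> g \in Lfun mu s%:E ->
  nrm (fun x => f x + g x) <= nrm f + nrm g.
Proof.
move=> Lf Lg; have := ler_LnormD (Lfun_Sub s1E Lf) (Lfun_Sub s1E Lg).
by rewrite !Lfun_valP.
Qed.

Lemma nrmZ a f : f \in Lfun mu s%:E -> nrm (fun x => a * f x) = `|a| * nrm f.
Proof.
move=> Lf; have := LnormZ (Lfun_Sub s1E Lf) a; rewrite Lfun_valP => h.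
by apply: EFin_inj; rewrite EFinM !nrm_fin//; exact: LfunZ.
Qed.

Lemma Lfun_measurable f : f \in Lfun mu s%:E -> measurable_fun setT f.
Proof. by rewrite inE => /andP[/[!inE]]. Qed.

Lemma measurable_norm_powR f : measurable_fun setT f ->
  measurable_fun setT (fun x => `|f x| `^ s).
Proof.
move=> mf; apply: (measurableT_comp (measurable_powR s)).
exact: measurableT_comp.
Qed.

Lemma Lfun_le f g : measurable_fun setT f -> g \in Lfun mu s%:E ->
  (forall x, `|f x| <= `|g x|) -> f \in Lfun mu s%:E.
Proof.
move=> mf Lg fg; have ig := Lfun_integrable s1 Lg.
rewrite inE; apply/andP; split; rewrite inE//=.
rewrite /finite_norm unlock poweR_lty//.
apply: le_lt_trans (integrable_lty measurableT ig).
apply: ge0_le_integral => //.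
- by move=> x _; rewrite poweR_ge0.
- apply/measurable_EFinP; exact: measurable_norm_powR.
- by apply/measurable_EFinP/measurable_norm_powR/Lfun_measurable.
- move=> x _ /=; rewrite lee_fin.
  by apply: ge0_ler_powR; rewrite ?nnegrE// ltW.
Qed.

(** Dominated convergence for the s-th powers, with |g|^s as integrable bound. *)
Lemma nrm_dominated (f_ : nat -> T -> R) g :
  (forall n, measurable_fun setT (f_ n)) -> g \in Lfun mu s%:E ->
  (forall n x, `|f_ n x| <= `|g x|) ->
  {ae mu, forall x, f_ n x @[n --> \oo] --> 0} ->
  forall e, 0 < e -> exists n, nrm (f_ n) < e.
Proof.
move=> mf Lg fg f0 e e0.
have [] := @dominated_convergence _ _ _ mu setT measurableT
  (fun n x => (`|f_ n x| `^ s)%:E) (cst 0%E) (fun x => (`|g x| `^ s)%:E).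
- by move=> n; apply/measurable_EFinP; exact: measurable_norm_powR.
- exact: measurable_cst.
- apply: filterS f0 => x f0 _; apply: cvg_EFin; first exact: nearW.
  have : (fun n => `|f_ n x| `^ s) @ \oo --> (0 : R).
    have c0 : continuous (fun y : R => `|y| `^ s).
      apply: continuous_ge0_powR => //.
      by apply: continuous_fun_norm => y; exact: cvg_id.
    have := cvg_comp _ _ f0 (c0 0).
    by rewrite normr0 powR0// gt_eqF.
  by [].
- exact: Lfun_integrable.
- apply: nearW => x n _; rewrite /= lee_fin ger0_norm ?powR_ge0//.
  by apply: ge0_ler_powR; rewrite ?nnegrE// ltW.
move=> _ _; rewrite integral0 => /fine_cvgP[_].
have es : 0 < e `^ s by rewrite powR_gt0.
move=> /cvgrPdist_lt/(_ _ es)[n _ /(_ n (leqnn n))] h; exists n.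
move: h; rewrite sub0r normrN /= => h.
have I0 : 0 <= \int[mu]_x (`|f_ n x| `^ s).
  by apply: Rintegral_ge0 => x _; rewrite powR_ge0.
rewrite nrmE -[ltRHS](powRr1 (ltW e0)) -(@mulfV _ s) ?gt_eqF// powRrM.
apply: gt0_ltr_powR; rewrite ?invr_gt0 ?nnegrE ?powR_ge0//.
by apply: le_lt_trans h; rewrite ler_norm.
Qed.

Section Closure.
Variable P : (T -> R) -> Prop.
Hypothesis P_Lfun : forall f, P f -> f \in Lfun mu s%:E.
Hypothesis P_lin : forall a f g, P f -> P g -> P (fun x => f x + a * g x).

Definition L_closure f := f \in Lfun mu s%:E /\
  forall e, 0 < e -> exists2 g, P g & nrm (fun x => f x - g x) < e.

Lemma L_closure_sub f : P f -> L_closure f.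
Proof.
move=> Pf; split=> [|e e0]; first exact: P_Lfun.
exists f => //; rewrite (@eq_nrm _ (fun x => 0 * f x)).
  by rewrite nrmZ ?normr0 ?mul0r// P_Lfun.
by move=> x; rewrite subrr mul0r.
Qed.

Lemma L_closure_lin a f g : L_closure f -> L_closure g ->
  L_closure (fun x => f x + a * g x).
Proof.
move=> [Lf hf] [Lg hg]; split; first by apply: LfunD => //; exact: LfunZ.
move=> e e0; have [|f' Pf' hf'] := hf (e / 2); first by rewrite divr_gt0.
have [|g' Pg' hg'] := hg (e / 2 / (`|a| + 1)).
  by rewrite !divr_gt0// ltr_wpDl.
exists (fun x => f' x + a * g' x); first exact: P_lin.
rewrite (@eq_nrm _ (fun x => (f x - f' x) + a * (g x - g' x))); last first.
  by move=> x; ring.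
have L1 := LfunB Lf (P_Lfun Pf'); have L2 := LfunB Lg (P_Lfun Pg').
apply: (le_lt_trans (nrmD L1 (LfunZ a L2))).
rewrite (nrmZ a L2).
have : `|a| * nrm (fun x => g x - g' x) <= e / 2.
  move: hg'; rewrite ltr_pdivlMr ?ltr_wpDl//.
  have := nrm_ge0 (fun x => g x - g' x); have := normr_ge0 a; nra.
lra.
Qed.

Lemma L_closure_closed f : f \in Lfun mu s%:E ->
  (forall e, 0 < e -> exists2 g, L_closure g & nrm (fun x => f x - g x) < e) ->
  L_closure f.
Proof.
move=> Lf h; split=> // e e0.
have [|g [Lg hg] fg] := h (e / 2); first by rewrite divr_gt0.
have [|g' Pg' hg'] := hg (e / 2); first by rewrite divr_gt0.
exists g' => //.
rewrite (@eq_nrm _ (fun x => (f x - g x) + (g x - g' x))); last first.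
  by move=> x; ring.
apply: (le_lt_trans (nrmD (LfunB Lf Lg) (LfunB Lg (P_Lfun Pg')))); lra.
Qed.

Lemma L_closure_lim (f_ : nat -> T -> R) f g :
  (forall n, L_closure (f_ n)) -> f \in Lfun mu s%:E ->
  g \in Lfun mu s%:E ->
  (forall n x, `|f x - f_ n x| <= `|g x|) ->
  {ae mu, forall x, f_ n x @[n --> \oo] --> f x} -> L_closure f.
Proof.
move=> hf Lf Lg fg cf; apply: L_closure_closed => // e e0.
have [||n hn] := @nrm_dominated (fun n x => f x - f_ n x) g _ Lg fg _ e e0.
- move=> n; apply: measurable_funB; first exact: Lfun_measurable.
  by apply: Lfun_measurable; have [] := hf n.
- apply: filterS cf => x cx; rewrite -(subrr (f x)).
  by apply: cvgB => //; exact: cvg_cst.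
- by exists (f_ n).
Qed.

Lemma L_closure_sum (I : Type) (r : seq I) (c : I -> R) (F : I -> T -> R) :
  P (fun=> 0) -> (forall i, L_closure (F i)) ->
  L_closure (fun x => \sum_(i <- r) c i * F i x).
Proof.
move=> P0 hF; elim: r => [|i r IH].
  by under eq_fun do rewrite big_nil; exact: L_closure_sub.
under eq_fun do rewrite big_cons addrC.
exact: L_closure_lin.
Qed.

End Closure.

End LNorm.

(** * The algebra of cosine polynomials and threshold polynomials *)

Section CosinePolynomials.
Context {R : realType}.
Implicit Types (f g : R -> R).

Definition is_cos_poly f := exists N (b : nat -> R), forall x, f x = cos_poly b N x.

Lemma cos_poly_widen (b : nat -> R) N M : (N <= M)%N ->
  cos_poly b N =1 cos_poly (fun n => if (n < N)%N then b n else 0) M.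
Proof.
move=> NM x; rewrite /cos_poly (@big_nat_widen _ _ _ _ N M)// big_mkcond/=.
by apply: eq_bigr => i _; case: ifP; rewrite ?mul0r.
Qed.

Lemma is_cos_poly_lin a f g : is_cos_poly f -> is_cos_poly g ->
  is_cos_poly (fun x => f x + a * g x).
Proof.
move=> [N [b fE]] [M [c gE]].
exists (maxn N M), (fun n => (if (n < N)%N then b n else 0) +
  a * (if (n < M)%N then c n else 0)) => x.
rewrite fE gE (cos_poly_widen b (leq_maxl N M)) (cos_poly_widen c (leq_maxr N M)).
rewrite /cos_poly mulr_sumr -big_split/=; apply: eq_bigr => i _.
by rewrite mulrA -mulrDl.
Qed.

Lemma is_cos_poly_cosn n : is_cos_poly (cosn n).
Proof.
exists n.+1, (fun m => (m == n)%:R) => x.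
rewrite /cos_poly big_nat_recr//= eqxx mul1r big_nat_cond big1 ?add0r//.
by move=> i /andP[/andP[_ iN] _]; rewrite ltn_eqF ?mul0r.
Qed.

Lemma is_cos_poly_ext f g : f =1 g -> is_cos_poly f -> is_cos_poly g.
Proof. by move=> fg [N [b fE]]; exists N, b => x; rewrite -fg. Qed.

Lemma cosn0 x : cosn 0 x = 1 :> R.
Proof. by rewrite /cosn !mul0r cos0. Qed.

Lemma is_cos_poly0 : is_cos_poly (fun=> 0).
Proof. by exists 0%N, (fun=> 0) => x; rewrite /cos_poly big_geq. Qed.

Lemma is_cos_poly_cst c : is_cos_poly (fun=> c).
Proof.
apply: is_cos_poly_ext (is_cos_poly_lin c is_cos_poly0 (is_cos_poly_cosn 0)).
by move=> x; rewrite cosn0 add0r mulr1.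
Qed.

Lemma is_cos_poly_sum (I : Type) (r : seq I) (c : I -> R) (F : I -> R -> R) :
  (forall i, is_cos_poly (F i)) ->
  is_cos_poly (fun x => \sum_(i <- r) c i * F i x).
Proof.
move=> hF; elim: r => [|i r IH].
  apply: is_cos_poly_ext is_cos_poly0.
  by move=> x; rewrite big_nil.
apply: is_cos_poly_ext (is_cos_poly_lin (c i) IH (hF i)) => x.
by rewrite big_cons addrC.
Qed.

Lemma is_cos_polyM f g : is_cos_poly f -> is_cos_poly g ->
  is_cos_poly (fun x => f x * g x).
Proof.
move=> [N [b fE]] [M [c gE]].
have h : is_cos_poly (fun x => \sum_(0 <= n < N) b n *
    (\sum_(0 <= m < M) c m * (cosn n x * cosn m x))).
  apply: is_cos_poly_sum => n; apply: is_cos_poly_sum => m.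
  pose k := ((n - m) + (m - n))%N.
  have h1 := is_cos_poly_lin 2^-1 is_cos_poly0 (is_cos_poly_cosn (n + m)).
  apply: is_cos_poly_ext (is_cos_poly_lin 2^-1 h1 (is_cos_poly_cosn k)) => x.
  have -> : cosn k x = cos ((n%:R - m%:R) * pi * x) :> R.
    rewrite /cosn /k; have [mn|/ltnW nm] := leqP m n.
      by rewrite (eqP mn) addn0 natrB.
    rewrite (eqP nm) add0n natrB// -cosN; congr cos; ring.
  by rewrite /cosn natrD !mulrDl mulNr mulNr cosD cosB; field.
apply: is_cos_poly_ext h => x; rewrite fE gE /cos_poly mulr_suml.
apply: eq_bigr => n _; rewrite mulr_sumr mulr_sumr; apply: eq_bigr => m _; ring.
Qed.

Lemma is_cos_polyX n f : is_cos_poly f -> is_cos_poly (fun x => f x ^+ n).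
Proof.
move=> hf; elim: n => [|n IH].
  by apply: is_cos_poly_ext (is_cos_poly_cst 1) => x; rewrite expr0.
by apply: is_cos_poly_ext (is_cos_polyM hf IH) => x; rewrite exprS.
Qed.

Lemma is_cos_poly_continuous f : is_cos_poly f -> continuous f.
Proof. by move=> [N [b /funext ->]]; exact: continuous_cos_poly. Qed.

Lemma bernoulli_ineq (z : R) n : -1 <= z -> 1 + n%:R * z <= (1 + z) ^+ n.
Proof.
move=> z1; elim: n => [|n IH]; first by rewrite mul0r addr0 expr0.
rewrite exprS; apply: (@le_trans _ _ ((1 + z) * (1 + n%:R * z))).
  rewrite -natr1; have : 0 <= n%:R :> R by []. nra.
by rewrite ler_wpM2l//; lra.
Qed.

(* The Brosowski-Deutsch polynomials, which separate [0, 1/2[ from ]1/2, 1]. *)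
Lemma threshold_cvg1 (t : R) : 0 <= t < 2^-1 ->
  (fun n => (1 - t ^+ n) ^+ (2 ^ n)) @ \oo --> (1 : R).
Proof.
move=> /andP[t0 t1].
have h : (fun n => 1 - (2 * t) ^+ n) @ \oo --> (1 : R).
  rewrite -[X in _ --> X]subr0; apply: cvgB; first exact: cvg_cst.
  by apply: cvg_expr; rewrite ger0_norm; lra.
apply: (squeeze_cvgr _ h (cvg_cst (1 : R))); apply: nearW => n.
have tn0 : 0 <= t ^+ n by rewrite exprn_ge0.
have tn1 : t ^+ n <= 1 by rewrite exprn_ile1//; lra.
apply/andP; split; last by rewrite exprn_ile1//; lra.
have := @bernoulli_ineq (- t ^+ n) (2 ^ n); rewrite lerN2 => /(_ tn1).
by rewrite natrX mulrN -exprMn.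
Qed.

Lemma threshold_cvg0 (t : R) : 2^-1 < t <= 1 ->
  (fun n => (1 - t ^+ n) ^+ (2 ^ n)) @ \oo --> (0 : R).
Proof.
move=> /andP[t0 t1].
have h : (fun n => ((2 * t)^-1) ^+ n) @ \oo --> (0 : R).
  apply: cvg_expr; rewrite ger0_norm ?invr_ge0; last by rewrite mulr_ge0//; lra.
  by rewrite invf_lt1; lra.
apply: (squeeze_cvgr _ (cvg_cst (0 : R)) h); apply: nearW => n.
have tn0 : 0 < t ^+ n by rewrite exprn_gt0//; lra.
have tn1 : t ^+ n <= 1 by rewrite exprn_ile1//; lra.
apply/andP; split; first by rewrite exprn_ge0//; lra.
rewrite exprVn -[leRHS]mul1r ler_pdivlMr; last by rewrite exprn_gt0//; lra.
rewrite exprMn -natrX.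
(* Replacing 1 - t^n by 1 / (1 + t^n) lets Bernoulli's inequality put (2 t)^n in the denominator. *)
have h1 : (1 - t ^+ n) ^+ (2 ^ n) * (1 + t ^+ n) ^+ (2 ^ n) <= 1.
  rewrite -exprMn exprn_ile1//; last by nra.
  by rewrite mulr_ge0//; lra.
apply: le_trans h1; rewrite ler_wpM2l ?exprn_ge0//; first lra.
apply: le_trans (@bernoulli_ineq (t ^+ n) (2 ^ n) _); lra.
Qed.

End CosinePolynomials.

Import HBSimple HBNNSimple.

(** * Density of cosine polynomials in L_s(0, 1) *)

Section Lebesgue01.
Context {R : realType}.
Notation mu := (lebesgue01 R).
Implicit Types (f g h : R -> R).

Lemma lebesgue01E A : mu A = lebesgue_measure (A `&` `]0, 1[%classic).
Proof. by []. Qed.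

Lemma lebesgue01T : mu setT = 1%E.
Proof.
by rewrite lebesgue01E setTI lebesgue_measure_itv/= lte_fin ltr01 oppr0 adde0.
Qed.

(** The excluded point is the jump in [closure_ray], where the approximants need not converge to the
    indicator. *)
Lemma ae_lebesgue01 (c : R) (Q : R -> Prop) :
  (forall x, 0 < x < 1 -> x != c -> Q x) -> {ae mu, forall x, Q x}.
Proof.
move=> hQ; exists (~` `]0, 1[%classic `|` [set c]); split.
- by apply: measurableU => //; exact: measurableC.
- rewrite lebesgue01E setIUl setICl set0U.
  apply/eqP; rewrite eq_le measure_ge0 andbT.
  rewrite -(@lebesgue_measure_set1 R c); apply: le_measure; rewrite ?inE//=.
  by apply: measurableI => //; exact: measurable_itv.
- move=> x /= nQ; have [->|xc] := eqVneq x c; [by right|left].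
  by move=> /=; rewrite in_itv/= => x01; apply: nQ; exact: hQ.
Qed.

Let ge0_integral_lebesgue01 (f : R -> \bar R) : measurable_fun setT f ->
  (forall x, (0 <= f x)%E) ->
  (\int[mu]_x f x = \int[lebesgue_measure]_(x in `[0%R, 1%R]) f x)%E.
Proof.
move=> mf f0.
have mN : measurable (~` `]0, 1[%classic : set (measurableTypeR R)).
  exact: measurableC.
rewrite (@ge0_negligible_integral _ _ _ mu setT (~` `]0, 1[%classic))//.
  rewrite setTD setCK.
  rewrite (@eq_measure_integral _ _ _ _ lebesgue_measure); last first.
    by move=> A mA AD; rewrite lebesgue01E setIidl.
  by rewrite -(@integral_itv_bndoo _ 0 1 f true false)//; exact: measurable_funTS.
by rewrite lebesgue01E setICl measure0.
Qed.

Lemma integral_lebesgue01 (f : R -> \bar R) : measurable_fun setT f ->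
  (\int[mu]_x f x = \int[lebesgue_measure]_(x in `[0%R, 1%R]) f x)%E.
Proof.
move=> mf; rewrite integralE [RHS]integralE; congr (_ - _)%E.
  by apply: ge0_integral_lebesgue01 => //; exact: measurable_funepos.
by apply: ge0_integral_lebesgue01 => //; exact: measurable_funeneg.
Qed.

Lemma Rintegral_lebesgue01 f : continuous f -> \int[mu]_x f x = int01 f.
Proof.
move=> cf; rewrite /int01 /Rintegral integral_lebesgue01//.
by apply/measurable_EFinP; exact: continuous_measurable_fun.
Qed.

Section Exponent.
Variable s : R.
Hypothesis s1 : 1 < s.
Let s1' : 1 <= s. Proof. exact: ltW. Qed.
Let s0 : 0 < s. Proof. exact: lt_trans s1. Qed.

Lemma nrm_continuous f : continuous f ->
  nrm mu s f = (int01 (fun x => `|f x| `^ s)) `^ s^-1.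
Proof.
by move=> cf; rewrite nrmE Rintegral_lebesgue01//; exact: continuous_norm_powR.
Qed.

Lemma continuous_Lfun f : continuous f -> f \in Lfun mu s%:E.
Proof.
move=> cf; rewrite inE; apply/andP; split; rewrite inE/=.
  exact: continuous_measurable_fun.
have cfs := continuous_norm_powR s0 cf.
rewrite /finite_norm unlock poweR_lty//= integral_lebesgue01; last first.
  by apply/measurable_EFinP; exact: continuous_measurable_fun.
by apply: integrable_lty => //; exact: (continuous_integrable_itv 0 1 cfs).
Qed.

Lemma cst_Lfun (c : R) : (fun=> c) \in Lfun mu s%:E.
Proof. by apply: continuous_Lfun; exact: continuous_fun_cst. Qed.

Lemma bounded_Lfun f (c : R) : measurable_fun setT f -> (forall x, `|f x| <= c) ->
  f \in Lfun mu s%:E.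
Proof.
move=> mf fc; apply: (@Lfun_le _ _ R mu s s1' f (fun=> c) mf (cst_Lfun c)) => x.
by rewrite (le_trans (fc x))// ler_norm.
Qed.

Lemma is_cos_poly_Lfun f : is_cos_poly f -> f \in Lfun mu s%:E.
Proof. by move=> /is_cos_poly_continuous; exact: continuous_Lfun. Qed.

Let P_lin a f g : is_cos_poly f -> is_cos_poly g ->
  is_cos_poly (fun x : R => f x + a * g x).
Proof. exact: is_cos_poly_lin. Qed.

Notation closure := (L_closure mu s is_cos_poly).

Let closure_cst (c : R) : closure (fun=> c).
Proof.
by apply: L_closure_sub => //; [exact: is_cos_poly_Lfun|exact: is_cos_poly_cst].
Qed.

Let indic_Lfun (A : set R) : measurable A -> (\1_A : R -> R) \in Lfun mu s%:E.
Proof.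
move=> mA; apply: (@bounded_Lfun _ 1); first exact: measurable_indic.
by move=> x; rewrite indicE; case: (_ \in _); rewrite ?normr1 ?normr0.
Qed.

Let indic_le1 (A : set R) x : `|\1_A x : R| <= 1.
Proof. by rewrite indicE; case: (_ \in _); rewrite ?normr1 ?normr0. Qed.

(** For 0 < c < 1, threshold polynomials are applied to a cosine polynomial [t] with values in
    [0, 1] that crosses 1/2 exactly at [c], since cos decreases on [0, pi]. Otherwise the indicator
    is constant almost everywhere on the interval. *)
Let closure_ray (c : R) : closure (\1_(`]-oo, c[%classic) : R -> R).
Proof.
have mI : measurable (`]-oo, c[%classic : set R) by exact: measurable_itv.
have iE (x : R) : \1_(`]-oo, c[%classic) x = (x < c)%R%:R :> R.
  by rewrite indicE; congr (nat_of_bool _)%:R; apply/idP/idP; rewrite inE/= in_itv.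
pose t (x : R) : R := 2^-1 + 4^-1 * (cos (c * pi) - cos (x * pi)).
have t01 x : 0 <= t x <= 1.
  have := cos_max (c * pi); have := cos_max (x * pi).
  rewrite !ler_norml /t; lra.
have q01 n x : 0 <= (1 - t x ^+ n) ^+ (2 ^ n) <= 1.
  have /andP[t0 t1] := t01 x.
  have tn0 : 0 <= t x ^+ n by rewrite exprn_ge0.
  have tn1 : t x ^+ n <= 1 by rewrite exprn_ile1.
  by rewrite exprn_ge0 ?exprn_ile1//; lra.
have tP : is_cos_poly t.
  apply: is_cos_poly_ext (is_cos_poly_lin (- 4^-1)
    (is_cos_poly_cst (2^-1 + 4^-1 * cos (c * pi))) (is_cos_poly_cosn 1)).
  by move=> x; rewrite /t /cosn mul1r (mulrC pi); ring.
have qP n : is_cos_poly (fun x => (1 - t x ^+ n) ^+ (2 ^ n)).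
  apply: is_cos_polyX; apply: is_cos_poly_ext
    (is_cos_poly_lin (-1) (is_cos_poly_cst 1) (is_cos_polyX n tP)) => x.
  by rewrite mulN1r.
have [c0|c0] := leP c 0.
  apply: (@L_closure_lim _ _ _ mu s s1' _ is_cos_poly_Lfun (fun _ _ => 0) _ (fun=> 1)).
  - by move=> _; exact: closure_cst.
  - exact: indic_Lfun.
  - exact: cst_Lfun.
  - by move=> _ x; rewrite subr0 normr1.
  - apply: (@ae_lebesgue01 0) => x /andP[x0 _] _.
    by rewrite iE ltNge (le_trans c0 (ltW x0))/=; exact: cvg_cst.
have [c1|c1] := leP 1 c.
  apply: (@L_closure_lim _ _ _ mu s s1' _ is_cos_poly_Lfun (fun _ _ => 1) _ (fun=> 1)).
  - by move=> _; exact: closure_cst.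
  - exact: indic_Lfun.
  - exact: cst_Lfun.
  - move=> _ x; rewrite iE normr1; case: (x < c); last by rewrite sub0r normrN1.
    by rewrite subrr normr0.
  - apply: (@ae_lebesgue01 0) => x /andP[_ x1] _.
    by rewrite iE (lt_le_trans x1 c1)/=; exact: cvg_cst.
apply: (@L_closure_lim _ _ _ mu s s1' _ is_cos_poly_Lfun
  (fun n x => (1 - t x ^+ n) ^+ (2 ^ n)) _ (fun=> 1)).
- by move=> n; apply: L_closure_sub => //; exact: is_cos_poly_Lfun.
- exact: indic_Lfun.
- exact: cst_Lfun.
- move=> n x; have /andP[q0 q1] := q01 n x.
  by rewrite iE normr1 ler_norml; case: (x < c) => /=; apply/andP; split; lra.
- apply: (@ae_lebesgue01 c) => x /andP[x0 x1] xc; rewrite iE.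
  have pi0 := @pi_gt0 R.
  have xI : x * pi \in `[0, pi].
    by rewrite in_itv/= mulr_ge0 ?(ltW x0) ?(ltW pi0)//= ler_piMl// ltW.
  have cI : c * pi \in `[0, pi].
    by rewrite in_itv/= mulr_ge0 ?(ltW c0) ?(ltW pi0)//= ler_piMl// ltW.
  have hc := ltr_cos xI cI; rewrite ltr_pM2r// in hc.
  have [xltc|cltx] := ltP x c.
    apply: threshold_cvg1; have /andP[-> _] := t01 x.
    by move: hc; rewrite xltc /t /=; lra.
  apply: threshold_cvg0; have /andP[_ ->] := t01 x; rewrite andbT.
  have cx : c < x by rewrite lt_neqAle eq_sym xc.
  by have := ltr_cos cI xI; rewrite ltr_pM2r// cx /t; lra.
Qed.

(** Dynkin's argument: by linearity and dominated convergence the sets whose indicator lies in the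
    closure form a lambda-system, and the rays are stable under intersection and generate the Borel
    sets. *)
Let closure_indic (A : set R) : measurable A -> closure (\1_A : R -> R).
Proof.
rewrite [measurable]RGenInftyO.measurableE => mA.
suff [] : [set A : set R | measurable A /\ closure (\1_A : R -> R)] A by [].
move: A mA; apply: lambda_system_subset => //.
- move=> A B [x ->] [y ->]; exists (Num.min x y); apply/seteqP; split=> z /=.
    by rewrite !in_itv/= lt_min => -[-> ->].
  by rewrite !in_itv/= lt_min => /andP[-> ->].
- split=> //.
  + split=> //; rewrite (_ : \1_setT = (fun=> 1))//.
    by apply/funext => x; rewrite indicE in_setT.
  + move=> A B BA [mA cA] [mB cB]; split; first exact: measurableD.
    have -> : \1_(A `\` B) = (fun x => \1_A x + (-1) * \1_B x) :> (R -> R).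
      apply/funext => x; rewrite !indicE in_setD.
      have [xB|xB] := boolP (x \in B); last by rewrite andbT mulr0 addr0.
      rewrite andbF mulN1r (_ : x \in A) ?subrr//.
      by move: xB; rewrite !inE; exact: BA.
    by apply: L_closure_lin => //; exact: is_cos_poly_Lfun.
  + move=> F ndF hF; split.
      by apply: bigcup_measurable => n _; have [] := hF n.
    have mF : measurable (\bigcup_i F i).
      by apply: bigcup_measurable => n _; have [] := hF n.
    apply: (@L_closure_lim _ _ _ mu s s1' _ is_cos_poly_Lfun
      (fun n => \1_(F n)) _ (fun=> 1)).
    * by move=> n; have [] := hF n.
    * exact: indic_Lfun.
    * exact: cst_Lfun.
    * move=> n x; rewrite !indicE normr1.
      by case: (_ \in _); case: (_ \in _); rewrite ?subr0 ?sub0r ?subrr ?normrN ?normr1 ?normr0.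
    * apply: nearW => x; have [xF|xF] := boolP (x \in \bigcup_i F i).
        have /set_mem[k _ xk] := xF.
        apply: (@cvg_near_cst); exists k => // n /= kn.
        rewrite !indicE xF (_ : x \in F n)//.
        by rewrite inE; have /subsetPset := ndF _ _ kn; exact.
      rewrite (_ : (fun n => \1_(F n) x) = (fun=> \1_(\bigcup_i F i) x)).
        exact: cvg_cst.
      apply/funext => n; rewrite !indicE (negbTE xF).
      rewrite (_ : x \in F n = false)//; apply/negbTE.
      by apply: contra xF; rewrite !inE => ?; exists n.
- move=> A [x ->]; split; first exact: measurable_itv.
  exact: closure_ray.
Qed.

(** Positive and negative parts reduce the claim to g >= 0, the increasing limit of simple functions
    whose distance to g is dominated by g itself. *)
Lemma cos_poly_dense f : f \in Lfun mu s%:E -> closure f.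
Proof.
move=> Lf; have mf := Lfun_measurable Lf.
suff pos g : (forall x, 0 <= g x) -> g \in Lfun mu s%:E -> closure g.
  have Lp : (fun x => Num.max (f x) 0) \in Lfun mu s%:E.
    apply: (Lfun_le s1' _ Lf); first by apply: measurable_maxr.
    move=> x; rewrite ger0_norm; last by rewrite le_max lexx orbT.
    by rewrite ge_max ler_norm normr_ge0.
  have Ln : (fun x => Num.max (- f x) 0) \in Lfun mu s%:E.
    apply: (Lfun_le s1' _ Lf).
      by apply: measurable_maxr => //; exact: measurableT_comp.
    move=> x; rewrite ger0_norm; last by rewrite le_max lexx orbT.
    by rewrite ge_max -normrN ler_norm normr_ge0.
  have -> : f = (fun x => Num.max (f x) 0 + (-1) * Num.max (- f x) 0).
    apply/funext => x; have [fx|fx] := leP 0 (f x).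
      by rewrite max_r; lra.
    by rewrite max_l; lra.
  apply: L_closure_lin => //; first exact: is_cos_poly_Lfun.
    by apply: pos => // x; rewrite le_max lexx orbT.
  by apply: pos => // x; rewrite le_max lexx orbT.
move=> g0 Lg; have mg := Lfun_measurable Lg.
have mEg : measurable_fun setT (EFin \o g) by exact/measurable_EFinP.
pose phi := nnsfun_approx measurableT mEg.
have cphi x : phi n x @[n --> \oo] --> g x.
  have : (EFin \o (fun n => phi n x)) @ \oo --> (g x)%:E.
    by apply: cvg_nnsfun_approx => // y _; rewrite lee_fin.
  by move=> /fine_cvgP[_].
have phi_le n x : phi n x <= g x.
  have nd : nondecreasing_seq (fun n => phi n x).
    by move=> k m km; have /lefP := nd_nnsfun_approx measurableT mEg km; exact.
  by rewrite -(cvg_lim _ (cphi x))//; apply: nondecreasing_cvgn_le => //; exact: cvgP (cphi x).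
apply: (@L_closure_lim _ _ _ mu s s1' _ is_cos_poly_Lfun (fun n => phi n) _ g) => //.
- move=> n; have -> : phi n = (fun x => \sum_(y <- finmap.enum_fset
      (fset_set (range (phi n)))) y * \1_(phi n @^-1` [set y]) x) :> (R -> R).
    by apply/funext => x; rewrite fimfunE fsbig_finite.
  apply: L_closure_sum => //.
  + exact: is_cos_poly_Lfun.
  + exact: is_cos_poly0.
  + by move=> y; apply: closure_indic; exact: measurable_sfunP.
- move=> n x; have p0 : 0 <= phi n x by [].
  rewrite ger0_norm ?subr_ge0// ger0_norm// lerBlDr lerDl.
  by [].
- exact: nearW.
Qed.

End Exponent.
End Lebesgue01.

(** * Dilation invariance of integrals and orthogonality of cosines *)

Section Dilation.
Context {R : realType}.
Implicit Types (h : R -> R).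

Lemma is_derive_antiderivative h (a b : R) : continuous h -> a < b ->
  exists H, forall x, a < x < b -> is_derive x 1 H (h x).
Proof. by move=> ch ab; eexists => x xab; exact: antiderivative_itv ch _ xab. Qed.

Lemma is_derive0_eq_cc h (a b : R) : a <= b ->
  (forall x, a <= x <= b -> is_derive x 1 h 0) -> h a = h b.
Proof.
move=> ab dh; apply: is_derive0_eq => //; last first.
  by move=> x /andP[ax xb]; apply: dh; rewrite !ltW.
apply: continuous_in_subspaceT => x; rewrite inE/= in_itv/= => xab.
exact: is_derive_continuous (dh x xab).
Qed.

(** The graph of h over [k, k + 1] is a translate of that over [0, 1] for even k, its mirror image
    for odd k. Both facts are expressed on an antiderivative [H], which takes the place of a change
    of variables. *)
Lemma int01_dilation h (n : nat) : continuous h -> (forall x, h (- x) = h x) ->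
  (forall x, h (x + 2) = h x) -> (0 < n)%N ->
  int01 (fun x => h (n%:R * x)) = int01 h.
Proof.
move=> ch h_even h_per n0.
have n0R : 0 < n%:R :> R by rewrite ltr0n.
have [|H dH] := @is_derive_antiderivative h (-1) (n%:R + 2) ch.
  by rewrite (lt_trans (y := 0))//; lra.
have cH x : -1 < x < n%:R + 2 -> {for x, continuous H}.
  by move=> xI; exact: is_derive_continuous (dH x xI).
have n1R : 1 <= n%:R :> R by rewrite ler1n.
have stepE (k : nat) : (k < n)%N -> H k.+1%:R - H k%:R = H 1 - H 0.
  move=> kn.
  have kR : 0 <= k%:R :> R by [].
  have k1n : k%:R + 1 <= n%:R :> R by rewrite natr1 ler_nat.
  have perE (j : nat) x : h (x + j.*2%:R) = h x.
    elim: j => [|j IH]; first by rewrite addr0.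
    by rewrite doubleS -addn2 natrD addrA h_per.
  rewrite -natr1; have := odd_double_half k; case: (odd k) => kE.
    have khE (x : R) : h (k%:R + x) = h (1 - x).
      rewrite -kE natrD -addrA [_ + x]addrC addrA perE.
      by rewrite -(h_even (1 - x)) -(h_per (- (1 - x))) /=; congr h; lra.
    have E : H (k%:R + 0) + H (1 - 0) = H (k%:R + 1) + H (1 - 1).
      apply: (@is_derive0_eq_cc (fun x => H (k%:R + x) + H (1 - x)) 0 1 ler01).
      move=> x /andP[x0 x1].
      have d1 : is_derive x 1 (fun t => H (k%:R + t)) (h (k%:R + x)).
        have a1 : is_derive x 1 (fun t : R => k%:R + t) (0 + 1).
          exact: is_derive_funD (is_derive_cst _ _ _) (is_derive_id _ _).
        apply: is_derive_val (@is_derive_fun_comp _ H (fun t => k%:R + t) x _ _ (dH _ _) a1) _; first lra.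
        by rewrite add0r mulr1.
      have d2 : is_derive x 1 (fun t => H (1 - t)) (- h (1 - x)).
        have a1 : is_derive x 1 (fun t : R => 1 - t) (0 - 1).
          exact: is_derive_funB (is_derive_cst _ _ _) (is_derive_id _ _).
        apply: is_derive_val (@is_derive_fun_comp _ H (fun t => 1 - t) x _ _ (dH _ _) a1) _; first lra.
        by rewrite sub0r mulrN1.
      by apply: is_derive_val (is_derive_funD d1 d2) _; rewrite khE subrr.
    by move: E; rewrite addr0 subr0 subrr; lra.
  have khE (x : R) : h (k%:R + x) = h x by rewrite addrC -kE add0n perE.
  have E : H (k%:R + 0) - H 0 = H (k%:R + 1) - H 1.
    apply: (@is_derive0_eq_cc (fun x => H (k%:R + x) - H x) 0 1 ler01).
    move=> x /andP[x0 x1].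
    have d1 : is_derive x 1 (fun t => H (k%:R + t)) (h (k%:R + x)).
      have a1 : is_derive x 1 (fun t : R => k%:R + t) (0 + 1).
        exact: is_derive_funD (is_derive_cst _ _ _) (is_derive_id _ _).
      apply: is_derive_val (@is_derive_fun_comp _ H (fun t => k%:R + t) x _ _ (dH _ _) a1) _; first lra.
      by rewrite add0r mulr1.
    apply: is_derive_val (is_derive_funB d1 (dH x _)) _; first lra.
    by rewrite khE subrr.
  by move: E; rewrite addr0; lra.
have HnE : H n%:R - H 0 = n%:R * (H 1 - H 0).
  have : forall k : nat, (k <= n)%N -> H k%:R - H 0 = k%:R * (H 1 - H 0).
    elim=> [|k IH] kn; first by rewrite subrr mul0r.
    have := stepE k kn; have := IH (ltnW kn).
    by rewrite -[X in _ -> _ -> _ = X * _]natr1 mulrDl mul1r; lra.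
  by move=> /(_ n (leqnn n)).
(* The antiderivative exists near [0, 1] only; the margin 1 / (2 n) keeps n x inside the domain of
   [H] after dilation. *)
have FTC (f F : R -> R) : continuous f ->
    (forall x : R, -2^-1 / n%:R < x < 1 + 2^-1 / n%:R -> is_derive x 1 F (f x)) ->
    int01 f = F 1 - F 0.
  move=> cf dF; rewrite /int01 /Rintegral.
  have n2 : 0 < 2^-1 / n%:R :> R by rewrite divr_gt0.
  rewrite (@continuous_FTC2 _ f F)//.
  - exact: continuous_fun_within.
  - split=> [x|//|//].
    + by rewrite in_itv/= => x01; case: (dF x _) => //; move: x01; rewrite mulNr; lra.
    + apply: cvg_at_right_filter; apply: is_derive_continuous (dF 0 _).
      by rewrite mulNr; lra.
    + apply: cvg_at_left_filter; apply: is_derive_continuous (dF 1 _).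
      by rewrite mulNr; lra.
  - move=> x; rewrite in_itv/= => x01; apply: is_derive_derive1; apply: dF.
    by move: x01; rewrite mulNr; lra.
have nV : n%:R^-1 <= 1 :> R by rewrite invf_le1.
have nV0 : 0 < n%:R^-1 :> R by rewrite invr_gt0.
have I1 : int01 h = H 1 - H 0.
  by apply: (FTC h H ch) => x; rewrite mulNr => xI; apply: dH; lra.
have chn : continuous (fun x : R => h (n%:R * x)).
  apply: continuous_fun_comp => //.
  by apply: continuous_funM; [exact: continuous_fun_cst|move=> x; exact: cvg_id].
have I2 : int01 (fun x : R => h (n%:R * x)) =
    n%:R^-1 * H (n%:R * 1) - n%:R^-1 * H (n%:R * 0); last first.
  by rewrite I2 I1 mulr1 mulr0 -mulrBr HnE mulrA mulVf ?mul1r// gt_eqF.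
apply: (FTC _ (fun x : R => n%:R^-1 * H (n%:R * x)) chn).
move=> x /andP[x1 x2].
  have nx1 : - 2^-1 < n%:R * x.
    by rewrite -ltr_pdivrMl// mulrC.
  have nx2 : n%:R * x < n%:R + 2^-1.
    rewrite -ltr_pdivlMl// mulrDr mulVf ?gt_eqF//.
    by rewrite [_^-1 * 2^-1]mulrC.
  have a1 := is_derive_funZ n%:R (is_derive_id x 1).
  have := is_derive_funZ n%:R^-1 (@is_derive_fun_comp _ H (fun t => n%:R * t) x _ _ (dH _ _) a1).
  move=> d; apply: is_derive_val (d _) _; first lra.
  by rewrite mulr1 [h _ * _]mulrC mulrA mulVf ?mul1r// gt_eqF.
Qed.

Lemma cosnN n (x : R) : cosn n (- x) = cosn n x.
Proof. by rewrite /cosn mulrN cosN. Qed.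

Lemma cosnD2 n (x : R) : cosn n (x + 2) = cosn n x.
Proof.
rewrite /cosn mulrDr (_ : n%:R * pi * 2 = (n.*2)%:R * pi); last first.
  by rewrite -muln2 natrM; ring.
by rewrite cosD sin_natpi cos_natpi -signr_odd odd_double expr0 mulr1 mulr0 subr0.
Qed.

Lemma int01_cosn n : int01 (@cosn R n) = (n == 0)%N%:R.
Proof.
case: n => [|n].
  by rewrite -[RHS](int01_cst 1); congr int01; apply/funext => x; rewrite cosn0.
have np : n.+1%:R * pi != 0 :> R by rewrite mulf_neq0// gt_eqF// pi_gt0.
have d (x : R) : is_derive x 1
    (fun x => (n.+1%:R * pi)^-1 * sin (n.+1%:R * pi * x)) (cosn n.+1 x).
  have a1 := is_derive_funZ (n.+1%:R * pi) (is_derive_id x 1).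
  have := is_derive_funZ (n.+1%:R * pi)^-1
    (@is_derive_fun_comp _ sin (fun t => n.+1%:R * pi * t) x _ _
    (is_derive_sin _) a1).
  move=> d; apply: is_derive_val d _.
  by rewrite mulr1 [cos _ * _]mulrC mulrA mulVf ?mul1r.
by rewrite (int01_FTC (@continuous_cosn R _) d) mulr1 mulr0 sin_natpi sin0 !mulr0 subrr.
Qed.

Lemma cosnM n m (x : R) :
  cosn n x * cosn m x = 2^-1 * (cosn (n + m) x + cosn ((n - m) + (m - n)) x).
Proof.
have -> : cosn ((n - m) + (m - n)) x = cos ((n%:R - m%:R) * pi * x) :> R.
  rewrite /cosn; have [mn|/ltnW nm] := leqP m n.
    by rewrite (eqP mn) addn0 natrB.
  by rewrite (eqP nm) add0n natrB// -cosN; congr cos; ring.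
by rewrite /cosn natrD !mulrDl mulNr mulNr cosD cosB; field.
Qed.

Lemma int01_cosnM n m :
  int01 (fun x : R => cosn n x * cosn m x) =
  2^-1 * ((n + m == 0)%N%:R + (n == m)%:R).
Proof.
rewrite (_ : (fun _ => _) = (fun x => 2^-1 * (cosn (n + m) x + cosn ((n - m) + (m - n)) x))).
  have c k := @continuous_cosn R k.
  rewrite int01Z ?int01D// ?int01_cosn; last exact: continuous_funD.
  have -> // : ((n - m + (m - n)) == 0)%N = (n == m).
  by rewrite addn_eq0 !subn_eq0 -eqn_leq.
by apply/funext => x; rewrite cosnM.
Qed.

End Dilation.

(** * The cosine basis and the systems obtained by dilating an even periodic function *)

Section CosineBasis.
Context {R : realType}.
Notation mu := (lebesgue01 R).
Variable s : R.
Hypothesis s1 : 1 < s.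
Let s1' : 1 <= s. Proof. exact: ltW. Qed.
Let s0 : 0 < s. Proof. exact: lt_trans s1. Qed.
Let s1E : (1 <= s%:E)%E. Proof. by rewrite lee_fin. Qed.
Let V := LfunType mu s1E.

Let nu (f : V) : R := nrm mu s f.
Let Lsub (f : R -> R) (Lf : f \in Lfun mu s%:E) : V := Lfun_Sub s1E Lf.

Let eq_nrm01 (f g : R -> R) : f =1 g -> nrm mu s f = nrm mu s g.
Proof. by move=> /funext ->. Qed.

Let nuD (f g : V) : nu (f + g) <= nu f + nu g.
Proof. exact: ler_LnormD. Qed.

Let nuZ (a : R) (f : V) : nu (a *: f) = `|a| * nu f.
Proof. exact: (nrmZ s1' a (LfunP f)). Qed.

Lemma integrable_mul_cosn (f : R -> R) n : f \in Lfun mu s%:E ->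
  mu.-integrable setT (EFin \o (fun x => f x * cosn n x)).
Proof.
move=> Lf; apply/Lfun1_integrable.
have Lf1 : f \in Lfun mu 1%:E.
  by apply: (Lfun_subset _ s1E) Lf => //; rewrite ?lee_fin// lebesgue01T.
apply: (Lfun_le (lexx 1) _ Lf1) => [|x].
  apply: measurable_funM; first exact: Lfun_measurable Lf.
  by apply: continuous_measurable_fun; exact: continuous_cosn.
by rewrite normrM ler_piMr// cos_max.
Qed.

(** Hoelder's inequality against the constant 1, whose norm is 1 because the interval has unit
    mass. *)
Lemma integral_norm_le_nrm (f : R -> R) : f \in Lfun mu s%:E ->
  \int[mu]_x `|f x| <= nrm mu s f.
Proof.
move=> Lf; have mf := Lfun_measurable Lf.
pose q := s / (s - 1).
have s10 : 0 < s - 1 by rewrite subr_gt0.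
have q0 : 0 < q by rewrite divr_gt0.
have sq : s^-1 + q^-1 = 1 by rewrite /q; field; rewrite (gt_eqF s0) (gt_eqF s10).
have := @hoelder _ _ _ mu f (fun=> 1) s q mf (measurable_cst _) s0 q0 sq.
rewrite (_ : EFin \o (fun=> 1) = cst 1%E)// Lnorm_cst1 lebesgue01T poweR1r mule1.
rewrite (_ : (f \* (fun=> 1)) = f); last by apply/funext => x; rewrite /= mulr1.
rewrite Lnorm1 -nrm_fin// => h.
have fE : (\int[mu]_x `|(EFin \o f) x| = (\int[mu]_x `|f x|)%:E)%E.
  rewrite /Rintegral fineK// ge0_fin_numE ?integral_ge0//.
  by apply: le_lt_trans h _; rewrite ltry.
by rewrite fE lee_fin in h.
Qed.

(** The factor is the inverse of the mean square of [cosn n], which is 1 for n = 0 and 1 / 2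
    otherwise. *)
Definition cos_coeff (n : nat) (f : R -> R) : R :=
  (if n == 0%N then 1 else 2) * \int[mu]_x (f x * cosn n x).

Let kap n (f : V) := cos_coeff n f.

Let kapD n (f g : V) : kap n (f + g) = kap n f + kap n g.
Proof.
rewrite /kap /cos_coeff -mulrDr -RintegralD//; try exact: integrable_mul_cosn (LfunP _).
by congr (_ * _); apply: eq_Rintegral => x _; rewrite -mulrDl.
Qed.

Let kapZ n (a : R) (f : V) : kap n (a *: f) = a * kap n f.
Proof.
have h := RintegralZl a measurableT (integrable_mul_cosn n (LfunP f)).
rewrite /kap /cos_coeff [RHS]mulrCA -h.
by congr (_ * _); apply: eq_Rintegral => x _; rewrite mulrA.
Qed.

Lemma cos_coeff_continuous n (f : R -> R) : continuous f ->
  cos_coeff n f = (if n == 0%N then 1 else 2) * int01 (fun x => f x * cosn n x).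
Proof.
move=> cf; rewrite /cos_coeff Rintegral_lebesgue01//.
by apply: continuous_funM => //; exact: continuous_cosn.
Qed.

Let e n : V := Lsub (continuous_Lfun s1 (@continuous_cosn R n)).

Let kap_e n m : kap n (e m) = (n == m)%:R.
Proof.
rewrite /kap cos_coeff_continuous; last exact: continuous_cosn.
rewrite int01_cosnM addn_eq0 [m == n]eq_sym.
case: n => [|n]; case: m => [|m] //=; first by lra.
- by rewrite addr0 !mulr0.
- by rewrite addr0 !mulr0.
- by rewrite add0r mulrA divff// mul1r.
Qed.

Let kap_le n (f : V) : `|kap n f| <= 2 * nu f.
Proof.
have Lf : (f : R -> R) \in Lfun mu s%:E := LfunP f.
rewrite /kap /cos_coeff normrM; apply: ler_pM => //.
  by case: ifP; rewrite ger0_norm//; lra.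
apply: (le_trans (le_normr_Rintegral measurableT (integrable_mul_cosn n Lf))).
apply: le_trans (integral_norm_le_nrm Lf).
have iN k : mu.-integrable setT (EFin \o (fun x => `|f x * cosn k x|)).
  by have := integrable_abse (integrable_mul_cosn k Lf).
apply: le_Rintegral => //.
  rewrite (_ : (fun x => `|f x|) = (fun x => `|f x * cosn 0 x|))//.
  by apply/funext => x; rewrite cosn0 mulr1.
by move=> x _; rewrite normrM ler_piMr// cos_max.
Qed.

Let comb_sumE (b : nat -> R) (w : nat -> V) m N :
  (\sum_(m <= n < N) b n *: w n : V) = (fun x => \sum_(m <= n < N) b n * w n x) :> (R -> R).
Proof.
apply/funext => x; elim: (index_iota m N) => [|n r ih].
  by rewrite !big_nil.
by rewrite !big_cons -ih.
Qed.

Let nu_comb (b : nat -> R) N :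
  nu (\sum_(0 <= n < N) b n *: e n) = nrm mu s (cos_poly b N).
Proof. by rewrite /nu comb_sumE; apply: eq_nrm01 => x. Qed.

Let nu_e_le1 n : nu (e n) <= 1.
Proof.
rewrite /nu nrm_continuous//; last exact: continuous_cosn.
have c1 : continuous (fun x : R => `|cosn n x| `^ s).
  by apply: continuous_norm_powR => //; exact: continuous_cosn.
have p1E (c : R) : 1 `^ c = 1 :> R by rewrite powR1.
rewrite -[leRHS](p1E s^-1); apply: ge0_ler_powR.
- by rewrite invr_ge0 ltW.
- by rewrite nnegrE; apply: int01_ge0 => // x _; rewrite powR_ge0.
- by rewrite nnegrE.
- rewrite -[leRHS](int01_cst 1); apply: int01_le => //.
    exact: continuous_fun_cst.
  move=> x _; rewrite -[leRHS](p1E s); apply: ge0_ler_powR; rewrite ?nnegrE//.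
    exact: ltW.
  exact: cos_max.
Qed.

Let partial_sum_bound : exists2 K : R, 1 <= K &
  forall (b : nat -> R) (N M : nat), (N <= M)%N ->
  nu (\sum_(0 <= n < N) b n *: e n) <= K * nu (\sum_(0 <= n < M) b n *: e n).
Proof.
have [K K0 hK] := @half_partial_sum_le R s s1.
have Ks0 : 0 <= K `^ s^-1 by rewrite powR_ge0.
exists (K `^ s^-1 + 1); first by lra.
move=> b N M; rewrite leq_eqVlt => /orP[/eqP <-|NM].
  by have := seminorm_ge0 nuD nuZ (\sum_(0 <= n < N) b n *: e n); nra.
have f0 := seminorm_ge0 nuD nuZ (\sum_(0 <= n < M) b n *: e n).
have [->|N0] := posnP N.
  by rewrite big_geq// (seminorm0 nuZ) mulr_ge0//; lra.
(* The known bound is for the sum augmented by half of its next term. That half term is then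
   removed: its full coefficient is at most twice the norm of the longer sum. *)
have -> : \sum_(0 <= n < N) b n *: e n =
   (\sum_(0 <= n < N) b n *: e n + (b N / 2) *: e N) - (b N / 2) *: e N.
  by rewrite addrK.
apply: (le_trans (seminormB nuD nuZ _ _)); rewrite mulrDl mul1r lerD//.
  rewrite nu_comb /nu.
  rewrite (@eq_nrm01 _ (fun x => cos_poly b N x + b N / 2 * cosn N x)); last first.
    by move=> x; rewrite /= comb_sumE.
  have c1 : continuous (fun x => cos_poly b N x + b N / 2 * cosn N x).
    apply: continuous_funD; first exact: continuous_cos_poly.
    by apply: continuous_funM; [exact: continuous_fun_cst|exact: continuous_cosn].
  rewrite nrm_continuous// nrm_continuous//; last exact: continuous_cos_poly.
  rewrite -powRM//; last first.
    apply: int01_ge0; last by move=> x _; rewrite powR_ge0.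
    by apply: continuous_norm_powR => //; exact: continuous_cos_poly.
  apply: ge0_ler_powR; rewrite ?nnegrE ?invr_ge0 ?(ltW s0)//.
  - by apply: int01_ge0 => [|x _]; [exact: continuous_norm_powR|rewrite powR_ge0].
  - rewrite mulr_ge0//; apply: int01_ge0 => [|x _]; last by rewrite powR_ge0.
    by apply: continuous_norm_powR => //; exact: continuous_cos_poly.
  - by apply: hK; rewrite N0.
rewrite nuZ normrM [`|2^-1|]ger0_norm//.
have : `|b N| <= 2 * nu (\sum_(0 <= n < M) b n *: e n).
  apply: le_trans (kap_le N _).
  have -> : kap N (\sum_(0 <= n < M) b n *: e n) = b N => //.
  have kap_sum (r : seq nat) : kap N (\sum_(n <- r) b n *: e n) =
      \sum_(n <- r) b n * (N == n)%:R.
    elim: r => [|n r ih].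
      by rewrite !big_nil -(scale0r 0) kapZ mul0r.
    by rewrite !big_cons kapD kapZ kap_e ih.
  rewrite kap_sum (bigD1_seq N) ?mem_index_iota ?iota_uniq//= eqxx mulr1.
  by rewrite big1 ?addr0// => i /negPf; rewrite eq_sym => ->; rewrite mulr0.
have := nu_e_le1 N; have := seminorm_ge0 nuD nuZ (e N); nra.
Qed.

Let e_dense (f : V) (d : R) : 0 < d ->
  exists N (b : nat -> R), nu (f - \sum_(0 <= n < N) b n *: e n) < d.
Proof.
move=> d0; have [_ /(_ d d0)[g [N [b gE]] hg]] := cos_poly_dense s1 (LfunP f).
exists N, b; rewrite /nu (@eq_nrm01 _ (fun x => f x - g x))//.
by move=> x; rewrite gE /= comb_sumE.
Qed.

Lemma cos_partial_sums_cvg (f : R -> R) (d : R) : f \in Lfun mu s%:E -> 0 < d ->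
  exists N0, forall N, (N0 <= N)%N ->
    nrm mu s (fun x => f x - cos_poly (cos_coeff^~ f) N x) < d.
Proof.
move=> Lf d0; have [K K1 hK] := partial_sum_bound.
have [N0 h] := partial_sum_cvg nuD nuZ kapD kapZ kap_e kap_le K1 hK e_dense (Lsub Lf) d0.
exists N0 => N /h; rewrite /nu (@eq_nrm01 _ (fun x => f x - cos_poly (cos_coeff^~ f) N x))//.
by move=> x; rewrite /= /partial_sum comb_sumE.
Qed.

Let nrm_dilation (h : R -> R) (n : nat) : continuous h ->
  (forall x, h (- x) = h x) -> (forall x, h (x + 2) = h x) -> (0 < n)%N ->
  nrm mu s (fun x => h (n%:R * x)) = nrm mu s h.
Proof.
move=> ch he hp n0.
have chn : continuous (fun x : R => h (n%:R * x)).
  apply: continuous_fun_comp => //.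
  by apply: continuous_funM; [exact: continuous_fun_cst|move=> x; exact: cvg_id].
rewrite (nrm_continuous s1 ch) (nrm_continuous s1 chn).
have cs := continuous_norm_powR s0 ch.
have es x : `|h (- x)| `^ s = `|h x| `^ s by rewrite he.
have ps x : `|h (x + 2)| `^ s = `|h x| `^ s by rewrite hp.
by rewrite -(int01_dilation cs es ps n0).
Qed.

Let cosn_dilation j n (x : R) : cosn (j * n) x = cosn n (j%:R * x).
Proof. by rewrite /cosn natrM; congr cos; ring. Qed.

Let dilation_le (j : nat) (b : nat -> R) N : (0 < j)%N ->
  nu (\sum_(1 <= n < N) b n *: e (j * n)%N) <=
  nu (\sum_(1 <= n < N) b n *: e n).
Proof.
move=> j0; rewrite le_eqVlt; apply/orP; left; apply/eqP.
rewrite /nu !comb_sumE.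
pose h (x : R) := \sum_(1 <= n < N) b n * cosn n x.
rewrite -[RHS]/(nrm mu s h) -(@nrm_dilation h j)//.
- apply: eq_nrm01 => x; apply: eq_bigr => n _.
  by congr (_ * _); exact: cosn_dilation.
- apply: continuous_fun_sum => n.
  by apply: continuous_funM; [exact: continuous_fun_cst|exact: continuous_cosn].
- by move=> x; apply: eq_bigr => n _; rewrite cosnN.
- by move=> x; apply: eq_bigr => n _; rewrite cosnD2.
Qed.

Variables (g : R -> R) (A : R).
Hypothesis g_cont : continuous g.
Hypothesis g_even : forall x, g (- x) = g x.
Hypothesis g_per : forall x, g (x + 2) = g x.
Hypothesis g0_neq0 : g 0 != 0.
Hypothesis g_mean : cos_coeff 0 g = 0.
Hypothesis a1_gt0 : 0 < cos_coeff 1 g.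
Hypothesis a_sum_le : forall J, \sum_(2 <= j < J) `|cos_coeff j g| <= A.
Hypothesis A_lt : A < cos_coeff 1 g.

Let g_dil_cont (n : nat) : continuous (fun x : R => g (n%:R * x)).
Proof.
apply: continuous_fun_comp => //.
by apply: continuous_funM; [exact: continuous_fun_cst|move=> x; exact: cvg_id].
Qed.

Let f n : V := Lsub (@continuous_Lfun R s s1 (fun x : R => g (n%:R * x)) (@g_dil_cont n)).

Let f0E : f 0%N = g 0 *: e 0%N.
Proof.
apply/LfuneqP => x; rewrite -[RHS]/(g 0 * cosn 0 x) cosn0 mulr1.
by rewrite -[LHS]/(g (0 * x)) mul0r.
Qed.

Let f_lim n (d : R) : (0 < n)%N -> 0 < d ->
  exists J0, forall J, (J0 <= J)%N ->
    nu (f n - \sum_(1 <= j < J) cos_coeff j g *: e (j * n)%N) < d.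
Proof.
move=> n0 d0; have [J0 hJ] := cos_partial_sums_cvg (continuous_Lfun s1 g_cont) d0.
(* [J >= 1] lets the term of index 0 be split off; it vanishes by [g_mean]. *)
exists (maxn J0 1) => J; rewrite geq_max => /andP[/hJ {}hJ J1].
pose h (x : R) := g x - cos_poly (cos_coeff^~ g) J x.
rewrite /nu (@eq_nrm01 _ (fun x => h (n%:R * x))).
  rewrite nrm_dilation//.
  - by apply: continuous_funB => //; exact: continuous_cos_poly.
  - move=> x; rewrite /h g_even; congr (_ - _).
    by apply: eq_bigr => k _; rewrite cosnN.
  - move=> x; rewrite /h g_per; congr (_ - _).
    by apply: eq_bigr => k _; rewrite cosnD2.
move=> x; rewrite /h /= comb_sumE /cos_poly big_ltn// g_mean mul0r add0r.
congr (_ - _); apply: eq_bigr => j _.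
by congr (_ * _); rewrite mulnC; exact: cosn_dilation.
Qed.

Theorem dilation_basis :
  schauder_basis_Lfun mu s (fun (n : nat) (x : R) => g (n%:R * x)).
Proof.
split=> [n|h Lh]; first exact: continuous_Lfun.
have [K K1 hK] := partial_sum_bound.
have [al [hal uniq_al]] := perturbed_basis nuD nuZ kapD kapZ kap_e kap_le K1 hK
  e_dense a1_gt0 a_sum_le A_lt dilation_le g0_neq0 f0E f_lim (Lsub Lh).
have key (a : nat -> R) :
  ('N[mu]_(s%:E)[EFin \o (fun x => h x - \sum_(n < N) a n * g (n%:R * x))%R]
     @[N --> \oo] --> 0)%E <->
  (forall d, 0 < d -> exists N0, forall N, (N0 <= N)%N ->
    nu (Lsub Lh - \sum_(0 <= n < N) a n *: f n) < d).
  have LE N : (fun x => h x - \sum_(n < N) a n * g (n%:R * x)) =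
      ((Lsub Lh - \sum_(0 <= n < N) a n *: f n : V) : R -> R).
    apply/funext => x; rewrite /= comb_sumE /=.
    by congr (_ - _); rewrite big_mkord.
  under eq_fun do rewrite LE.
  have NE N : ('N[mu]_(s%:E)[EFin \o ((Lsub Lh - \sum_(0 <= n < N) a n *: f n : V)%R : R -> R)] =
      (nu (Lsub Lh - \sum_(0 <= n < N) a n *: f n))%:E)%E.
    by rewrite (nrm_fin s1E)//; exact: LfunP.
  under eq_fun do rewrite NE.
  split.
    move=> /fine_cvgP[_ /cvgrPdist_lt hc] d d0.
    have [N0 _ hN0] := hc d d0; exists N0 => N /hN0.
    by rewrite sub0r normrN /= ger0_norm// seminorm_ge0.
  move=> hd; apply: cvg_EFin; first exact: nearW.
  apply/cvgrPdist_lt => d d0; have [N0 hN0] := hd d d0.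
  exists N0 => // N /hN0.
  by rewrite sub0r normrN /= ger0_norm// seminorm_ge0.
exists al; split; first exact/key.
by move=> be /key; exact: uniq_al.
Qed.

End CosineBasis.

(** * The functions sin_p and cos_p *)

Section PowerCalculus.
Context {R : realType}.
Implicit Types (f g h Z : R -> R) (x y r p : R).

(** Young's inequality for the product of w^r and 1, with conjugate exponents 1 / r and 1 / (1 -
    r). *)
Lemma powR_le_tangent (w r : R) : 0 < r < 1 -> 0 <= w ->
  w `^ r <= 1 + r * (w - 1).
Proof.
move=> /andP[r0 r1] w0.
have r10 : 0 < 1 - r by rewrite subr_gt0.
have := @conjugate_powR R (w `^ r) 1 r^-1 (1 - r)^-1 (powR_ge0 _ _) ler01.
rewrite !invr_gt0 !invrK mulr1 -powRrM divff ?gt_eqF// powRr1// powR1.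
move=> /(_ r0 r10); rewrite addrC subrK => /(_ erefl); lra.
Qed.

(** The tangent inequality with exponent 1 / p, applied to w = (1 - y)^p. *)
Lemma bernoulli_powR p y : 1 < p -> 0 <= y <= 1 -> 1 - p * y <= (1 - y) `^ p.
Proof.
move=> p1 /andP[y0 y1].
have p0 : 0 < p by lra.
have pV : 0 < p^-1 < 1 by rewrite invr_gt0 p0 invf_lt1.
have := powR_le_tangent pV (powR_ge0 (1 - y) p).
rewrite -powRrM divff ?gt_eqF// powRr1; last lra.
move=> h; have : p * (1 - y) <= p * (1 + p^-1 * ((1 - y) `^ p - 1)).
  by rewrite ler_wpM2l// ltW.
by rewrite [leRHS]mulrDr mulrA divff ?gt_eqF//; lra.
Qed.

(** As [phi] may blow up at the ends, it is compared with [Z] on the intervals [e_n, 1 - e_n], which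
    exhaust ]0, 1[, and monotone convergence concludes. *)
Lemma ge0_le_derive_integrable (phi psi Z : R -> R) :
  (forall x, 0 < x < 1 -> {for x, continuous phi}) ->
  (forall x, 0 < x < 1 -> 0 <= phi x <= psi x) ->
  {within `[0, 1], continuous Z} ->
  (forall x, 0 < x < 1 -> is_derive x 1 Z (psi x)) ->
  lebesgue_measure.-integrable `[0, 1] (EFin \o phi) /\
  \int[lebesgue_measure]_(x in `[0, 1]) phi x <= Z 1 - Z 0.
Proof.
move=> cphi phib cZ dZ.
have mphi : measurable_fun (`]0, 1[%classic : set (measurableTypeR R)) (EFin \o phi).
  apply/measurable_EFinP; apply: open_continuous_measurable_fun => //.
  by move=> x; rewrite inE/= in_itv/= => /cphi.
have subZ (a b : R) : 0 <= a -> b <= 1 -> {within `[a, b], continuous Z}.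
  move=> a0 b1; apply: continuous_subspaceW cZ => x /=.
  by rewrite !in_itv/= => /andP[ax xb]; rewrite (le_trans a0) ?(le_trans xb).
have ndZ (a b : R) : 0 <= a -> a <= b -> b <= 1 -> Z a <= Z b.
  move=> a0 ab b1; apply: (ge0_is_derive_le ab (subZ _ _ a0 b1) (g := psi)).
    by move=> x /andP[ax xb]; apply: dZ; rewrite (le_lt_trans a0) ?(lt_le_trans xb).
  move=> x /andP[ax xb].
  have /phib : 0 < x < 1 by rewrite (le_lt_trans a0) ?(lt_le_trans xb).
  by move=> /andP[h1 h2]; exact: le_trans h1 h2.
have intE (a b : R) : 0 < a -> a < b -> b < 1 ->
    (\int[lebesgue_measure]_(x in `[a, b]) (phi x)%:E <= (Z 1 - Z 0)%:E)%E.
  move=> a0 ab b1.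
  have i01 x : a <= x <= b -> 0 < x < 1.
    by move=> /andP[ax xb]; rewrite (lt_le_trans a0) ?(le_lt_trans xb).
  have iphi : lebesgue_measure.-integrable `[a, b] (EFin \o phi).
    apply: continuous_compact_integrable; first exact: segment_compact.
    apply: continuous_in_subspaceT => x; rewrite inE/= in_itv/= => /i01.
    exact: cphi.
  pose G x := \int[lebesgue_measure]_(t in `[a, x]) phi t.
  have cG : {within `[a, b], continuous G}.
    exact: (@parameterized_integral_continuous _ a b phi (ltW ab) iphi).
  have dG x : a < x < b -> is_derive x 1 G (phi x).
    move=> /andP[ax xb].
    have [] := @continuous_FTC1_closed R phi a x b xb iphi ax.
      by apply: cphi; apply: i01; rewrite !ltW.
    by move=> h1 h2; rewrite -h2 derive1E; exact: derivableP.
  have : Z a - G a <= Z b - G b.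
    apply: (@ge0_is_derive_le _ (fun x => Z x - G x) (fun x => psi x - phi x) _ _ (ltW ab)).
    - by move=> x; apply: cvgB; [exact: subZ (ltW a0) (ltW b1) x|exact: cG].
    - move=> x /andP[ax xb]; have x01 : 0 < x < 1 by apply: i01; rewrite !ltW.
      by apply: is_derive_funB; [exact: dZ|apply: dG; rewrite ax].
    - move=> x /andP[ax xb].
      have /phib : 0 < x < 1 by apply: i01; rewrite !ltW.
      by move=> /andP[_]; rewrite subr_ge0.
  have Ga : G a = 0 by rewrite /G set_itv1 Rintegral_set1.
  have GbE : (\int[lebesgue_measure]_(x in `[a, b]) (phi x)%:E = (G b)%:E)%E.
    rewrite /G /Rintegral fineK//; exact: integrable_fin_num.
  rewrite GbE lee_fin Ga.
  have := ndZ 0 a (lexx _) (ltW a0) (ltW (lt_trans ab b1)).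
  have := ndZ b 1 (ltW (lt_trans a0 ab)) (ltW b1) (lexx _).
  lra.
have [e [n3 e_homo e_small]] : exists e : nat -> R, [/\ forall n, 0 < e n < 2^-1,
    forall m n, (m <= n)%N -> e n <= e m & forall d, 0 < d -> exists n, e n < d].
  (* Starting at 1 / 3 keeps [e n] below 1 / 2, so that the intervals are nondegenerate. *)
  exists (fun n => n.+3%:R^-1); split => [n|m n mn|d d0].
  - by rewrite invr_gt0 ltr0n ltf_pV2 ?posrE ?ltr0n// ltr_nat.
  - by rewrite lef_pV2 ?posrE ?ltr0n// ler_nat.
  - have [k hk] := ltr_add_invr d0; exists k; rewrite add0r in hk.
    by rewrite (le_lt_trans _ hk)// lef_pV2 ?posrE ?ltr0n// ler_nat ltnS -addn2 leq_addr.
pose D (n : nat) : set R := `[e n, 1 - e n]%classic.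
have Dphi n x : D n x -> 0 < x < 1.
  by rewrite /D /= in_itv/=; have := n3 n; lra.
have DU : \bigcup_n D n = `]0, 1[%classic.
  apply/seteqP; split=> x /=.
    by move=> [n _] /Dphi; rewrite in_itv.
  rewrite in_itv/= => /andP[x0 x1].
  have [|k hk] := e_small (Num.min x (1 - x)); first by rewrite lt_min x0 subr_gt0.
  exists k => //; rewrite /D /= in_itv/=.
  by move: hk; rewrite lt_min; lra.
have hle : (\int[lebesgue_measure]_(x in `]0%R, 1%R[) (phi x)%:E <= (Z 1 - Z 0)%:E)%E.
  rewrite -DU.
  have cv := @ge0_nondecreasing_set_cvg_integral _ (measurableTypeR R) R D (EFin \o phi) lebesgue_measure.
  apply: (cvge_le _ (cv _ _ _ _)).
  - apply: nearW => n; apply: intE; have := n3 n; lra.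
  - move=> m n mn; apply/subsetPset => x; rewrite /D /= !in_itv/=.
    have := e_homo _ _ mn.
    lra.
  - by move=> n; rewrite /D.
  - move=> n; apply: measurable_funS mphi => // x /Dphi.
    by rewrite /= in_itv.
  - by move=> n x /Dphi/phib/andP[? _]; rewrite lee_fin.
have Ephi : (\int[lebesgue_measure]_(x in `[0%R, 1%R]) (phi x)%:E =
    \int[lebesgue_measure]_(x in `]0%R, 1%R[) (phi x)%:E)%E.
  exact: integral_itv_bndoo.
have iphi : lebesgue_measure.-integrable `[0, 1] (EFin \o phi).
  apply/integrableP; split.
    apply/emeasurable_fun_itv_bndo_bndcP.
    exact/emeasurable_fun_itv_obnd_cbndP.
  rewrite (@integral_itv_bndoo _ 0 1 (fun x => `|(EFin \o phi) x|)%E); last first.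
    exact: measurableT_comp.
  under eq_integral.
    move=> x; rewrite inE/= in_itv/= => /phib/andP[h _].
    rewrite ger0_norm//. over.
  by apply: le_lt_trans hle _; rewrite ltry.
split=> //; rewrite -lee_fin /Rintegral fineK ?Ephi//.
by rewrite -Ephi; exact: integrable_fin_num.
Qed.

End PowerCalculus.

Section WithinContinuity.
Context {R : realType}.
Implicit Types (f g : R -> R) (A : set R).

Lemma within_continuous_eq f g A : (forall x, A x -> f x = g x) ->
  {within A, continuous f} -> {within A, continuous g}.
Proof. by move=> fg; apply: subspace_eq_continuous => x; rewrite inE; exact: fg. Qed.

Lemma within_ge0_powR (c : R) f A : 0 < c -> {within A, continuous f} ->
  (forall x, A x -> 0 <= f x) -> {within A, continuous (fun x => f x `^ c)}.
Proof.
move=> c0 cf f0; apply: (@within_continuous_eq (fun x => `|f x| `^ c)).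
  by move=> x Ax; rewrite ger0_norm// f0.
apply: (@continuous_fun_comp R (subspace A) (fun y => `|y| `^ c) f) => //.
by apply: (continuous_ge0_powR c0) => //; exact: norm_continuous.
Qed.

End WithinContinuity.

(** * The integral F_p: size, monotonicity and convexity *)

Section ArcSine.
Context {R : realType}.
Variable p : R.
Hypothesis p1 : 1 < p.
Implicit Types x y t : R.

Let p0 : 0 < p. Proof. exact: lt_trans p1. Qed.
Let pV0 : 0 < p^-1. Proof. by rewrite invr_gt0. Qed.
Let pV1 : p^-1 < 1. Proof. by rewrite invf_lt1. Qed.

Let powR1E (q : R) : 1 `^ q = 1 :> R. Proof. by rewrite powR1. Qed.

Notation phi := (fun t : R => (1 - t `^ p) `^ (- p^-1)).

Let powp_bound x : 0 < x < 1 -> 0 < x `^ p < 1.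
Proof.
move=> /andP[x0 x1]; rewrite powR_gt0//= -[X in _ < X](powR1E p).
by rewrite gt0_ltr_powR ?nnegrE ?ler01 ?ltW.
Qed.

Let phi_continuous x : 0 < x < 1 -> {for x, continuous phi}.
Proof.
move=> x01; have /andP[xp0 xp1] := powp_bound x01; case/andP: x01 => x0 x1.
have d1 : is_derive x 1 (fun t : R => 1 - t `^ p) (0 - p * x `^ (p - 1) * 1).
  exact: is_derive_funB (is_derive_cst _ _ _) (is_derive_fun_powR p (is_derive_id _ _) x0).
apply: is_derive_continuous (is_derive_fun_powR (- p^-1) d1 _).
by rewrite subr_gt0.
Qed.

Let phi_ge1 x : 0 < x < 1 -> 1 <= phi x.
Proof.
move=> x01; have /andP[xp0 xp1] := powp_bound x01.
rewrite powRN invr_ge1 ?unitfE ?gt_eqF ?powR_gt0 ?subr_gt0//.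
rewrite -[leRHS](powR1E p^-1) ge0_ler_powR ?nnegrE ?(ltW pV0)//; lra.
Qed.

Let phi_le x y : 0 < x -> x <= y -> y < 1 -> phi x <= phi y.
Proof.
move=> x0 xy y1; have y0 := lt_le_trans x0 xy.
have /andP[xp0 xp1] : 0 < x `^ p < 1 by apply: powp_bound; rewrite x0 (le_lt_trans xy).
have /andP[yp0 yp1] : 0 < y `^ p < 1 by apply: powp_bound; rewrite y0.
have pos z : z < 1 -> (1 - z) `^ p^-1 \is Num.pos.
  by move=> z1; rewrite posrE powR_gt0// subr_gt0.
rewrite !powRN (lef_pV2 (pos _ xp1) (pos _ yp1)).
apply: ge0_ler_powR; rewrite ?nnegrE ?subr_ge0 ?(ltW pV0) ?(ltW xp1) ?(ltW yp1)//.
by rewrite lerD2l lerN2 ge0_ler_powR ?nnegrE ?(ltW p0) ?(ltW x0) ?(ltW y0).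
Qed.

Let r := 1 - p^-1.
Let r0 : 0 < r. Proof. by rewrite subr_gt0. Qed.
Let r1 : r < 1. Proof. by rewrite /r ltrBlDr ltrDl. Qed.

(** The second hypothesis bounds the integrand by (1 - y)^(-1/p) (1 - k y), whose antiderivative is
    explicit after writing 1 - k y = (1 - k) + k (1 - y). The value k = 0 yields integrability, k =
    1 / 5 a sharper bound on pi_p. *)
Let phi_integral (k : R) : 0 <= k <= 5^-1 ->
  (forall y, 0 < y < 1 -> 1 - y <= (1 - k * y) `^ p * (1 - y `^ p)) ->
  lebesgue_measure.-integrable `[0, 1] (EFin \o phi) /\
  Fp p 1 <= (1 - k) / r + k / (1 + r).
Proof.
move=> /andP[k0 k1] hk.
pose Z y := - ((1 - k) / r * (1 - y) `^ r + k / (1 + r) * (1 - y) `^ (1 + r)).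
pose psi y := (1 - y) `^ (- p^-1) * (1 - k * y).
have r10 : 0 < 1 + r by have := r0; lra.
have Z1 : Z 1 = 0 by rewrite /Z subrr !powR0 ?gt_eqF// !mulr0 addr0 oppr0.
have Z0 : Z 0 = - ((1 - k) / r + k / (1 + r)) by rewrite /Z subr0 !powR1E !mulr1.
have -> : (1 - k) / r + k / (1 + r) = Z 1 - Z 0 by rewrite Z1 Z0 sub0r opprK.
apply: (@ge0_le_derive_integrable _ _ psi) => [|y y01| |y /andP[y0 y1]].
- exact: phi_continuous.
- have /andP[yp0 yp1] := powp_bound y01.
  rewrite powR_ge0 /psi /= !powRN; case/andP: (y01) => y0 y1.
  have ky : 0 < 1 - k * y by nra.
  rewrite ler_pdivlMl ?powR_gt0 ?subr_gt0//.
  rewrite mulrC ler_pdivrMl ?powR_gt0 ?subr_gt0//.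
  have := hk y y01 => {}hk.
  have := @ge0_ler_powR _ p^-1 (ltW pV0) _ _ _ _ hk.
  rewrite !nnegrE powRM ?powR_ge0//; last by rewrite subr_ge0 ltW.
  rewrite -powRrM divff ?gt_eqF// powRr1; last exact: ltW.
  rewrite [(1 - y `^ p) `^ _ * _]mulrC; apply; first lra.
  by rewrite mulr_ge0 ?powR_ge0//; lra.
- have c1 : {within `[0, 1], continuous (fun y : R => 1 - y)}.
    apply: continuous_fun_within; apply: continuous_funB; first exact: continuous_fun_cst.
    by move=> x; exact: cvg_id.
  have n1 : forall y, `[0, 1]%classic y -> 0 <= 1 - y.
    by move=> y; rewrite /= in_itv/= subr_ge0 => /andP[].
  apply: (@continuous_funN _ (subspace _)); apply: (@continuous_funD _ (subspace _));
    apply: (@continuous_funM _ (subspace _)); try exact: continuous_fun_cst;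
    exact: within_ge0_powR.
- have y10 : 0 < 1 - y by lra.
  have d1 : is_derive y 1 (fun t : R => 1 - t) (0 - 1).
    exact: is_derive_funB (is_derive_cst _ _ _) (is_derive_id _ _).
  apply: is_derive_val (is_derive_funN (is_derive_funD
    (is_derive_funZ _ (is_derive_fun_powR r d1 y10))
    (is_derive_funZ _ (is_derive_fun_powR (1 + r) d1 y10)))) _.
  have -> : r - 1 = - p^-1 by rewrite /r; lra.
  have -> : (1 + r - 1) = - p^-1 + 1 by rewrite /r; lra.
  rewrite [_ `^ (_ + 1)]powRD; last by rewrite (gt_eqF y10) implybT.
  rewrite powRr1 ?(ltW y10)// /psi; field.
  by rewrite !gt_eqF.
Qed.

Let phi_integrable_le : lebesgue_measure.-integrable `[0, 1] (EFin \o phi) /\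
  Fp p 1 <= (1 - 0) / r + 0 / (1 + r).
Proof.
apply: phi_integral => [|y /andP[y0 y1]]; first by rewrite lexx invr_ge0 ler0n.
rewrite mul0r subr0 powR1E mul1r lerD2l lerN2.
by apply: ge1r_powR; rewrite ?y0 ?(ltW y1) ?(ltW p1).
Qed.

Let phi_integrable := phi_integrable_le.1.

Lemma Fp1_le : Fp p 1 <= p / (p - 1).
Proof.
apply: le_trans phi_integrable_le.2 _; rewrite mul0r addr0 subr0 mul1r /r.
by rewrite le_eqVlt; apply/orP; left; apply/eqP; field; rewrite ?subr_eq0 ?(gt_eqF p0) ?(gt_eqF p1).
Qed.

(* With [k = 1 / 5], the inequality [1 - y <= (1 - k y)^p (1 - y^p)] follows
   from [y^p <= (2 - p) y + (p - 1) y^2] and [(1 - k y)^p >= 1 - p k y]. *)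
Lemma Fp1_le_refined : 7 / 5 <= p < 2 ->
  Fp p 1 <= 4 / 5 * (p / (p - 1)) + 1 / 5 * (p / (2 * p - 1)).
Proof.
move=> /andP[p15 p2].
have hk y : 0 < y < 1 -> 1 - y <= (1 - 5^-1 * y) `^ p * (1 - y `^ p).
  move=> /[dup] y01 /andP[y0 y1].
  have p11 : 0 < p - 1 < 1 by lra.
  have h1 : y `^ p <= y * (1 + (p - 1) * (y - 1)).
    have -> : y `^ p = y * y `^ (p - 1) by rewrite mulr_powRB1// ltW.
    by rewrite ler_wpM2l ?(ltW y0)// powR_le_tangent// ltW.
  have h2 : 1 - p * (5^-1 * y) <= (1 - 5^-1 * y) `^ p.
    by apply: bernoulli_powR => //; lra.
  apply: (@le_trans _ _ ((1 - p * (5^-1 * y)) * ((1 - y) * (1 + (p - 1) * y)))).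
    have h3 : 0 <= p - 1 - p / 5 - p * (p - 1) / 5 * y.
      have e1 : 0 <= p * (p - 1) * (1 - y) by apply: mulr_ge0; [apply: mulr_ge0|]; lra.
      have e2 : 0 <= (p - 7 / 5) * (2 - p) by apply: mulr_ge0; lra.
      lra.
    have h4 : 0 <= (1 - y) * y * (p - 1 - p / 5 - p * (p - 1) / 5 * y).
      by apply: mulr_ge0 => //; apply: mulr_ge0; lra.
    lra.
  have /andP[yp0 yp1] := powp_bound y01.
  apply: ler_pM => //; [nra|rewrite mulr_ge0; nra|nra].
have [|_] := phi_integral _ hk; first by rewrite lexx invr_ge0 ler0n.
move=> h; apply: le_trans h _; rewrite /r.
rewrite le_eqVlt; apply/orP; left; apply/eqP; field.
have := p1; lra.
Qed.

Lemma within_continuous_Fp : {within `[0, 1], continuous (Fp p)}.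
Proof. exact: (@parameterized_integral_continuous _ 0 1 phi ler01 phi_integrable). Qed.

Lemma is_derive_Fp x : 0 < x < 1 -> is_derive x 1 (Fp p) (phi x).
Proof.
move=> /andP[x0 x1].
have [|h1 h2] := @continuous_FTC1_closed R phi 0 x 1 x1 phi_integrable x0.
  by apply: phi_continuous; rewrite x0.
by rewrite -h2 derive1E; exact: derivableP.
Qed.

Lemma Fp0 : Fp p 0 = 0.
Proof. by rewrite /Fp set_itv1 Rintegral_set1. Qed.

Let within_sub (x y : R) (f : R -> R) : 0 <= x -> y <= 1 ->
  {within `[0, 1], continuous f} -> {within `[x, y], continuous f}.
Proof.
move=> x0 y1; apply: continuous_subspaceW => z /=.
by rewrite !in_itv/= => /andP[xz zy]; rewrite (le_trans x0) ?(le_trans zy).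
Qed.

(** The integrand is at least 1; consequently the inverse function is 1-Lipschitz. *)
Lemma Fp_expansive x y : 0 <= x -> x <= y -> y <= 1 -> y - x <= Fp p y - Fp p x.
Proof.
move=> x0 xy y1.
have h z : x < z < y -> 0 < z < 1.
  by move=> /andP[xz zy]; rewrite (le_lt_trans x0) ?(lt_le_trans zy).
suff : Fp p x - x <= Fp p y - y by lra.
apply: (@ge0_is_derive_le _ (fun z => Fp p z - z) (fun z => phi z - 1)) => //.
- apply: within_sub => //; apply: (@continuous_funB _ (subspace _)).
    exact: within_continuous_Fp.
  by apply: continuous_fun_within => z; exact: cvg_id.
- by move=> z /h z01; exact: is_derive_funB (is_derive_Fp z01) (is_derive_id _ _).
- by move=> z /h z01; rewrite subr_ge0 phi_ge1.
Qed.

(** Convexity: the integrand increases, so the increments on both sides of [x] compare with its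
    value at [x]; the weights 1 - x and x then eliminate that value. *)
Lemma Fp_le_chord x : 0 <= x <= 1 -> Fp p x <= x * Fp p 1.
Proof.
move=> /andP[]; rewrite le_eqVlt => /predU1P[<- _|x0].
  by rewrite Fp0 mul0r.
rewrite le_eqVlt => /predU1P[->|x1]; first by rewrite mul1r.
have cl (a b : R) : {within `[0, 1], continuous (fun t : R => a * t + b * Fp p t)}.
  apply: (@continuous_funD _ (subspace _)); apply: (@continuous_funM _ (subspace _));
    try exact: continuous_fun_cst; last exact: within_continuous_Fp.
  by apply: continuous_fun_within => z; exact: cvg_id.
have dl (a b z : R) : 0 < z < 1 ->
    is_derive z 1 (fun t : R => a * t + b * Fp p t) (a * 1 + b * phi z).
  move=> z01; exact: is_derive_funD (is_derive_funZ _ (is_derive_id _ _))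
    (is_derive_funZ _ (is_derive_Fp z01)).
have h1 : phi x * 0 + -1 * Fp p 0 <= phi x * x + -1 * Fp p x.
  apply: (@ge0_is_derive_le _ (fun z => phi x * z + -1 * Fp p z) (fun z => phi x * 1 + -1 * phi z) 0 x (ltW x0)).
  - exact: within_sub (lexx _) (ltW x1) (cl _ _).
  - by move=> z /andP[z0 zx]; apply: dl; rewrite z0 (lt_trans zx).
  - move=> z /andP[z0 zx]; have := @phi_le z x z0 (ltW zx) x1.
    by rewrite mulr1 mulN1r subr_ge0.
have h2 : - phi x * x + 1 * Fp p x <= - phi x * 1 + 1 * Fp p 1.
  apply: (@ge0_is_derive_le _ (fun z => - phi x * z + 1 * Fp p z) (fun z => - phi x * 1 + 1 * phi z) x 1 (ltW x1)).
  - exact: within_sub (ltW x0) (lexx _) (cl _ _).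
  - by move=> z /andP[xz z1]; apply: dl; rewrite z1 (lt_trans x0).
  - move=> z /andP[xz z1]; have := @phi_le x z x0 (ltW xz) z1.
    by rewrite mulr1 mul1r [- _ + _]addrC subr_ge0.
rewrite Fp0 in h1.
have e1 : 0 <= (1 - x) * (phi x * x - Fp p x) by rewrite mulr_ge0//; lra.
have e2 : 0 <= x * (Fp p 1 - Fp p x - phi x * (1 - x)).
  by rewrite mulr_ge0 ?(ltW x0)//; lra.
lra.
Qed.

End ArcSine.

(** * sin_p and its derivatives on the first quarter period *)

Section QuarterSine.
Context {R : realType}.
Variable p : R.
Hypothesis p1 : 1 < p.
Implicit Types x y t : R.

Let p0 : 0 < p. Proof. exact: lt_trans p1. Qed.
Let pV0 : 0 < p^-1. Proof. by rewrite invr_gt0. Qed.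
Let c := Fp p 1.
Let S := sinp_quarter p.

Let c1 : 1 <= c.
Proof. by have := Fp_expansive p1 (lexx 0) ler01 (lexx 1); rewrite subr0 Fp0 subr0. Qed.

Lemma pip_ge2 : 2 <= pip p.
Proof. by have := c1; rewrite /pip -/c; lra. Qed.

Let FpK x : 0 <= x <= 1 -> S (Fp p x) = x.
Proof.
have Finj : {in `[0, 1]%classic &, injective (Fp p)}.
  move=> y z; rewrite !inE/= !in_itv/= => /andP[y0 y1] /andP[z0 z1] e.
  apply/le_anti/andP; split; rewrite leNgt; apply/negP => lt.
    by have := Fp_expansive p1 z0 (ltW lt) y1; rewrite e; lra.
  by have := Fp_expansive p1 y0 (ltW lt) z1; rewrite e; lra.
by move=> x01; apply: (pinvKV (fun=> 0) Finj); rewrite inE/= in_itv.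
Qed.

Let SP y : 0 <= y <= c -> exists2 x, 0 <= x <= 1 & y = Fp p x.
Proof.
move=> yc; have := @IVT _ (Fp p) 0 1 y ler01 (within_continuous_Fp p1).
rewrite Fp0 -/c min_l ?max_r; [|have := c1; lra..].
by case=> // x x01 <-; exists x => //; rewrite in_itv in x01.
Qed.

Let S_lip x y : 0 <= x <= c -> 0 <= y <= c -> `|S x - S y| <= `|x - y|.
Proof.
move=> /SP[u u01 ->] /SP[v v01 ->]; rewrite !FpK//.
wlog uv : u v u01 v01 / u <= v => [h|].
  have [uv|/ltW vu] := leP u v; first exact: h.
  by rewrite distrC [X in _ <= X]distrC; exact: h.
case/andP: u01 => u0 _; case/andP: v01 => _ v1.
have h := Fp_expansive p1 u0 uv v1.
by rewrite ler0_norm ?subr_le0// ler0_norm; lra.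
Qed.

Let S_ge_chord y : 0 <= y <= c -> y / c <= S y <= 1.
Proof.
move=> /SP[x x01 ->]; rewrite FpK//; case/andP: (x01) => _ ->; rewrite andbT.
by rewrite ler_pdivrMr ?(lt_le_trans _ c1)// Fp_le_chord.
Qed.

Let S_in y : 0 < y < c -> 0 < S y < 1 /\ Fp p (S y) = y.
Proof.
move=> yc; have [|x x01 yE] := @SP y; first lra.
rewrite yE FpK//; split=> //; move: yc; rewrite yE => /andP[h1 h2].
case/andP: x01 => x0 x1; rewrite !lt_neqAle x0 x1 !andbT.
apply/andP; split; apply/eqP => E; first by move: h1; rewrite -E Fp0 ltxx.
by move: h2; rewrite E ltxx.
Qed.

Let is_derive_S y : 0 < y < c ->
  is_derive y 1 S ((1 - S y `^ p) `^ p^-1).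
Proof.
move=> /S_in[/andP[x0 x1] <-]; move: x0 x1; move: (S y) => x x0 x1.
have xp : 0 < 1 - x `^ p.
  rewrite subr_gt0 -[ltRHS](_ : 1 `^ p = 1); last by rewrite powR1.
  by rewrite gt0_ltr_powR ?nnegrE ?ltW.
have near01 : \forall z \near x, 0 < z < 1.
  have x01 : x \in `]0, 1[ by rewrite in_itv/= x0.
  by near=> z; near: z; apply: filterS (near_in_itvoo x01) => z; rewrite in_itv.
rewrite FpK; last by rewrite !ltW.
have -> : (1 - x `^ p) `^ p^-1 = ((1 - x `^ p) `^ (- p^-1))^-1.
  by rewrite powRN invrK.
apply: is_derive_inverse.
- by apply: filterS near01 => z /andP[z0 z1]; rewrite FpK// !ltW.
- apply: filterS near01 => z z01.
  exact: is_derive_continuous (is_derive_Fp p1 z01).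
- by apply: is_derive_Fp => //; rewrite x0.
- by rewrite gt_eqF// powR_gt0.
Unshelve. all: by end_near. Qed.

(* The argument of [S] is [t] truncated to [[0, c]]. *)
Definition sinp_clamp t : R := S ((`|t| + c - `|t - c|) / 2).

Let clampP t : 0 <= (`|t| + c - `|t - c|) / 2 <= c.
Proof.
have hc := c1; have [t0|t0] := leP 0 t.
  rewrite (ger0_norm t0); have [tc|tc] := leP 0 (t - c).
    by rewrite ger0_norm//; lra.
  by rewrite ltr0_norm//; lra.
by rewrite (ltr0_norm t0) ltr0_norm; lra.
Qed.

Let clampE t : 0 <= t <= c -> (`|t| + c - `|t - c|) / 2 = t.
Proof. by move=> /andP[t0 tc]; rewrite ger0_norm// ler0_norm; lra. Qed.

Lemma sinp_clampE t : 0 <= t <= c -> sinp_clamp t = S t.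
Proof. by move=> tc; rewrite /sinp_clamp clampE. Qed.

Lemma sinp_clamp_bound t : 0 <= sinp_clamp t <= 1.
Proof.
have /andP[h ->] := S_ge_chord (clampP t); rewrite andbT; apply: le_trans h.
by rewrite divr_ge0 ?(le_trans ler01 c1)//; case/andP: (clampP t).
Qed.

Lemma sinp_clamp_chord t : 0 <= t <= c -> t / c <= sinp_clamp t.
Proof. by move=> tc; rewrite sinp_clampE//; case/andP: (S_ge_chord tc). Qed.

Lemma sinp_clamp_le0 t : t <= 0 -> sinp_clamp t = 0.
Proof.
move=> t0; rewrite /sinp_clamp (_ : _ / 2 = 0).
  have /FpK : 0 <= (0 : R) <= 1 by rewrite lexx ler01.
  by rewrite Fp0.
have hc := c1; rewrite ler0_norm// ler0_norm; lra.
Qed.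

Lemma sinp_clamp_ge t : c <= t -> sinp_clamp t = 1.
Proof.
move=> tc; have hc := c1; rewrite /sinp_clamp (_ : _ / 2 = c).
  by rewrite FpK// lexx ler01.
by rewrite ger0_norm ?ger0_norm; lra.
Qed.

Lemma continuous_sinp_clamp : continuous sinp_clamp.
Proof.
have cl : continuous (fun t : R => (`|t| + c - `|t - c|) / 2).
  apply: continuous_funM; last exact: continuous_fun_cst.
  apply: continuous_funB.
    apply: continuous_funD; [exact: norm_continuous|exact: continuous_fun_cst].
  apply: continuous_fun_norm; apply: continuous_funB; last exact: continuous_fun_cst.
  by move=> t; exact: cvg_id.
move=> t; apply/cvgrPdist_lt => e e0; near=> z.
apply: le_lt_trans (S_lip (clampP t) (clampP z)) _.
by near: z; move: (cl t) => /cvgrPdist_lt; exact.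
Unshelve. all: by end_near. Qed.

Lemma near_between (a b x : R) : a < x < b -> \forall z \near x, a < z < b.
Proof.
move=> xab; have x01 : x \in `]a, b[ by rewrite in_itv.
by apply: filterS (near_in_itvoo x01) => z; rewrite in_itv.
Qed.

Lemma near_is_derive (f g : R -> R) x a : {near x, f =1 g} ->
  is_derive x 1 f a -> is_derive x 1 g a.
Proof. by move=> fg [df <-]; apply: DeriveDef; [exact: near_eq_derivable df|rewrite (near_eq_derive _ fg)]. Qed.

(** The identity sin_p^p + cos_p^p = 1 solved for cos_p. Clamping extends it continuously by 1 to
    the left of 0 and by 0 to the right of [c]. *)
Definition cosp_clamp t : R := (1 - sinp_clamp t `^ p) `^ p^-1.

Let sinp_clamp_powR t : 0 <= sinp_clamp t `^ p <= 1.
Proof.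
rewrite powR_ge0/= -[X in _ <= X](_ : 1 `^ p = 1); last by rewrite powR1.
have /andP[h0 h1] := sinp_clamp_bound t.
by rewrite ge0_ler_powR ?nnegrE ?(ltW p0).
Qed.

Lemma cosp_clamp_le0 t : t <= 0 -> cosp_clamp t = 1.
Proof.
move=> t0; rewrite /cosp_clamp sinp_clamp_le0// powR0 ?(gt_eqF p0)//.
by rewrite subr0 powR1.
Qed.

Lemma cosp_clamp_ge t : c <= t -> cosp_clamp t = 0.
Proof.
move=> tc; rewrite /cosp_clamp sinp_clamp_ge// powR1 subrr powR0//.
by rewrite (gt_eqF pV0).
Qed.

Lemma cosp_clamp_gt0 t : 0 < t < c -> 0 < cosp_clamp t.
Proof.
move=> tc; have [/andP[s0 s1] _] := S_in tc.
have tc' : 0 <= t <= c by lra.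
rewrite powR_gt0// sinp_clampE// subr_gt0 -[X in _ < X](_ : 1 `^ p = 1); last by rewrite powR1.
by rewrite gt0_ltr_powR ?nnegrE ?ltW.
Qed.

Lemma sinp_clamp_gt0 t : 0 < t < c -> 0 < sinp_clamp t.
Proof.
move=> tc; have [/andP[s0 s1] _] := S_in tc.
by rewrite sinp_clampE//; lra.
Qed.

Lemma continuous_cosp_clamp : continuous cosp_clamp.
Proof.
apply: continuous_ge0_powR => // [|t]; last by rewrite subr_ge0; case/andP: (sinp_clamp_powR t).
apply: continuous_funB; first exact: continuous_fun_cst.
apply: continuous_ge0_powR => //; first exact: continuous_sinp_clamp.
by move=> t; case/andP: (sinp_clamp_bound t).
Qed.

Lemma is_derive_sinp_clamp t : 0 < t < c -> is_derive t 1 sinp_clamp (cosp_clamp t).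
Proof.
move=> tc; rewrite /cosp_clamp sinp_clampE; last lra.
apply: near_is_derive (is_derive_S tc).
by apply: filterS (near_between tc) => z zc; rewrite sinp_clampE//; lra.
Qed.

Lemma cosp_clampX t : cosp_clamp t `^ p = 1 - sinp_clamp t `^ p.
Proof.
have /andP[_ h] := sinp_clamp_powR t.
by rewrite -powRrM mulVf ?gt_eqF// powRr1 ?subr_ge0.
Qed.

Lemma is_derive_cosp_clamp t : 0 < t < c -> is_derive t 1 cosp_clamp
  (- (sinp_clamp t `^ (p - 1) * cosp_clamp t `^ (2 - p))).
Proof.
move=> tc; have C0 := cosp_clamp_gt0 tc; have S0 := sinp_clamp_gt0 tc.
have u0 : 0 < 1 - sinp_clamp t `^ p by rewrite -cosp_clampX powR_gt0.
apply: is_derive_val (is_derive_fun_powR p^-1 (is_derive_funB (is_derive_cst _ _ _)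
  (is_derive_fun_powR p (is_derive_sinp_clamp tc) S0)) u0) _.
(* Here (C^p)^(1/p - 1) = C^(1-p), and the factor C = S' raises the exponent to 2 - p. *)
rewrite -cosp_clampX -powRrM.
have -> : p * (p^-1 - 1) = 1 - p by rewrite mulrBr divff ?gt_eqF// mulr1.
have -> : 2 - p = 1 - p + 1 by lra.
rewrite [_ `^ (_ + 1)]powRD; last by rewrite (gt_eqF C0) implybT.
rewrite powRr1 ?(ltW C0)//; field.
by rewrite gt_eqF.
Qed.

End QuarterSine.

(** * sin_p and cos_p on the whole line *)

Section GlobalCosine.
Context {R : realType}.
Variable p : R.
Hypothesis p1 : 1 < p.
Implicit Types x y t : R.

Let c := Fp p 1.
Let pipE : pip p = 2 * c. Proof. by []. Qed.
Let c0 : 0 < c. Proof. by have := pip_ge2 p1; rewrite pipE; lra. Qed.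
Let pi0 : 0 < pip p. Proof. by rewrite pipE mulr_gt0. Qed.
Let pip2E : pip p / 2 = c. Proof. by rewrite pipE; field. Qed.

(** A formula for cos_p on [-pi_p, pi_p]: the first term vanishes for |x| >= c, the second for |x|
    <= c. *)
Let h x := cosp_clamp p `|x| - cosp_clamp p (2 * c - `|x|).

Let h_cont : continuous h.
Proof.
apply: continuous_funB; apply: continuous_fun_comp; try exact: continuous_cosp_clamp.
  exact: norm_continuous.
apply: continuous_funB; [exact: continuous_fun_cst|exact: norm_continuous].
Qed.

Let h_even x : h (- x) = h x. Proof. by rewrite /h normrN. Qed.

Let h_quarter x : 0 <= x <= c -> h x = cosp_clamp p x.
Proof.
move=> /andP[x0 xc]; rewrite /h ger0_norm//.
by rewrite [X in _ - X](cosp_clamp_ge p1) ?subr0// -/c; lra.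
Qed.

Let h_reflect x : 0 <= x <= 2 * c -> h (2 * c - x) = - h x.
Proof.
move=> /andP[x0 xc]; rewrite /h !ger0_norm ?subr_ge0//.
by rewrite (_ : 2 * c - (2 * c - x) = x) ?opprB//; lra.
Qed.

Let sinpD x : sinp p (x + pip p) = - sinp p x.
Proof.
rewrite -sinpN//; have := sinp_reflect (x + pip p / 2) pi0.
have -> : pip p / 2 + (x + pip p / 2) = x + pip p by field.
by move=> <-; congr sinp; ring.
Qed.

Let sinp_quarter_clamp x : 0 <= x <= c -> sinp p x = sinp_clamp p x.
Proof.
move=> /andP[]; rewrite le_eqVlt => /predU1P[<- _|x0 xc].
  rewrite (sinp_clamp_le0 p1)//; have := sinpN 0 pi0; rewrite oppr0; lra.
by rewrite sinp_clampE ?(ltW x0)//= sinp_quarterE// x0 pip2E.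
Qed.

Let is_derive_eq (f g : R -> R) x d : f =1 g ->
  is_derive x 1 f d -> is_derive x 1 g d.
Proof. by move=> /funext ->. Qed.

Let is_derive_shift (f : R -> R) a x d :
  is_derive (x + a) 1 f d -> is_derive x 1 (fun t => f (t + a)) d.
Proof.
move=> fd.
have a1 : is_derive x 1 (fun t : R => t + a) (1 + 0).
  exact: is_derive_funD (is_derive_id _ _) (is_derive_cst _ _ _).
apply: is_derive_val (@is_derive_fun_comp _ f (fun t => t + a) x _ _ fd a1) _.
by rewrite addr0 mulr1.
Qed.

(** An antiderivative [H] of the continuous function [h] is identified with sin_p, up to a constant,
    piece by piece through their common symmetries. This settles differentiability at the points
    where the pieces of sin_p meet. *)
Let sinp_is_derive x : `|x| < 2 * c -> is_derive x 1 (sinp p) (h x).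
Proof.
have [|H dH] := @is_derive_antiderivative _ h (- (3 * c)) (3 * c) h_cont.
  by have := c0; lra.
have dHN t : - (3 * c) < t < 3 * c -> is_derive t 1 (fun u => H (- u)) (- h t).
  move=> tc; have d1 : is_derive (- t) 1 H (h (- t)) by apply: dH; lra.
  apply: is_derive_val (@is_derive_fun_comp _ H (fun u => - u) t _ _ d1
    (is_derive_funN (is_derive_id _ _))) _.
  by rewrite h_even mulrN1.
have HN y : 0 <= y <= 2 * c -> H y + H (- y) = H 0 + H 0.
  move=> /andP[y0 yc].
  rewrite -[X in _ = X](_ : H 0 + H (- 0) = _); last by rewrite oppr0.
  apply/esym/(@is_derive0_eq_cc _ (fun t => H t + H (- t)) 0 y y0) => t /andP[t0 ty].
  have tc : - (3 * c) < t < 3 * c by have := c0; lra.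
  by apply: is_derive_val (is_derive_funD (dH t tc) (dHN t tc)) _; rewrite subrr.
have HR y : c <= y <= 2 * c -> H y = H (2 * c - y).
  move=> /andP[yc y2c]; have hc := c0.
  suff : H c - H (2 * c - c) = H y - H (2 * c - y).
    rewrite (_ : 2 * c - c = c); last lra.
    lra.
  apply: (@is_derive0_eq_cc _ (fun t => H t - H (2 * c - t)) c y yc) => t /andP[ct ty].
  have d1 : is_derive (2 * c - t) 1 H (h (2 * c - t)) by apply: dH; lra.
  have d2 : is_derive t 1 (fun u : R => 2 * c - u) (0 - 1).
    exact: is_derive_funB (is_derive_cst _ _ _) (is_derive_id _ _).
  apply: is_derive_val (is_derive_funB (dH t _)
    (@is_derive_fun_comp _ H (fun u => 2 * c - u) t _ _ d1 d2)) _; first lra.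
  by rewrite h_reflect; lra.
have HS y : 0 <= y <= c -> sinp_clamp p y = H y - H 0.
  move=> /andP[y0 yc]; have hc := c0.
  have cH t : 0 <= t <= y -> {for t, continuous H}.
    by move=> ty; apply: is_derive_continuous (dH t _); lra.
  suff : sinp_clamp p 0 - H 0 = sinp_clamp p y - H y.
    by rewrite (sinp_clamp_le0 p1)//; lra.
  apply: (@is_derive0_eq _ (fun t => sinp_clamp p t - H t) 0 y y0).
    apply: continuous_in_subspaceT => t; rewrite inE/= in_itv/= => ty.
    apply: cvgB; [exact: continuous_sinp_clamp|exact: cH].
  move=> t /andP[t0 ty].
  have d1 : is_derive t 1 (sinp_clamp p) (cosp_clamp p t).
    by apply: is_derive_sinp_clamp => //; rewrite -/c; lra.
  apply: is_derive_val (is_derive_funB d1 (dH t _)) _; first lra.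
  by rewrite h_quarter ?subrr//; lra.
have HE y : 0 <= y <= 2 * c -> sinp p y = H y - H 0.
  move=> /andP[y0 y2c]; have [yc|/ltW cy] := leP y c.
    by rewrite sinp_quarter_clamp ?y0// HS ?y0.
  have hc := c0.
  rewrite HR ?cy// -HS; last lra.
  rewrite -sinp_quarter_clamp; last lra.
  have := sinp_reflect (y - c) pi0; rewrite pip2E.
  by rewrite (_ : c - (y - c) = 2 * c - y) 1?(_ : c + (y - c) = y)//; lra.
have HE' y : - (2 * c) < y < 2 * c -> H y - H 0 = sinp p y.
  move=> yc; have [y0|/ltW y0] := leP 0 y; first by rewrite HE//; lra.
  have := sinpN (- y) pi0; rewrite opprK => ->.
  have := HN (- y); rewrite opprK HE; lra.
rewrite ltr_norml => xc; have hc := c0.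
apply: near_is_derive (is_derive_val (is_derive_funB (dH x _) (is_derive_cst (H 0 : R) x 1)) (subr0 _)); last lra.
by apply: filterS (near_between xc) => z /HE'.
Qed.

(** Every real number is reached from ]-pi_p, pi_p[ by finitely many steps of length pi_p. *)
Let shift_ind (P : R -> Prop) : (forall x, `|x| < 2 * c -> P x) ->
  (forall x, P x -> P (x + pip p)) -> (forall x, P x -> P (x - pip p)) ->
  forall x, P x.
Proof.
move=> P0 Pr Pl.
have hc := c0.
have Pn (n : nat) : forall x, `|x| < 2 * c * n.+1%:R -> P x.
  elim: n => [|n]; first by rewrite mulr1; exact: P0.
  rewrite -[n.+2%:R]natr1; have : 1 <= n.+1%:R :> R by rewrite ler1n.
  move: n.+1%:R => m m1 IH x.
  rewrite mulrDr mulr1 ltr_norml => /andP[x1 x2].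
  have n1 : 2 * c <= 2 * c * m by rewrite -[X in X <= _]mulr1 ler_pM2l//; lra.
  have [|xc] := ltP `|x| (2 * c); first exact: P0.
  have [x0|x0] := leP 0 x.
    rewrite (ger0_norm x0) in xc.
    rewrite -(subrK (pip p) x); apply/Pr/IH.
    by rewrite ltr_norml pipE; lra.
  rewrite (ltr0_norm x0) in xc.
  rewrite -(addrK (pip p) x); apply/Pl/IH.
  by rewrite ltr_norml pipE; lra.
move=> x; pose k := Num.bound (`|x| / (2 * c)).
apply: (Pn k); rewrite mulrC -ltr_pdivrMr; last lra.
have : 0 <= `|x| / (2 * c) by rewrite divr_ge0//; lra.
move=> /archi_boundP hk; apply: lt_le_trans hk _.
by rewrite ler_nat.
Qed.

Let sinp_is_derive_all x : is_derive x 1 (sinp p) (cosp p x).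
Proof.
suff [d dE] : exists d, is_derive x 1 (sinp p) d.
  by rewrite /cosp (is_derive_derive1 dE).
move: x; apply: shift_ind => [x /sinp_is_derive xd|x [d xd]|x [d xd]].
- by exists (h x).
- exists (- d); have d1 : is_derive (x + pip p - pip p) 1 (sinp p) d by rewrite addrK.
  apply: is_derive_eq (is_derive_funN (is_derive_shift d1)) => z.
  by rewrite -sinpD subrK.
- exists (- d); have d1 : is_derive (x - pip p + pip p) 1 (sinp p) d by rewrite subrK.
  apply: is_derive_eq (is_derive_funN (is_derive_shift d1)) => z.
  by rewrite sinpD opprK.
Qed.

Lemma is_derive_sinp x : is_derive x 1 (sinp p) (cosp p x).
Proof. exact: sinp_is_derive_all. Qed.

Lemma cospD_pip x : cosp p (x + pip p) = - cosp p x.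
Proof.
have d1 := is_derive_shift (sinp_is_derive_all (x + pip p)).
have d2 : is_derive x 1 (fun t => sinp p (t + pip p)) (- cosp p x).
  apply: is_derive_eq (is_derive_funN (sinp_is_derive_all x)) => z.
  by rewrite sinpD.
by rewrite -(is_derive_derive1 d1) (is_derive_derive1 d2).
Qed.

Lemma cospN x : cosp p (- x) = cosp p x.
Proof.
have d1 := @is_derive_fun_comp _ (sinp p) (fun u => - u) x _ _
  (sinp_is_derive_all (- x)) (is_derive_funN (is_derive_id _ _)).
have d2 : is_derive x 1 (fun t => sinp p (- t)) (- cosp p x).
  apply: is_derive_eq (is_derive_funN (sinp_is_derive_all x)) => z.
  by rewrite sinpN.
have := is_derive_derive1 d1; rewrite (is_derive_derive1 d2); lra.
Qed.

Let cosp_h x : `|x| < 2 * c -> cosp p x = h x.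
Proof. by move=> /sinp_is_derive xd; rewrite /cosp (is_derive_derive1 xd). Qed.

Lemma cosp_quarter x : 0 <= x <= Fp p 1 -> cosp p x = cosp_clamp p x.
Proof.
move=> xc; rewrite cosp_h ?h_quarter//.
by move: xc; rewrite -/c => /andP[x0 xc]; have hc := c0; rewrite ger0_norm//; lra.
Qed.

Let continuous_shiftN (f : R -> R) a x : {for x + a, continuous f} ->
  {for x, continuous (fun t => - f (t + a))}.
Proof.
move=> cf; apply: cvgN; apply: (@continuous_comp _ _ _ (fun t : R => t + a) f) => //.
by apply: cvgD; [exact: cvg_id|exact: cvg_cst].
Qed.

Lemma continuous_cosp : continuous (cosp p).
Proof.
apply: shift_ind => x.
- rewrite ltr_norml => xc; rewrite /continuous_at cosp_h ?ltr_norml//.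
  have : {for x, continuous h} by exact: h_cont.
  rewrite /continuous_at; apply: cvg_trans; apply: near_eq_cvg.
  by apply: filterS (near_between xc) => z zc; rewrite cosp_h ?ltr_norml.
- move=> cx.
  have -> : cosp p = (fun t => - cosp p (t + - pip p)).
    by apply/funext => t; rewrite -cospD_pip subrK.
  by apply: continuous_shiftN; rewrite addrK.
- move=> cx.
  have -> : cosp p = (fun t => - cosp p (t + pip p)).
    by apply/funext => t; rewrite cospD_pip opprK.
  by apply: continuous_shiftN; rewrite subrK.
Qed.

End GlobalCosine.

(** * Cosine coefficients of antisymmetric functions *)

Section HalfIntegral.
Context {R : realType}.
Implicit Types (h g s : R -> R) (x : R).

Lemma int01_antiderivative h : continuous h -> exists H,
  (forall x, -1 < x < 2 -> is_derive x 1 H (h x)) /\ int01 h = H 1 - H 0.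
Proof.
move=> ch; have [|H dH] := @is_derive_antiderivative _ h (-1) 2 ch; first lra.
exists H; split=> //; rewrite /int01 /Rintegral (@continuous_FTC2 _ h H)//.
- exact: continuous_fun_within.
- split=> [x| |].
  + by rewrite in_itv/= => x01; case: (dH x _) => //; lra.
  + by apply: cvg_at_right_filter; apply: is_derive_continuous (dH 0 _); lra.
  + by apply: cvg_at_left_filter; apply: is_derive_continuous (dH 1 _); lra.
- move=> x; rewrite in_itv/= => x01; apply: is_derive_derive1; apply: dH; lra.
Qed.

Let is_derive_reflect (H : R -> R) x d : is_derive (1 - x) 1 H d ->
  is_derive x 1 (fun t => H (1 - t)) (- d).
Proof.
move=> dH.
have d2 : is_derive x 1 (fun u : R => 1 - u) (0 - 1).
  exact: is_derive_funB (is_derive_cst _ _ _) (is_derive_id _ _).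
apply: is_derive_val (@is_derive_fun_comp _ H (fun u => 1 - u) x _ _ dH d2) _.
by rewrite sub0r mulrN1.
Qed.

(** [H 2^-1 - H 0] stands for the integral over the first half, in a form suited to monotonicity
    arguments. *)
Lemma int01_reflect h : continuous h -> (forall x, h (1 - x) = h x) -> exists H,
  (forall x, -1 < x < 2 -> is_derive x 1 H (h x)) /\
  int01 h = 2 * (H 2^-1 - H 0).
Proof.
move=> ch hE; have [H [dH ->]] := int01_antiderivative ch.
exists H; split=> //.
suff : H 0 + H (1 - 0) = H 2^-1 + H (1 - 2^-1).
  by rewrite subr0 (_ : 1 - 2^-1 = 2^-1); lra.
apply: (@is_derive0_eq_cc _ (fun t => H t + H (1 - t))) => [|x x01]; first lra.
have d1 : is_derive (1 - x) 1 H (h (1 - x)) by apply: dH; lra.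
apply: is_derive_val (is_derive_funD (dH x _) (is_derive_reflect d1)) _; first lra.
by rewrite hE subrr.
Qed.

Lemma int01_antireflect h : continuous h -> (forall x, h (1 - x) = - h x) ->
  int01 h = 0.
Proof.
move=> ch hE; have [H [dH ->]] := int01_antiderivative ch.
have : H (1 - 0) - H 0 = H (1 - 2^-1) - H 2^-1.
  apply: (@is_derive0_eq_cc _ (fun t => H (1 - t) - H t)) => [|x x01]; first lra.
  have d1 : is_derive (1 - x) 1 H (h (1 - x)) by apply: dH; lra.
  apply: is_derive_val (is_derive_funB (is_derive_reflect d1) (dH x _)) _; first lra.
  by rewrite hE opprK subrr.
by rewrite subr0 (_ : 1 - 2^-1 = 2^-1); lra.
Qed.

Lemma cosn_reflect n x : cosn n (1 - x) = (-1) ^+ n * cosn n x :> R.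
Proof.
by rewrite /cosn mulrBr mulr1 cosB cos_natpi sin_natpi mul0r addr0.
Qed.

Lemma sin_reflect n x : odd n ->
  sin (n%:R * pi * (1 - x)) = sin (n%:R * pi * x) :> R.
Proof.
move=> on; rewrite mulrBr mulr1 sinB cos_natpi sin_natpi mul0r sub0r.
by rewrite -signr_odd on mulN1r opprK.
Qed.

Lemma continuous_sin_dilation (a : R) : continuous (fun x => sin (a * x)).
Proof.
apply: continuous_fun_comp; first exact: continuous_sin.
by apply: continuous_funM; [exact: continuous_fun_cst|move=> t; exact: cvg_id].
Qed.

Lemma int01_sinM n m :
  int01 (fun x : R => sin (n%:R * pi * x) * sin (m%:R * pi * x)) =
  2^-1 * ((n == m)%:R - (n + m == 0)%N%:R).
Proof.
rewrite (_ : (fun _ => _) =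
    (fun x => cosn ((n - m) + (m - n)) x - cosn n x * cosn m x)).
  rewrite int01B; [|exact: continuous_cosn|].
    rewrite int01_cosn int01_cosnM.
    have -> : ((n - m + (m - n)) == 0)%N = (n == m).
      by rewrite addn_eq0 !subn_eq0 -eqn_leq.
    by field.
  by apply: continuous_funM; exact: continuous_cosn.
apply/funext => x; rewrite cosnM.
have -> : cosn (n - m + (m - n)) x = cos ((n%:R - m%:R) * pi * x) :> R.
  rewrite /cosn; have [mn|/ltnW nm] := leqP m n.
    by rewrite (eqP mn) addn0 natrB.
  by rewrite (eqP nm) add0n natrB// -cosN; congr cos; ring.
by rewrite /cosn natrD !mulrDl mulNr mulNr cosB cosD; field.
Qed.

End HalfIntegral.

Section CoefficientBounds.
Context {R : realType}.
Variable g : R -> R.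
Hypothesis g_cont : continuous g.
Hypothesis g_reflect : forall x, g (1 - x) = - g x.

Let a j := cos_coeff j g.

Let a_int j : int01 (fun x => g x * cosn j x) = (if j == 0%N then 1 else 2^-1) * a j.
Proof.
rewrite /a cos_coeff_continuous//.
case: eqP => _; rewrite ?mul1r//.
by rewrite mulrA mulVf ?mul1r.
Qed.

Let gcos_cont j : continuous (fun x => g x * cosn j x).
Proof. by apply: continuous_funM => //; exact: continuous_cosn. Qed.

Lemma cos_coeff_even j : ~~ odd j -> cos_coeff j g = 0.
Proof.
move=> oj; rewrite cos_coeff_continuous// int01_antireflect ?mulr0// => x.
by rewrite g_reflect cosn_reflect -signr_odd (negbTE oj) mul1r mulNr.
Qed.

Let gcos_reflect j x : odd j -> g (1 - x) * cosn j (1 - x) = g x * cosn j x.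
Proof.
by move=> oj; rewrite g_reflect cosn_reflect -signr_odd oj mulN1r mulrNN.
Qed.

(** Integration by parts on [0, 1/2] gives a_1 = (4 pi / k) int s(x) sin(pi x) dx; the minorant 2 x
    of s then yields 8 / (pi k). *)
Lemma first_cos_coeff_ge (s : R -> R) (k : R) : 0 < k ->
  (forall x : R, is_derive x 1 s (k * g x)) -> s 0 = 0 ->
  (forall x, 0 <= x <= 2^-1 -> 2 * x <= s x) ->
  8 / (pi * k) <= cos_coeff 1 g.
Proof.
move=> k0 ds s0 s_ge.
have [H [dH HE]] := @int01_reflect R _ (@gcos_cont 1%N) (fun x => @gcos_reflect 1%N x isT).
have pi0 : 0 < pi :> R := pi_gt0 R.
have pin : pi != 0 :> R by rewrite gt_eqF.
have kn : k != 0 by rewrite gt_eqF.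
(* An antiderivative of (pi / k) sin(pi x) (s(x) - 2 x); its terms in s vanish at both ends because
   s(0) = 0 and cos(pi / 2) = 0. *)
pose T x := H x - k^-1 * (s x * cos (pi * x)) -
  2 / k * (pi^-1 * sin (pi * x) - x * cos (pi * x)).
have dpi (x : R) : is_derive x 1 (fun t : R => pi * t) (pi * 1).
  exact: is_derive_funZ (is_derive_id _ _).
have dc x := @is_derive_fun_comp _ cos (fun t : R => pi * t) x _ _ (is_derive_cos _) (dpi x).
have dsn x := @is_derive_fun_comp _ sin (fun t : R => pi * t) x _ _ (is_derive_sin _) (dpi x).
have : T 0 <= T 2^-1.
  have dT (x : R) : 0 <= x <= 2^-1 ->
      is_derive x 1 T (pi / k * sin (pi * x) * (s x - 2 * x)).
    move=> x01.
    apply: is_derive_val (is_derive_funB (is_derive_funB (dH x _)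
      (is_derive_funZ _ (is_derive_funM (ds x) (dc x))))
      (is_derive_funZ _ (is_derive_funB (is_derive_funZ _ (dsn x))
      (is_derive_funM (is_derive_id _ _) (dc x))))) _; first lra.
    have -> : cosn 1 x = cos (pi * x) by rewrite /cosn mul1r.
    move: (cos (pi * x)) (sin (pi * x)) => u v; move: (pi : R) pin => P Pn; field.
    by rewrite kn Pn.
  apply: (@ge0_is_derive_le _ T (fun x : R => pi / k * sin (pi * x) * (s x - 2 * x)) 0 2^-1 _).
  - lra.
  - apply: continuous_in_subspaceT => x; rewrite inE/= in_itv/= => xI.
    exact: is_derive_continuous (dT x xI).
  - by move=> x xI; apply: dT; lra.
  - move=> x xI; apply: mulr_ge0; last by rewrite subr_ge0 s_ge//; lra.
    apply: mulr_ge0; first by rewrite divr_ge0 ?(ltW k0) ?(ltW pi0).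
    by apply: sin_ge0_pi; nra.
rewrite /T s0 !mulr0 sin0 ?(mulr0, mul0r, subr0).
rewrite cos_pihalf sin_pihalf ?(mulr0, mulr1, subr0).
rewrite cos_coeff_continuous//= HE => h.
rewrite (_ : 8 / (pi * k) = 4 * (2 / k * pi^-1)); last first.
  by move: (pi : R) pin => P Pn; field; rewrite kn Pn.
lra.
Qed.


(** The energy enters through [A], continuous up to the ends, whose derivative majorizes g'^2: this
    accommodates a g' that is unbounded at 1/2. The boundary terms of the integration by parts
    vanish, as Q(0) = 0 and g(1/2) = 0. *)
Lemma coeff_energy_le (A A' g' : R -> R) (B : R) (q : nat -> R) (J : nat) :
  {within `[0, 2^-1], continuous A} ->
  (forall x : R, 0 < x < 2^-1 -> is_derive x 1 A (A' x)) ->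
  (forall x : R, 0 < x < 2^-1 -> is_derive x 1 g (g' x)) ->
  (forall x, 0 < x < 2^-1 -> g' x ^+ 2 <= A' x) -> A 2^-1 - A 0 <= B ->
  (forall j, ~~ odd j -> q j = 0) ->
  pi / 2 * \sum_(0 <= j < J) j%:R * q j * cos_coeff j g <=
  B + 4^-1 * \sum_(0 <= j < J) q j ^+ 2.
Proof.
move=> cA dA dg gA AB q_even.
pose Q x := \sum_(0 <= j < J) q j * sin (j%:R * pi * x).
pose Qd x := \sum_(0 <= j < J) q j * (j%:R * pi) * cosn j x.
have cQ : continuous Q.
  apply: continuous_fun_sum => j; apply: continuous_funM; first exact: continuous_fun_cst.
  exact: continuous_sin_dilation.
have cQd : continuous Qd.
  apply: continuous_fun_sum => j; apply: continuous_funM; first exact: continuous_fun_cst.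
  exact: continuous_cosn.
have dQ (x : R) : is_derive x 1 Q (Qd x).
  apply: is_derive_fun_sum => j.
  apply: is_derive_val (is_derive_funZ _ (@is_derive_fun_comp _ sin _ x _ _
    (is_derive_sin _) (is_derive_funZ _ (is_derive_id _ _)))) _.
  by rewrite /cosn; ring.
have QE x : Q (1 - x) = Q x.
  apply: eq_bigr => j _; have [oj|/q_even ->] := boolP (odd j); last by rewrite !mul0r.
  by rewrite sin_reflect.
have gQdE x : g (1 - x) * Qd (1 - x) = g x * Qd x.
  rewrite !mulr_sumr; apply: eq_bigr => j _.
  have [oj|/q_even ->] := boolP (odd j); last by rewrite !mul0r !mulr0.
  by rewrite mulrCA gcos_reflect// mulrCA.
have cQQ : continuous (fun x => Q x * Q x) by exact: continuous_funM.
have cgQd : continuous (fun x => g x * Qd x) by exact: continuous_funM.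
have [H1 [dH1 H1E]] := @int01_reflect _ _ cQQ (fun x => congr2 *%R (QE x) (QE x)).
have [H2 [dH2 H2E]] := int01_reflect cgQd gQdE.
have Q0 : Q 0 = 0 by rewrite /Q big1// => j _; rewrite mulr0 sin0 mulr0.
have g12 : g 2^-1 = 0.
  by have := g_reflect 2^-1; rewrite (_ : 1 - 2^-1 = 2^-1); lra.
(* Its derivative is (A' - g'^2) + (g' + Q)^2, since [H1] and [H2] are antiderivatives of Q^2 and g
   Q'. *)
pose P x := A x + H1 x + 2 * (g x * Q x) - 2 * H2 x.
have hP : P 0 <= P 2^-1.
  have h20 : 0 <= 2^-1 :> R by rewrite invr_ge0.
  have cH (H h : R -> R) : (forall x : R, -1 < x < 2 -> is_derive x 1 H (h x)) ->
      {within `[0, 2^-1], continuous H}.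
    move=> dH; apply: continuous_in_subspaceT => x; rewrite inE/= in_itv/= => xI.
    by apply: is_derive_continuous (dH x _); lra.
  apply: (@ge0_is_derive_le _ P (fun x : R => A' x + Q x * Q x +
    2 * (g' x * Q x + g x * Qd x) - 2 * (g x * Qd x)) 0 2^-1 h20).
  - apply: (@continuous_funB _ (subspace _)).
      apply: (@continuous_funD _ (subspace _)).
        by apply: (@continuous_funD _ (subspace _)) => //; exact: cH dH1.
      apply: continuous_fun_within; apply: continuous_funM; first exact: continuous_fun_cst.
      exact: continuous_funM.
    apply: (@continuous_funM _ (subspace _)); first exact: continuous_fun_cst.
    exact: cH dH2.
  - move=> x xI; have xI' : -1 < x < 2 by lra.
    apply: is_derive_funB (is_derive_funZ _ (dH2 x xI')).
    apply: is_derive_funD (is_derive_funZ _ (is_derive_funM (dg x xI) (dQ x))).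
    exact: is_derive_funD (dA x xI) (dH1 x xI').
  - move=> x /gA h; have := sqr_ge0 (g' x + Q x); rewrite sqrrD; lra.
have E1 : int01 (fun x => g x * Qd x) =
    pi / 2 * \sum_(0 <= j < J) j%:R * q j * cos_coeff j g.
  rewrite (_ : (fun x => g x * Qd x) = (fun x =>
      \sum_(0 <= j < J) q j * (j%:R * pi) * (g x * cosn j x))); last first.
    by apply/funext => x; rewrite mulr_sumr; apply: eq_bigr => j _; rewrite mulrCA.
  rewrite int01_sum; last first.
    by move=> j; apply: continuous_funM => //; exact: continuous_fun_cst.
  rewrite mulr_sumr; apply: eq_bigr => j _; rewrite int01Z// a_int.
  have [->|j0] := eqVneq j 0%N; first by rewrite !(mul0r, mulr0).
  by rewrite /a; ring.
have E2 : int01 (fun x => Q x * Q x) = 2^-1 * \sum_(0 <= j < J) q j ^+ 2.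
  have c2 i j : continuous (fun x => sin (i%:R * pi * x) * sin (j%:R * pi * x) : R).
    by apply: continuous_funM; exact: continuous_sin_dilation.
  have c3 i j : continuous (fun x => q i * q j * (sin (i%:R * pi * x) * sin (j%:R * pi * x))).
    by apply: continuous_funM => //; exact: continuous_fun_cst.
  rewrite (_ : (fun x => Q x * Q x) = (fun x => \sum_(0 <= i < J) \sum_(0 <= j < J)
      q i * q j * (sin (i%:R * pi * x) * sin (j%:R * pi * x)))); last first.
    apply/funext => x; rewrite mulr_suml; apply: eq_bigr => i _.
    by rewrite mulr_sumr; apply: eq_bigr => j _; rewrite mulrACA.
  rewrite int01_sum; last by move=> i; exact: continuous_fun_sum.
  rewrite mulr_sumr !big_mkord; apply: eq_bigr => i _.
  rewrite int01_sum// big_mkord (bigD1 i)//= int01Z// int01_sinM eqxx.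
  rewrite big1 ?addr0 => [|j ji].
    have [oi|/q_even ->] := boolP (odd i); last by rewrite expr0n !(mul0r, mulr0).
    have -> : (i + i == 0)%N = false by case: (val i) oi.
    by rewrite expr2 subr0 mulr1 mulrC.
  rewrite int01Z// int01_sinM; have -> : (i == j :> nat) = false.
    by apply/negbTE; rewrite eq_sym.
  have [oi|/q_even ->] := boolP (odd i); last by rewrite !mul0r.
  have -> : (i + j == 0)%N = false by case: (val i) oi.
  by rewrite subrr !mulr0.
rewrite -E1 H2E; move: hP; rewrite /P g12 Q0; move: H1E; rewrite E2; lra.
Qed.

End CoefficientBounds.

(** * From the energy inequality to the sum of the coefficients *)

Section TailBound.
Context {R : realType}.

(** Telescoping: for j = 2 m + 1 one has j^2 >= 4 m (m + 1), and 1 / (4 m (m + 1)) = 1 / (4 m) - 1 /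
    (4 (m + 1)); [J./2] is the first m beyond the sum. *)
Lemma sum_odd_invsq_le J : (2 <= J)%N ->
  \sum_(2 <= j < J) (odd j)%:R / j%:R ^+ 2 <= 4^-1 - (4 * (J./2)%:R)^-1 :> R.
Proof.
elim: J => // J IH; rewrite leq_eqVlt => /predU1P[[<-]|].
  by rewrite big_geq// /= mulr1 subrr.
rewrite ltnS => J2; rewrite big_nat_recr//=; apply: le_trans (lerD (IH J2) (lexx _)) _.
rewrite uphalf_half natrD; have [oJ|eJ] := boolP (odd J); last by rewrite mul0r addr0 add0r.
have m0 : 0 < (J./2)%:R :> R by rewrite ltr0n half_gt0.
have -> : J%:R = 1 + 2 * (J./2)%:R :> R.
  by rewrite -[in LHS](odd_double_half J) oJ natrD -muln2 natrM mulrC.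
move: (J./2)%:R m0 => m m0.
have hE : (4 * m)^-1 - (4 * (1 + m))^-1 = (4 * m * (1 + m))^-1.
  by field; rewrite !gt_eqF//; lra.
have hle : ((1 + 2 * m) ^+ 2)^-1 <= (4 * m * (1 + m))^-1.
  rewrite lef_pV2 ?posrE ?exprn_gt0 ?mulr_gt0 ?addr_gt0//.
    by rewrite expr2; lra.
  by rewrite mulr_gt0.
rewrite mul1r; lra.
Qed.

Lemma tail_sum_le (a : nat -> R) (B : R) :
  (forall j, ~~ odd j -> a j = 0) -> 0 < a 1%N ->
  (forall q J, (forall j, ~~ odd j -> q j = 0) ->
    pi / 2 * \sum_(0 <= j < J) j%:R * q j * a j <=
    B + 4^-1 * \sum_(0 <= j < J) q j ^+ 2) ->
  forall J, \sum_(2 <= j < J) `|a j| <= B / (2 * pi ^+ 2 * a 1%N) + 3 / 8 * a 1%N.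
Proof.
move=> a_even a1 hq J; have pi0 : 0 < pi :> R := pi_gt0 R.
have B0 : 0 <= B.
  by have := hq (fun=> 0) 0%N (fun _ _ => erefl); rewrite !big_geq// !mulr0 addr0.
have [J2|J2] := leqP J 2.
  rewrite big_geq//; apply: addr_ge0; last by apply: mulr_ge0; lra.
  by rewrite divr_ge0// mulr_ge0 ?(ltW a1)// mulr_ge0 ?sqr_ge0.
pose t := 4 * pi * a 1%N.
pose q j := if odd j then if j == 1%N then pi * a 1%N else t * Num.sg (a j) / j%:R else 0.
have := hq q J (fun j => ifN _ _).
rewrite big_ltn ?(ltn_trans _ J2)// big_ltn ?(ltn_trans _ J2)//.
rewrite [X in _ + _ * X]big_ltn ?(ltn_trans _ J2)// [X in _ + _ * (_ + X)]big_ltn ?(ltn_trans _ J2)//.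
have -> : q 0%N = 0 by [].
have -> : q 1%N = pi * a 1%N by [].
rewrite !mul0r expr0n/= !add0r mul1r.
have -> : \sum_(2 <= j < J) j%:R * q j * a j = t * \sum_(2 <= j < J) `|a j|.
  rewrite mulr_sumr; apply: eq_big_nat => j /andP[j2 _]; rewrite /q.
  have [oj|/a_even ->] := boolP (odd j); last by rewrite normr0 !mulr0.
  rewrite ifN; last by rewrite gtn_eqF.
  have jn : j%:R != 0 :> R by rewrite pnatr_eq0 -lt0n (ltn_trans _ j2).
  by rewrite [`|a j|]normrEsg; field.
have qs : \sum_(2 <= j < J) q j ^+ 2 <= t ^+ 2 / 4.
  apply: (@le_trans _ _ (t ^+ 2 * \sum_(2 <= j < J) (odd j)%:R / j%:R ^+ 2)).
    rewrite mulr_sumr; apply: ler_sum_nat => j /andP[j2 _]; rewrite /q.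
    have [oj|oj] := boolP (odd j); last by rewrite expr0n/= mul0r mulr0.
    rewrite ifN; last by rewrite gtn_eqF.
    rewrite exprMn exprMn exprVn mul1r; apply: ler_wpM2r.
      by rewrite invr_ge0 sqr_ge0.
    by rewrite ler_piMr ?sqr_ge0// sqr_sg lern1 leq_b1.
  rewrite ler_wpM2l ?sqr_ge0//; apply: le_trans (sum_odd_invsq_le (ltnW J2)) _.
  by rewrite gerBl invr_ge0 mulr_ge0.
set s := \sum_(2 <= j < J) `|a j| => h.
have {}h : 2 * pi ^+ 2 * a 1%N * s <= B + 3 / 4 * (pi ^+ 2 * a 1%N ^+ 2).
  move: h qs; rewrite /t; move: (pi : R) (a 1%N) (\sum_(2 <= j < J) q j ^+ 2) s => P a1' S s' h qs.
  lra.
have d0 : 0 < 2 * pi ^+ 2 * a 1%N by rewrite !mulr_gt0// exprn_gt0.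
have -> : B / (2 * pi ^+ 2 * a 1%N) + 3 / 8 * a 1%N =
    (B + 3 / 4 * (pi ^+ 2 * a 1%N ^+ 2)) / (2 * pi ^+ 2 * a 1%N).
  move: (pi : R) pi0 => P P0; field.
  by rewrite !gt_eqF.
by rewrite ler_pdivlMr// mulrC.
Qed.

End TailBound.

(** * The coefficients of cos_p *)

Section Numerics.
Context {R : realType}.
Implicit Types p c : R.

(** To be used with c = F_p(1): [k] bounds it and [l] bounds the energy factor (p^2 - p + 3) / (3 p
    (3 - p)), leaving the numerical check k^3 l < 10. *)
Let cube_bound p c k l : 0 < p < 3 -> 0 <= c <= k -> k * k * k * l < 10 -> 0 <= l ->
  p ^+ 2 - p + 3 <= l * (3 * p * (3 - p)) ->
  c ^+ 3 * ((3 - p)^-1 - (p - 1) / (3 * p)) < 10.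
Proof.
move=> p03 ck kl l0 pl.
have {}kl : k ^+ 3 * l < 10 by rewrite !exprS expr0 mulr1 mulrA.
apply: le_lt_trans kl.
have -> : (3 - p)^-1 - (p - 1) / (3 * p) = (p ^+ 2 - p + 3) / (3 * p * (3 - p)).
  by field; apply/andP; split; apply/eqP; lra.
case/andP: ck => c0 ck.
apply: ler_pM; first by rewrite exprn_ge0.
- by apply: divr_ge0; nra.
- by rewrite lerXn2r ?nnegrE//; apply: le_trans ck.
- by rewrite ler_pdivrMr//; nra.
Qed.

(** This is B pi_p^2 < 80 divided by 8. The bounds on F_p(1) decrease in p and the energy factor
    increases on this range, so on each subinterval [k] comes from the left end and [l] from the
    right end, rounded up. Near 3/2 the estimate p / (p - 1) is too weak, as 3^3 times 5/9 is 15;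
    [Fp1_le_refined] takes over there. *)
Lemma Fp1_cube_lt p : 149 / 100 <= p <= 221 / 100 ->
  Fp p 1 ^+ 3 * ((3 - p)^-1 - (p - 1) / (3 * p)) < 10.
Proof.
move=> /andP[pl pu]; have p1 : 1 < p by lra.
have p03 : 0 < p < 3 by lra.
have F0 : 0 <= Fp p 1.
  by have := Fp_expansive p1 (lexx 0) ler01 (lexx 1); rewrite Fp0; lra.
have crude k : p <= k * (p - 1) -> 0 <= Fp p 1 <= k.
  move=> h; rewrite F0; apply: le_trans (Fp1_le p1) _.
  by rewrite ler_pdivrMr//; lra.
have refined k k1 k2 : p < 2 -> p <= k1 * (p - 1) -> p <= k2 * (2 * p - 1) ->
    4 / 5 * k1 + 1 / 5 * k2 <= k -> 0 <= Fp p 1 <= k.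
  move=> p2 h1 h2 hk; rewrite F0 /=; apply: le_trans hk.
  apply: le_trans (Fp1_le_refined p1 _) _; first lra.
  have : p / (p - 1) <= k1 by rewrite ler_pdivrMr//; lra.
  have : p / (2 * p - 1) <= k2 by rewrite ler_pdivrMr//; lra.
  lra.
have [p2|p2] := leP 2 p.
  by apply: (@cube_bound p _ 2 (11 / 10)); [|apply: crude|..]; nra.
have [p17|p17] := leP (17 / 10) p.
  apply: (@cube_bound p _ (21 / 10) (5 / 6));
    [|apply: (refined _ (17 / 7) (5 / 7))|..]; nra.
have [p152|p152] := leP (38 / 25) p.
  apply: (@cube_bound p _ (5 / 2) (127 / 200));
    [|apply: (refined _ (117 / 40) (3 / 4))|..]; nra.
apply: (@cube_bound p _ (13 / 5) (113 / 200));
  [|apply: (refined _ (61 / 20) (4 / 5))|..]; nra.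
Qed.

End Numerics.

(** * The first coefficient and the energy of cos_p *)

Section CosineCoefficients.
Context {R : realType}.
Variable p : R.
Hypothesis p1 : 1 < p.
Hypothesis p3 : p < 3.

Let c := Fp p 1.
Let c0 : 0 < c. Proof. by have := pip_ge2 p1; rewrite /pip -/c; lra. Qed.
Let k0 : 0 < pip p. Proof. by rewrite /pip mulr_gt0. Qed.
Let g x := cosp p (pip p * x).

Lemma continuous_cosp_dilation : continuous (fun x => cosp p (pip p * x)).
Proof.
apply: continuous_fun_comp; first exact: continuous_cosp.
by apply: continuous_funM; [exact: continuous_fun_cst|move=> t; exact: cvg_id].
Qed.

Lemma cosp_dilation_reflect x : cosp p (pip p * (1 - x)) = - cosp p (pip p * x).
Proof.
by rewrite mulrBr mulr1 addrC (cospD_pip p1) (cospN p1).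
Qed.

Lemma cosp0 : cosp p 0 = 1.
Proof. by rewrite (cosp_quarter p1) ?cosp_clamp_le0// lexx ltW. Qed.

Lemma first_cosp_coeff_ge : 8 / (pi * pip p) <= cos_coeff 1 g.
Proof.
apply: (@first_cos_coeff_ge _ g continuous_cosp_dilation cosp_dilation_reflect
  (fun x => sinp p (pip p * x))) => //.
- move=> x; apply: is_derive_val (@is_derive_fun_comp _ (sinp p) _ x _ _
    (is_derive_sinp p1 _) (is_derive_funZ _ (is_derive_id _ _))) _.
  by rewrite mulr1 mulrC.
- by rewrite mulr0; have := sinpN 0 k0; rewrite oppr0; lra.
- move=> x /andP[]; rewrite le_eqVlt => /predU1P[<- _|x0 x1].
    by rewrite !mulr0; have := sinpN 0 k0; rewrite oppr0; lra.
  have kx : 0 < pip p * x <= pip p / 2.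
    by rewrite mulr_gt0//= ler_wpM2l// ltW.
  have kc : pip p / 2 = c by rewrite /pip -/c; field.
  rewrite (sinp_quarterE kx); rewrite kc in kx.
  have kx' : 0 <= pip p * x <= c by case/andP: kx => /ltW -> ->.
  rewrite -sinp_clampE//; apply: le_trans (sinp_clamp_chord p1 kx').
  rewrite -/c /pip -/c le_eqVlt; apply/orP; left; apply/eqP; field.
  by rewrite gt_eqF.
Qed.

Let m x := pip p * x.
Let S x := sinp_clamp p (m x).
Let C x := cosp_clamp p (m x).
Let r := (p - 1) / p.
(** As C' = - pi_p S^(p-1) C^(2-p), this integrates pi_p^2 S^(p-1) C^(4-2p) (1 - r C^p). For p < 3
    it stays continuous at 1/2, where g' blows up if p > 2. *)
Let A x := pip p * (r / 3 * C x ^+ 3 - (3 - p)^-1 * C x `^ (3 - p)).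

Let m_in (x : R) : 0 < x < 2^-1 -> 0 < m x < c.
Proof.
move=> /andP[x0 x1]; rewrite /m mulr_gt0//=.
have -> : c = pip p * 2^-1 by rewrite /pip -/c; field.
by rewrite ltr_pM2l.
Qed.

Let dC (x : R) : 0 < x < 2^-1 ->
  is_derive x 1 C (- (S x `^ (p - 1) * C x `^ (2 - p)) * pip p).
Proof.
move=> /m_in xc; have d1 : is_derive x 1 m (pip p * 1).
  exact: is_derive_funZ (is_derive_id _ _).
apply: is_derive_val (@is_derive_fun_comp _ (cosp_clamp p) m x _ _
  (is_derive_cosp_clamp p1 xc) d1) _.
by rewrite mulr1.
Qed.

(* [C^p = 1 - S^p] and concavity of [w^((p-1)/p)] give
   [S^(p-1) <= 1 - (p-1)/p C^p], so that [(g')^2 = pip^2 S^(2p-2) C^(4-2p)] is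
   bounded by a function with an explicit antiderivative. *)
Lemma cosp_coeff_energy_le (q : nat -> R) (J : nat) :
  (forall j, ~~ odd j -> q j = 0) ->
  pi / 2 * \sum_(0 <= j < J) j%:R * q j * cos_coeff j g <=
  pip p * ((3 - p)^-1 - (p - 1) / (3 * p)) + 4^-1 * \sum_(0 <= j < J) q j ^+ 2.
Proof.
have p30 : 0 < 3 - p by rewrite subr_gt0.
have p0 : 0 < p by exact: lt_trans p1.
pose g' x := - (S x `^ (p - 1) * C x `^ (2 - p)) * pip p.
pose A' x := pip p * (r / 3 * (3%:R * C x ^+ 2 * g' x) -
  (3 - p)^-1 * ((3 - p) * C x `^ (3 - p - 1) * g' x)).
have cC : continuous C.
  apply: continuous_fun_comp; first exact: continuous_cosp_clamp.
  by apply: continuous_funM; [exact: continuous_fun_cst|move=> t; exact: cvg_id].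
have C0 x : 0 <= C x by exact: powR_ge0.
have Cpos x : 0 < x < 2^-1 -> 0 < C x by move=> /m_in; exact: cosp_clamp_gt0.
apply: (@coeff_energy_le _ g continuous_cosp_dilation cosp_dilation_reflect A A' g').
- apply: continuous_fun_within; apply: continuous_funM; first exact: continuous_fun_cst.
  apply: continuous_funB; apply: continuous_funM; try exact: continuous_fun_cst.
    exact: continuous_funX.
  exact: continuous_ge0_powR.
- move=> x xI; apply: is_derive_funZ; apply: is_derive_funB; apply: is_derive_funZ.
    exact: is_derive_funX (dC xI).
  exact: is_derive_fun_powR (dC xI) (Cpos x xI).
- move=> x xI; apply: near_is_derive (dC xI).
  apply: filterS (near_between xI) => z /m_in zc.
  by rewrite /g cosp_quarter//; move: zc; rewrite /m -/c; lra.
- move=> x xI; have Cx := Cpos x xI; have Sx := sinp_clamp_gt0 p1 (m_in xI).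
  have CX := cosp_clampX p1 (m x); rewrite -/(C x) in CX.
  have SE : S x `^ (p - 1) = (1 - C x `^ p) `^ r.
    rewrite CX subKr -powRrM; congr (_ `^ _).
    by rewrite /r mulrCA mulfV ?mulr1// gt_eqF.
  have r01 : 0 < r < 1.
    by rewrite /r divr_gt0 ?subr_gt0//= ltr_pdivrMr//; lra.
  have Cp1 : 0 <= 1 - C x `^ p.
    by rewrite CX subKr powR_ge0.
  have hS := powR_le_tangent r01 Cp1; rewrite -SE in hS.
  have E1 : C x `^ (3 - p - 1) = C x `^ (2 - p) by congr (_ `^ _); lra.
  have E2 : C x ^+ 2 = C x `^ (2 - p) * C x `^ p.
    rewrite -powRD; last by rewrite (gt_eqF Cx) implybT.
    by rewrite subrK -powR_mulrn// ltW.
  have -> : A' x = pip p ^+ 2 * (S x `^ (p - 1) * (C x `^ (2 - p)) ^+ 2 *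
      (1 - r * C x `^ p)).
    rewrite /A' /g' E1 E2; field.
    by rewrite gt_eqF.
  have -> : g' x ^+ 2 = pip p ^+ 2 * (S x `^ (p - 1) * (C x `^ (2 - p)) ^+ 2 *
      S x `^ (p - 1)).
    by rewrite /g'; ring.
  apply: ler_wpM2l; first exact: sqr_ge0.
  apply: ler_wpM2l; first by rewrite mulr_ge0 ?powR_ge0 ?sqr_ge0.
  by apply: le_trans hS _; lra.
- rewrite /A; have -> : C 2^-1 = 0.
    apply: cosp_clamp_ge => //; rewrite /m /pip -/c; lra.
  have -> : C 0 = 1.
    by rewrite /C (cosp_clamp_le0 p1)// /m mulr0.
  rewrite powR1 powR0 ?(gt_eqF p30)//.
  rewrite /r le_eqVlt; apply/orP; left; apply/eqP; field.
  by rewrite !gt_eqF.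
Qed.

End CosineCoefficients.

Theorem theorem1 (R : realType) :
  exists p0 p1 : R,
    [/\ 1 < p0, p0 < 3 / 2, 11 / 5 < p1 &
      forall p s : R, p0 <= p <= p1 -> 1 < s ->
        schauder_basis_Lfun (lebesgue01 R) s
          (fun (n : nat) (x : R) => cosp p (n%:R * pip p * x))].
Proof.
(* The ends of the range of [Fp1_cube_lt], just beyond 3/2 and 11/5. *)
exists (149 / 100), (221 / 100); split; [lra..|].
move=> p s pI s1; have p1 : 1 < p by lra.
have p3 : p < 3 by lra.
have k2 := pip_ge2 p1; have k0 : 0 < pip p by lra.
pose g (x : R) := cosp p (pip p * x).
rewrite (_ : (fun _ _ => _) = fun (n : nat) (x : R) => g (n%:R * x)); last first.
  by apply/funext => n; apply/funext => x; rewrite /g mulrA [_ * n%:R]mulrC.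
have cg : continuous g := continuous_cosp_dilation p1.
have gr : forall x, g (1 - x) = - g x := cosp_dilation_reflect p1.
have ge : forall x, g (- x) = g x by move=> x; rewrite /g mulrN (cospN p1).
pose B := pip p * ((3 - p)^-1 - (p - 1) / (3 * p)).
have hA1 := first_cosp_coeff_ge p1.
have pi0 : 0 < pi :> R := pi_gt0 R.
have A1 : 0 < cos_coeff 1 g by apply: lt_le_trans hA1; rewrite divr_gt0// mulr_gt0.
apply: (@dilation_basis _ s s1 g
  (B / (2 * pi ^+ 2 * cos_coeff 1 g) + 3 / 8 * cos_coeff 1 g)) => //.
- move=> x; rewrite /g (_ : pip p * (x + 2) = pip p * x + pip p + pip p); last by ring.
  by rewrite !(cospD_pip p1) opprK.
- by rewrite /g mulr0 (cosp0 p1) oner_eq0.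
- exact: cos_coeff_even.
- move=> J; apply: tail_sum_le => //.
    by move=> j; exact: cos_coeff_even.
  exact: cosp_coeff_energy_le.
- have hB : pip p ^+ 3 * ((3 - p)^-1 - (p - 1) / (3 * p)) < 80.
    have := Fp1_cube_lt pI; rewrite /pip exprMn; lra.
  have h8 : 8 <= cos_coeff 1 g * pi * pip p.
    have pk : 0 < pi * pip p by exact: mulr_gt0.
    by rewrite -mulrA -(ler_pdivrMr _ _ pk).
  move: (cos_coeff 1 g) A1 h8 => a a0 h8.
  have d0 : 0 < 2 * pi ^+ 2 * a by rewrite !mulr_gt0// exprn_gt0.
  have h64 : 64 <= a ^+ 2 * pi ^+ 2 * pip p ^+ 2.
    rewrite -!exprMn (_ : 64 = 8 ^+ 2); last by ring.
    by rewrite lerXn2r ?nnegrE//; apply: le_trans h8.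
  have hB2 : B * pip p ^+ 2 < 80 by apply: le_lt_trans hB; rewrite /B; lra.
  (* Cleared of denominators and multiplied by pi_p^2, this is B pi_p^2 < 80 <= (5 / 4) a_1^2 pi^2
     pi_p^2. *)
  suff : B / (2 * pi ^+ 2 * a) < 5 / 8 * a by lra.
  rewrite ltr_pdivrMr// -(ltr_pM2r (exprn_gt0 2 k0)); lra.
Qed.
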